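(* Let $n,d\ge 1$ be integers and $v$ an indeterminate. Over $\mathbb{Q}(v)$, the $q$-Schur algebra $\mathbf{S}(n,d)$ is isomorphic to the associative $\mathbb{Q}(v)$-algebra (with $1$) on generators $E_i,F_i$ ($1\le i\le n-1$) and $K_i^{\pm1}$ ($1\le i\le n$) subject to the following relations (for all admissible indices $i,j$): \begin{align*} &\text{(Q1)}\quad K_iK_j=K_jK_i,\qquad K_iK_i^{-1}=K_i^{-1}K_i=1;\\ &\text{(Q2)}\quad E_iF_j-F_jE_i=\delta_{ij}\frac{K_iK_{i+1}^{-1}-K_i^{-1}K_{i+1}}{v-v^{-1}};\\ &\text{(Q3)}\quad K_iE_j=v^{(\varepsilon_i,\alpha_j)}E_jK_i,\qquad K_iF_j=v^{-(\varepsilon_i,\alpha_j)}F_jK_i;\\ &\text{(Q4)}\quad E_i^2E_j-(v+v^{-1})E_iE_jE_i+E_jE_i^2=0\ \text{ if }|i-j|=1,\qquad E_iE_j-E_jE_i=0\ \text{ otherwise};\\ &\text{(Q5)}\quad F_i^2F_j-(v+v^{-1})F_iF_jF_i+F_jF_i^2=0\ \text{ if }|i-j|=1,\qquad F_iF_j-F_jF_i=0\ \text{ otherwise};\\ &\text{(Q6)}\quad K_1K_2\cdots K_n=v^d;\\ &\text{(Q7)}\quad (K_j-1)(K_j-v)(K_j-v^2)\cdots(K_j-v^d)=0\qquad(j=1,\dots,n). \end{align*}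
   Context: $\{\varepsilon_1,\dots,\varepsilon_n\}$ is the standard basis of $\mathbb{Z}^n$, $(\ ,\ )$ is the bilinear form on $\mathbb{Z}^n$ with $(\varepsilon_i,\varepsilon_j)=\delta_{ij}$, and $\alpha_j=\varepsilon_j-\varepsilon_{j+1}$. The algebra with only the relations (Q1)–(Q5) is the Drinfeld–Jimbo quantized enveloping algebra $\mathbf{U}=\mathbf{U}_v(\mathfrak{gl}_n)$. The $q$-Schur algebra is $\mathbf{S}(n,d)=\operatorname{End}_{\mathbf{H}}(V^{\otimes d})$, where $V$ is the $\mathbb{Q}(v)$-vector space with basis $v_1,\dots,v_n$ and $\mathbf{H}=\mathbf{H}(\Sigma_d)$ is the Hecke algebra of $\Sigma_d$ over $\mathbb{Q}(v)$, generated by $T_1,\dots,T_{d-1}$ with the braid relations and $(T_r-v)(T_r+v^{-1})=0$, acting on $V^{\otimes d}$ in the standard way: $T_r$ acts on tensor places $r,r+1$ by $v_a\otimes v_a\mapsto v\,v_a\otimes v_a$; $v_a\otimes v_b\mapsto v_b\otimes v_a$ if $a<b$; $v_a\otimes v_b\mapsto v_b\otimes v_a+(v-v^{-1})v_a\otimes v_b$ if $a>b$. *)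

(* Defs.v *)
From HB Require Import structures.
From mathcomp Require Import all_boot all_order all_algebra all_fingroup.
From mathcomp Require Import finmap generic_quotient ring_quotient.
From mathcomp Require Import boolp xfinmap monalg ring zify.

Set Implicit Arguments.
Unset Strict Implicit.
Unset Printing Implicit Defensive.

Import GRing.Theory Num.Theory.

Local Open Scope ring_scope.
Local Open Scope quotient_scope.

Section FreeAlgebra.
Variables (F : fieldType) (X : choiceType).

(* {malg F[{fmonom X}]} is the algebra of the free monoid on X, i.e. the free
   associative unital F-algebra on X. *)
Definition freeAlg := {malg F[{fmonom X}]}.
HB.instance Definition _ := GRing.Lalgebra.on freeAlg.

Definition gen (x : X) : freeAlg := mkmalgU (fmu x) 1.

Lemma free_scalerAr (c : F) (a b : freeAlg) : c *: (a * b) = a * (c *: b).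
Proof.
apply/malgP=> k; rewrite mcoeffZ.
rewrite [in LHS](mcoeffMlw k (fsubset_refl (msupp a)) (fsubset_refl (msupp b))).
rewrite [in RHS](mcoeffMlw k (fsubset_refl (msupp a)) (msuppZ_le c b)).
rewrite mulr_sumr; apply: eq_bigr => k1 _; rewrite mulr_sumr.
by apply: eq_bigr => k2 _; rewrite mcoeffZ mulrCA mulrnAr.
Qed.

Section FreeAction.
Variables (V : lmodType F) (T : X -> {linear V -> V}).

(* The left action of the free algebra in which the generator x acts by T x;
   products act by composition (freeActM). *)
Definition wordAct (w : {fmonom X}) (u : V) : V := foldr (fun x => T x) u w.

Definition freeAct (a : freeAlg) (u : V) : V :=
  \sum_(w <- msupp a) a@_w *: wordAct w u.

Lemma wordActP w : linear (wordAct w).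
Proof.
rewrite /wordAct => c u1 u2; elim: (fmonom_val w) => [//|x s IHs] /=.
by rewrite IHs linearP.
Qed.

HB.instance Definition _ w :=
  GRing.isLinear.Build F V V _ (wordAct w) (wordActP w).

Lemma freeActP a : linear (freeAct a).
Proof.
move=> c u1 u2; rewrite /freeAct scaler_sumr -big_split; apply: eq_bigr => w _.
by rewrite /= wordActP scalerDr !scalerA mulrC.
Qed.
HB.instance Definition _ a :=
  GRing.isLinear.Build F V V _ (freeAct a) (freeActP a).

Lemma freeActEw (d : {fset {fmonom X}}) a u : (msupp a `<=` d)%fset ->
  freeAct a u = \sum_(w <- d) a@_w *: wordAct w u.
Proof.
move=> le; rewrite [LHS](big_fset_incl _ le) => //= w wd /mcoeff_outdom ->.
by rewrite scale0r.
Qed.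

Lemma freeActD a b u : freeAct (a + b) u = freeAct a u + freeAct b u.
Proof.
rewrite (freeActEw _ (msuppD_le a b)) (freeActEw u (fsubsetUl (msupp a) (msupp b))).
rewrite (freeActEw u (fsubsetUr (msupp a) (msupp b))) -big_split /=.
by apply: eq_bigr => w _; rewrite mcoeffD scalerDl.
Qed.

Lemma freeAct0 u : freeAct 0 u = 0.
Proof. by rewrite /freeAct msupp0 big_seq_fset0. Qed.

Lemma freeActZ c a u : freeAct (c *: a) u = c *: freeAct a u.
Proof.
rewrite (freeActEw _ (msuppZ_le c a)) scaler_sumr; apply: eq_bigr => w _.
by rewrite mcoeffZ scalerA.
Qed.

Lemma freeActB a b u : freeAct (a - b) u = freeAct a u - freeAct b u.
Proof. by rewrite freeActD -[- b]scaleN1r freeActZ scaleN1r. Qed.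

Lemma freeAct_sum I (s : seq I) (a : I -> freeAlg) u :
  freeAct (\sum_(i <- s) a i) u = \sum_(i <- s) freeAct (a i) u.
Proof.
exact: (big_morph (freeAct^~ u) (fun a b => freeActD a b u) (freeAct0 u)).
Qed.

Lemma freeActU c w u : freeAct << c *g w >> u = c *: wordAct w u.
Proof. by rewrite (freeActEw _ msuppU_le) big_seq_fset1 mcoeffUU. Qed.

Lemma freeAct_gen x u : freeAct (gen x) u = T x u.
Proof. by rewrite /gen freeActU scale1r /wordAct fmU. Qed.

Lemma freeAct1 u : freeAct 1 u = u.
Proof. by rewrite [1]/(mkmalgU _ _) freeActU scale1r /wordAct fm1. Qed.

Lemma freeActM a b u : freeAct (a * b) u = freeAct a (freeAct b u).
Proof.
rewrite malgME freeAct_sum {2}/freeAct; apply: eq_bigr => w1 _.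
rewrite freeAct_sum [freeAct b u]/freeAct.
rewrite linear_sum scaler_sumr; apply: eq_bigr => w2 _.
rewrite linearZ /=.
by rewrite freeActU scalerA /wordAct fmM foldr_cat.
Qed.

End FreeAction.
End FreeAlgebra.

Section Presentation.
Variables (F : fieldType) (X : choiceType).
Variable R : freeAlg F X -> freeAlg F X -> Prop.

(* R a b stands for the defining relation a = b; relIdeal is the two-sided
   ideal generated by the differences a - b. *)
Inductive relIdeal : freeAlg F X -> Prop :=
| relIdeal_rel a b of R a b : relIdeal (a - b)
| relIdeal0 : relIdeal 0
| relIdealB a b of relIdeal a & relIdeal b : relIdeal (a - b)
| relIdealMl a b of relIdeal b : relIdeal (a * b)
| relIdealMr a b of relIdeal a : relIdeal (a * b).

Definition relIdealb : pred (freeAlg F X) := fun a => `[< relIdeal a >].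

Lemma relIdeal_zmod_closed : zmod_closed relIdealb.
Proof.
split; first exact/asboolP/relIdeal0.
by move=> a b /asboolP Ia /asboolP Ib; apply/asboolP/relIdealB.
Qed.
HB.instance Definition _ :=
  GRing.isZmodClosed.Build (freeAlg F X) relIdealb relIdeal_zmod_closed.

(* The algebra generated by X subject to R. The algType structures assume
   1 != 0, which may fail here, so presAlg is a pzRingType and an lmodType F;
   pres_scalerAl and pres_scalerAr say that these make it an F-algebra. *)
Definition presAlg :=
  {ideal_quot (Algebra.ZmodClosed.clone (freeAlg F X) relIdealb _)}.
HB.instance Definition _ := GRing.Zmodule.on presAlg.
HB.instance Definition _ := EqQuotient.on presAlg.

Definition presPi (a : freeAlg F X) : presAlg := \pi a.

Lemma presPiE a b : presPi a = presPi b <-> relIdeal (a - b).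
Proof.
split=> [/eqP|H]; last apply/eqP; rewrite /presPi piE /= /Quotient.equiv.
  by move/asboolP.
by apply/asboolP.
Qed.

Lemma presPi_rel a b : R a b -> presPi a = presPi b.
Proof. by move=> Rab; apply/presPiE/relIdeal_rel. Qed.

Lemma presPi_reprK x : presPi (repr x) = x.
Proof. exact: reprK. Qed.

Lemma presPiK a : relIdeal (a - repr (presPi a)).
Proof. by apply/presPiE; rewrite presPi_reprK. Qed.

Lemma presPiB : {morph presPi : a b / a - b}.
Proof. by move=> a b; rewrite /presPi !piE. Qed.

Lemma presPiD : {morph presPi : a b / a + b}.
Proof. by move=> a b; rewrite /presPi !piE. Qed.

Definition presOne : presAlg := presPi 1.
Definition presMul (x y : presAlg) : presAlg := presPi (repr x * repr y).
Definition presScale (c : F) (x : presAlg) : presAlg := presPi (c *: repr x).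

Lemma presMul_pi a b : presMul (presPi a) (presPi b) = presPi (a * b).
Proof.
apply/esym/presPiE; set a' := repr _; set b' := repr _.
have -> : a * b - a' * b' = (a - a') * b - a' * (b' - b).
  by rewrite mulrBl mulrBr opprB addrA subrK.
apply: relIdealB; first exact/relIdealMr/presPiK.
by apply: relIdealMl; apply/presPiE; rewrite presPi_reprK.
Qed.

Lemma relIdealZ c a : relIdeal a -> relIdeal (c *: a).
Proof. by move=> Ia; rewrite -[a]mul1r scalerAl; apply: relIdealMl. Qed.

Lemma presScale_pi c a : presScale c (presPi a) = presPi (c *: a).
Proof. by apply/esym/presPiE; rewrite -scalerBr; exact/relIdealZ/presPiK. Qed.

Lemma presP (P : presAlg -> Prop) : (forall a, P (presPi a)) -> forall x, P x.
Proof. by move=> PP x; rewrite -[x]presPi_reprK. Qed.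

Fact presMulA : associative presMul.
Proof.
by elim/presP=> a; elim/presP=> b; elim/presP=> c; rewrite !presMul_pi mulrA.
Qed.
Fact presMul1 : left_id presOne presMul.
Proof. by elim/presP=> a; rewrite presMul_pi mul1r. Qed.
Fact presMulr1 : right_id presOne presMul.
Proof. by elim/presP=> a; rewrite presMul_pi mulr1. Qed.
Fact presMulDl : left_distributive presMul +%R.
Proof.
elim/presP=> a; elim/presP=> b; elim/presP=> c.
by rewrite -presPiD !presMul_pi -presPiD mulrDl.
Qed.
Fact presMulDr : right_distributive presMul +%R.
Proof.
elim/presP=> a; elim/presP=> b; elim/presP=> c.
by rewrite -presPiD !presMul_pi -presPiD mulrDr.
Qed.
HB.instance Definition _ := GRing.Zmodule_isPzRing.Build presAlg
  presMulA presMul1 presMulr1 presMulDl presMulDr.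

Fact presScaleA c d x : presScale c (presScale d x) = presScale (c * d) x.
Proof. by elim/presP: x => a; rewrite !presScale_pi scalerA. Qed.
Fact presScale1 : left_id 1 presScale.
Proof. by elim/presP=> a; rewrite presScale_pi scale1r. Qed.
Fact presScaleDr : right_distributive presScale +%R.
Proof.
move=> c; elim/presP=> a; elim/presP=> b.
by rewrite -presPiD !presScale_pi -presPiD scalerDr.
Qed.
Fact presScaleDl x : {morph presScale^~ x : c d / c + d}.
Proof.
by move=> c d; elim/presP: x => a; rewrite !presScale_pi -presPiD scalerDl.
Qed.
HB.instance Definition _ := GRing.Zmodule_isLmodule.Build F presAlg
  presScaleA presScale1 presScaleDr presScaleDl.

Lemma presMulE x y : x * y = presMul x y. Proof. exact: erefl. Qed.
Lemma presScaleE c x : c *: x = presScale c x. Proof. exact: erefl. Qed.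
Lemma presOneE : 1 = presPi 1. Proof. exact: erefl. Qed.

Lemma presPi_linear : linear presPi.
Proof. by move=> c a b; rewrite presPiD presScaleE presScale_pi. Qed.
HB.instance Definition _ :=
  GRing.isLinear.Build F (freeAlg F X) presAlg _ presPi presPi_linear.

Lemma presPi_monoid_morphism : monoid_morphism presPi.
Proof.
split; first exact/esym/presOneE.
by move=> a b; rewrite presMulE presMul_pi.
Qed.
HB.instance Definition _ :=
  GRing.isMonoidMorphism.Build (freeAlg F X) presAlg presPi
    presPi_monoid_morphism.

Lemma pres_scalerAl c (x y : presAlg) : c *: (x * y) = (c *: x) * y.
Proof.
elim/presP: x => a; elim/presP: y => b.
by rewrite -rmorphM -!linearZ -rmorphM /= -scalerAl.
Qed.

Lemma pres_scalerAr c (x y : presAlg) : c *: (x * y) = x * (c *: y).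
Proof.
elim/presP: x => a; elim/presP: y => b.
by rewrite -rmorphM -!linearZ -rmorphM /= free_scalerAr.
Qed.

Section Action.
Variables (V : lmodType F) (T : X -> {linear V -> V}).

(* Independent of the choice of representatives by presAct_pi, as soon as the
   operators T satisfy the relations. *)
Definition presAct (x : presAlg) : V -> V := freeAct T (repr x).
HB.instance Definition _ x := GRing.Linear.on (presAct x).

Hypothesis T_rel : forall a b, R a b -> freeAct T a =1 freeAct T b.

Lemma freeAct_relIdeal a u : relIdeal a -> freeAct T a u = 0.
Proof.
move=> Ia; elim: Ia u => {a} [a b Rab|//|a b _ IHa _ IHb|a b _ IHb|a b _ IHa] u.
- by rewrite freeActB (T_rel Rab) subrr.
- exact: freeAct0.
- by rewrite freeActB IHa IHb subrr.
- by rewrite freeActM IHb linear0.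
- by rewrite freeActM IHa.
Qed.

Lemma presAct_pi a u : presAct (presPi a) u = freeAct T a u.
Proof.
by apply/esym/eqP; rewrite -subr_eq0 -freeActB freeAct_relIdeal //; apply: presPiK.
Qed.

Lemma presAct1 u : presAct 1 u = u.
Proof. by rewrite presAct_pi freeAct1. Qed.

Lemma presActM x y u : presAct (x * y) u = presAct x (presAct y u).
Proof.
elim/presP: x => a; elim/presP: y => b.
by rewrite -rmorphM !presAct_pi freeActM.
Qed.

Lemma presActD x y u : presAct (x + y) u = presAct x u + presAct y u.
Proof.
elim/presP: x => a; elim/presP: y => b.
by rewrite -raddfD !presAct_pi freeActD.
Qed.

Lemma presActZ c x u : presAct (c *: x) u = c *: presAct x u.
Proof. by elim/presP: x => a; rewrite -linearZ !presAct_pi freeActZ. Qed.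

End Action.
End Presentation.

Section Indices.
Variable n : nat.

(* Indices are shifted by one: i : 'I_n.-1 stands for i.+1 in {1, .., n - 1},
   and lo i, hi i : 'I_n stand for i.+1, i.+2 in {1, .., n}. *)
Definition lo (i : 'I_n.-1) : 'I_n := widen_ord (leq_pred n) i.

Fact hi_subproof (i : 'I_n.-1) : (i.+1 < n)%N.
Proof. by case: n i => [[]|m []]. Qed.
Definition hi (i : 'I_n.-1) : 'I_n := Ordinal (hi_subproof i).

Definition adjacent (i j : 'I_n.-1) : bool := `|i%:Z - j%:Z| == 1.

End Indices.

Section TensorSpace.
Variables (F : fieldType) (n d : nat).

(* The d-th tensor power of V = F^n, in coordinates: x t is the coefficient of
   the basis vector tbasis t = v_(t_1) (x) ... (x) v_(t_d). *)
Definition tens := {ffun d.-tuple 'I_n -> F^o}.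
HB.instance Definition _ := Vector.on tens.

Definition tbasis (t : d.-tuple 'I_n) : tens := [ffun s => (s == t)%:R].

Lemma tens_expand (x : tens) : x = \sum_t x t *: tbasis t.
Proof.
apply/ffunP=> s; rewrite sum_ffunE (bigD1 s) //= big1 => [|t /negPf nts].
  by rewrite !ffunE eqxx addr0 [RHS]mulr1.
by rewrite !ffunE eq_sym nts [LHS]mulr0.
Qed.

Lemma tens_linear_eq (f g : {linear tens -> tens}) :
  (forall t, f (tbasis t) = g (tbasis t)) -> f =1 g.
Proof.
move=> efg x; rewrite (tens_expand x) !linear_sum; apply: eq_bigr => t _.
by rewrite !linearZ /= efg.
Qed.

Definition swap (r : 'I_d.-1) (t : d.-tuple 'I_n) : d.-tuple 'I_n :=
  [tuple tnth t (tperm (lo r) (hi r) i) | i < d].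

Variable q : F.

Definition heckeBasis (r : 'I_d.-1) (t : d.-tuple 'I_n) : tens :=
  let a := tnth t (lo r) in
  let b := tnth t (hi r) in
  if a == b then q *: tbasis t
  else if (a < b)%N then tbasis (swap r t)
  else tbasis (swap r t) + (q - q^-1) *: tbasis t.

Definition heckeOp (r : 'I_d.-1) (x : tens) : tens :=
  \sum_t x t *: heckeBasis r t.

Fact heckeOp_linear r : linear (heckeOp r).
Proof.
move=> c x y; rewrite /heckeOp scaler_sumr -big_split; apply: eq_bigr => t _.
by rewrite !ffunE /= scalerDl scalerA.
Qed.
HB.instance Definition _ r :=
  GRing.isLinear.Build F tens tens _ (heckeOp r) (heckeOp_linear r).

Lemma heckeOp_basis r t : heckeOp r (tbasis t) = heckeBasis r t.
Proof.
rewrite /heckeOp (bigD1 t) //= big1 => [|s /negPf nst].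
  by rewrite ffunE eqxx scale1r addr0.
by rewrite ffunE nst scale0r.
Qed.

Notation HF := (freeAlg F 'I_d.-1).
Notation T := (@gen F 'I_d.-1).

Inductive heckeRel : HF -> HF -> Prop :=
| heckeRel_braid r s of adjacent r s :
    heckeRel (T r * T s * T r) (T s * T r * T s)
| heckeRel_comm r s of ~~ adjacent r s : heckeRel (T r * T s) (T s * T r)
| heckeRel_quad r : heckeRel ((T r - q%:A) * (T r + q^-1%:A)) 0.

Definition heckeAlg := presAlg heckeRel.
HB.instance Definition _ := GRing.PzRing.on heckeAlg.
HB.instance Definition _ := GRing.Lmodule.on heckeAlg.

(* The action of the Hecke algebra in which T_r acts by heckeOp r; heckeRel_act
   checks that these operators satisfy the relations. *)
Definition heckeAct (h : heckeAlg) (x : tens) : tens := presAct heckeOp h x.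

Section HeckeRelations.
Hypothesis q0 : q != 0.

Let al (r : 'I_d.-1) (t : d.-tuple 'I_n) : F :=
  let a := tnth t (lo r) in let b := tnth t (hi r) in
  if a == b then q else if (a < b)%N then 0 else q - q^-1.
Let be (r : 'I_d.-1) (t : d.-tuple 'I_n) : F :=
  (tnth t (lo r) != tnth t (hi r))%:R.

Let heckeE r t :
  heckeOp r (tbasis t) = be r t *: tbasis (swap r t) + al r t *: tbasis t.
Proof.
rewrite heckeOp_basis /heckeBasis /al /be /=; case: eqP => _ /=.
  by rewrite scale0r add0r.
by case: ifP => _; rewrite !scale1r ?scale0r ?addr0.
Qed.

Let tnth_swap r t i : tnth (swap r t) i = tnth t (tperm (lo r) (hi r) i).
Proof. exact: tnth_mktuple. Qed.

Let swapK r t : swap r (swap r t) = t.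
Proof. by apply: eq_from_tnth => i; rewrite !tnth_swap tpermK. Qed.

Let lohi m (r : 'I_m.-1) : lo r != hi r.
Proof. by rewrite -val_eqE /= neq_ltn leqnn. Qed.

Let opD r x y : heckeOp r (x + y) = heckeOp r x + heckeOp r y.
Proof. exact: linearD. Qed.
Let opZ r c x : heckeOp r (c *: x) = c *: heckeOp r x.
Proof. exact: linearZ. Qed.

Let evD (x y : tens) z : (x + y) z = x z + y z.
Proof. exact: ffunE. Qed.
Let evZ c (x : tens) z : (c *: x) z = c * x z.
Proof. exact: ffunE. Qed.

Let act2 r s u : freeAct heckeOp (T r * T s) u = heckeOp r (heckeOp s u).
Proof. by rewrite freeActM 2!freeAct_gen. Qed.

Let act3 r s p u :
  freeAct heckeOp (T r * T s * T p) u = heckeOp r (heckeOp s (heckeOp p u)).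
Proof. by rewrite freeActM act2 freeAct_gen. Qed.

Let actB r c u :
  freeAct heckeOp (T r - c%:A) u = heckeOp r u + (- c) *: u.
Proof. by rewrite freeActB freeActZ freeAct1 freeAct_gen scaleNr. Qed.

Let actD r c u :
  freeAct heckeOp (T r + c%:A) u = heckeOp r u + c *: u.
Proof. by rewrite freeActD freeActZ freeAct1 freeAct_gen. Qed.

Let adjacentP (r s : 'I_d.-1) : adjacent r s -> (hi r = lo s) \/ (hi s = lo r).
Proof.
rewrite /adjacent => rs.
suff [?|?] : (s = r.+1 :> nat) \/ (r = s.+1 :> nat).
- by left; apply: val_inj.
- by right; apply: val_inj.
by lia.
Qed.

Let hecke_quad r t :
  freeAct heckeOp ((T r - q%:A) * (T r + q^-1%:A)) (tbasis t) = 0.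
Proof.
rewrite freeActM actD actB.
rewrite !(heckeE, opD, opZ) swapK /al /be !tnth_swap tpermL tpermR.
move: (tbasis (swap r t)) (tbasis t) => b2 b1.
apply/ffunP=> z; rewrite !(evD, evZ).
rewrite -![tnth _ _ == tnth _ _]val_eqE.
rewrite [RHS]ffunE.
case: (ltngtP (tnth t (lo r)) (tnth t (hi r))) => /= cmp; by field.
Qed.

Let hecke_comm r s t : ~~ adjacent r s ->
  heckeOp r (heckeOp s (tbasis t)) = heckeOp s (heckeOp r (tbasis t)).
Proof.
case: (eqVneq r s) => [-> //|nrs]; rewrite /adjacent => rs.
have [h1 [h2 [h3 h4]]] : lo r != lo s /\ lo r != hi s /\ hi r != lo s /\ hi r != hi s.
  by move: nrs rs; rewrite -!val_eqE /=; lia.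
have ss : swap r (swap s t) = swap s (swap r t).
  apply: eq_from_tnth => i; rewrite !tnth_swap; congr (tnth t _).
  move/eqP: h1 => h1; move/eqP: h2 => h2; move/eqP: h3 => h3; move/eqP: h4 => h4.
  have /eqP h5 := lohi r; have /eqP h6 := lohi s.
  by case: (tpermP (lo r) (hi r) i) => *; case: (tpermP (lo s) (hi s) i) => *;
     repeat (case: tpermP => * ); congruence.
have e1 : tnth (swap s t) (lo r) = tnth t (lo r) by rewrite tnth_swap tpermD // eq_sym.
have e2 : tnth (swap s t) (hi r) = tnth t (hi r) by rewrite tnth_swap tpermD // eq_sym.
have e3 : tnth (swap r t) (lo s) = tnth t (lo s) by rewrite tnth_swap tpermD // eq_sym.
have e4 : tnth (swap r t) (hi s) = tnth t (hi s) by rewrite tnth_swap tpermD // eq_sym.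
rewrite !(heckeE, opD, opZ) ss /al /be e1 e2 e3 e4.
move: (tbasis (swap s (swap r t))) (tbasis (swap r t)) (tbasis (swap s t))
  (tbasis t) => b4 b3 b2 b1.
apply/ffunP=> z; rewrite !ffunE /GRing.scale /=; ring.
Qed.

Let hecke_braid r s t : hi r = lo s ->
  heckeOp r (heckeOp s (heckeOp r (tbasis t))) =
  heckeOp s (heckeOp r (heckeOp s (tbasis t))).
Proof.
move=> rs.
have h1 : lo r != lo s by rewrite -rs.
have h2 : lo s != hi s by [].
have h3 : lo r != hi s.
  by move/(congr1 val): rs; rewrite -!val_eqE /=; lia.

have rL u : tnth (swap r u) (lo r) = tnth u (lo s) by rewrite tnth_swap tpermL rs.
have rR u : tnth (swap r u) (lo s) = tnth u (lo r) by rewrite -rs tnth_swap tpermR.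
have rD u : tnth (swap r u) (hi s) = tnth u (hi s).
  by rewrite tnth_swap tpermD // rs.
have sL' u : tnth (swap s u) (lo s) = tnth u (hi s) by rewrite tnth_swap tpermL.
have sR u : tnth (swap s u) (hi s) = tnth u (lo s) by rewrite tnth_swap tpermR.
have sD u : tnth (swap s u) (lo r) = tnth u (lo r).
  by rewrite tnth_swap tpermD // eq_sym.
have ss : swap r (swap s (swap r t)) = swap s (swap r (swap s t)).
  apply: eq_from_tnth => i; rewrite !tnth_swap; congr (tnth t _).
  have E1 : tperm (lo r) (lo s) (hi s) = hi s by apply: tpermD.
  have E2 : tperm (lo s) (hi s) (lo r) = lo r by apply: tpermD; rewrite eq_sym.
  rewrite rs; have [-> | nr] := eqVneq i (lo r).
    by rewrite !(tpermL, tpermR, E1, E2).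
  have [-> | ns] := eqVneq i (lo s); first by rewrite !(tpermL, tpermR, E1, E2).
  have [-> | nh] := eqVneq i (hi s); first by rewrite !(tpermL, tpermR, E1, E2).
  by rewrite !tpermD // eq_sym.
rewrite !(heckeE, opD, opZ) ss !swapK.
rewrite /al /be rs !(rL, rR, rD, sL', sR, sD).
move: (tbasis (swap s (swap r (swap s t)))) (tbasis (swap r (swap s t)))
  (tbasis (swap s (swap r t))) (tbasis (swap r t)) (tbasis (swap s t))
  (tbasis t) => e6 e5 e4 e3 e2 e1.
apply/ffunP=> z; rewrite !(evD, evZ).
rewrite -![tnth _ _ == tnth _ _]val_eqE.
case: (ltngtP (tnth t (lo r)) (tnth t (lo s))) => /= c1;
case: (ltngtP (tnth t (lo s)) (tnth t (hi s))) => /= c2;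
case: (ltngtP (tnth t (lo r)) (tnth t (hi s))) => /= c3;
try lia; field => //.
Qed.

Lemma heckeRel_act a b :
  heckeRel a b -> freeAct heckeOp a =1 freeAct heckeOp b.
Proof.
move=> Rab; apply: tens_linear_eq => t.
case: Rab => {a b} [r s rs|r s rs|r].
- apply: etrans (act3 r s r _) (etrans _ (esym (act3 s r s _))).
  by case: (adjacentP rs) => /hecke_braid->.
- exact: etrans (act2 r s _) (etrans (hecke_comm t rs) (esym (act2 s r _))).
- exact: etrans (hecke_quad r t) (esym (freeAct0 _ _)).
Qed.

Lemma heckeAct_gen r x : heckeAct (presPi heckeRel (T r)) x = heckeOp r x.
Proof.
rewrite /heckeAct (presAct_pi heckeRel_act).
exact: (freeAct_gen heckeOp r x).
Qed.

Lemma heckeAct1 x : heckeAct 1 x = x.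
Proof. exact: (presAct1 heckeRel_act). Qed.

Lemma heckeActM (g h : heckeAlg) x :
  heckeAct (g * h) x = heckeAct g (heckeAct h x).
Proof. exact: (presActM heckeRel_act). Qed.

Lemma heckeActD (g h : heckeAlg) x :
  heckeAct (g + h) x = heckeAct g x + heckeAct h x.
Proof. exact: (presActD heckeRel_act). Qed.

Lemma heckeActZ c (h : heckeAlg) x : heckeAct (c *: h) x = c *: heckeAct h x.
Proof. exact: (presActZ heckeRel_act). Qed.

End HeckeRelations.
End TensorSpace.

Section SchurAlgebra.
Variables (F : fieldType) (n d : nat) (q : F).
Local Notation V := (tens F n d).

Definition isHeckeLinear (f : 'End(V)) : bool :=
  `[< forall (h : heckeAlg d q) (x : V),
        f (heckeAct h x) = heckeAct h (f x) >].

Fact isHeckeLinear_submod : submod_closed isHeckeLinear.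
Proof.
split=> [|c f g /asboolP fH /asboolP gH]; apply/asboolP => h x.
  by rewrite !zero_lfunE /heckeAct linear0.
by rewrite !add_lfunE !scale_lfunE fH gH /heckeAct linearP.
Qed.
HB.instance Definition _ :=
  GRing.isSubmodClosed.Build F 'End(V) isHeckeLinear isHeckeLinear_submod.

(* End_H of the tensor power, with composition as product. *)
Record qSchur : predArgType :=
  QSchur { qSchur_val :> 'End(V); _ : isHeckeLinear qSchur_val }.
HB.instance Definition _ := [isSub for qSchur_val].
HB.instance Definition _ := [Choice of qSchur by <:].
HB.instance Definition _ := [SubChoice_isSubLmodule of qSchur by <:].

Lemma qSchurP (f : qSchur) (h : heckeAlg d q) (x : V) :
  f (heckeAct h x) = heckeAct h (f x).
Proof. by case: f => f /= /asboolP. Qed.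

Fact isHeckeLinear1 : isHeckeLinear \1%VF.
Proof. by apply/asboolP => h x; rewrite !id_lfunE. Qed.

Fact isHeckeLinearM (f g : qSchur) : isHeckeLinear (f \o g)%VF.
Proof. by apply/asboolP => h x; rewrite !comp_lfunE !qSchurP. Qed.

Definition qSchurOne : qSchur := QSchur isHeckeLinear1.
Definition qSchurMul (f g : qSchur) : qSchur := QSchur (isHeckeLinearM f g).

Fact qSchurMulA : associative qSchurMul.
Proof. by move=> f g h; apply: val_inj; rewrite /= comp_lfunA. Qed.
Fact qSchurMul1 : left_id qSchurOne qSchurMul.
Proof. by move=> f; apply: val_inj; rewrite /= comp_lfun1l. Qed.
Fact qSchurMulr1 : right_id qSchurOne qSchurMul.
Proof. by move=> f; apply: val_inj; rewrite /= comp_lfun1r. Qed.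
Fact qSchurMulDl : left_distributive qSchurMul +%R.
Proof. by move=> f g h; apply: val_inj; rewrite /= comp_lfunDl. Qed.
Fact qSchurMulDr : right_distributive qSchurMul +%R.
Proof. by move=> f g h; apply: val_inj; rewrite /= comp_lfunDr. Qed.
HB.instance Definition _ := GRing.Zmodule_isPzRing.Build qSchur
  qSchurMulA qSchurMul1 qSchurMulr1 qSchurMulDl qSchurMulDr.

Lemma qSchur_scalerAl c (f g : qSchur) : c *: (f * g) = (c *: f) * g.
Proof. by apply: val_inj; rewrite /= comp_lfunZl. Qed.

Lemma qSchur_scalerAr c (f g : qSchur) : c *: (f * g) = f * (c *: g).
Proof. by apply: val_inj; rewrite /= comp_lfunZr. Qed.

End SchurAlgebra.

Section SchurGenerators.
Variable n : nat.

Inductive schurGen : Type :=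
| GenE of 'I_n.-1 | GenF of 'I_n.-1 | GenK of 'I_n | GenKinv of 'I_n.

Definition schurGen_code (x : schurGen) :
    ('I_n.-1 + 'I_n.-1) + ('I_n + 'I_n) :=
  match x with
  | GenE i => inl (inl i) | GenF i => inl (inr i)
  | GenK i => inr (inl i) | GenKinv i => inr (inr i)
  end.
Definition schurGen_decode (x : ('I_n.-1 + 'I_n.-1) + ('I_n + 'I_n)) :=
  match x with
  | inl (inl i) => GenE i | inl (inr i) => GenF i
  | inr (inl i) => GenK i | inr (inr i) => GenKinv i
  end.
Fact schurGen_codeK : cancel schurGen_code schurGen_decode.
Proof. by case. Qed.
HB.instance Definition _ := Finite.copy schurGen (can_type schurGen_codeK).

Definition eps (i : 'I_n) : 'rV[int]_n := delta_mx 0 i.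
Definition alpha (j : 'I_n.-1) : 'rV[int]_n := eps (lo j) - eps (hi j).
Definition form (x y : 'rV[int]_n) : int := \sum_i x 0 i * y 0 i.

End SchurGenerators.

Section SchurPresentation.
Variables (k : fieldType) (n d : nat) (q : k).
Local Notation A := (freeAlg k (schurGen n)).

Local Notation E i := (gen k (GenE i) : A).
Local Notation F i := (gen k (GenF i) : A).
Local Notation K i := (gen k (GenK i) : A).
Local Notation K' i := (gen k (GenKinv i) : A).

Inductive schurRel : A -> A -> Prop :=
| Q1_comm i j : schurRel (K i * K j) (K j * K i)
| Q1_invr i : schurRel (K i * K' i) 1
| Q1_invl i : schurRel (K' i * K i) 1
| Q2 i j :
    schurRel (E i * F j - F j * E i)
      ((i == j)%:R *:
         ((q - q^-1)^-1 *: (K (lo i) * K' (hi i) - K' (lo i) * K (hi i))))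
| Q3_E i j :
    schurRel (K i * E j) (q ^ form (eps i) (alpha j) *: (E j * K i))
| Q3_F i j :
    schurRel (K i * F j) (q ^ (- form (eps i) (alpha j)) *: (F j * K i))
| Q4_serre i j of adjacent i j :
    schurRel (E i ^+ 2 * E j - (q + q^-1) *: (E i * E j * E i)
              + E j * E i ^+ 2) 0
| Q4_comm i j of ~~ adjacent i j : schurRel (E i * E j - E j * E i) 0
| Q5_serre i j of adjacent i j :
    schurRel (F i ^+ 2 * F j - (q + q^-1) *: (F i * F j * F i)
              + F j * F i ^+ 2) 0
| Q5_comm i j of ~~ adjacent i j : schurRel (F i * F j - F j * F i) 0
| Q6 : schurRel (\prod_(i < n) K i) (q ^+ d)%:A
| Q7 j : schurRel (\prod_(m < d.+1) (K j - (q ^+ m)%:A)) 0.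

Definition schurPres := presAlg schurRel.
HB.instance Definition _ := GRing.PzRing.on schurPres.
HB.instance Definition _ := GRing.Lmodule.on schurPres.

End SchurPresentation.

Definition Qv : fieldType := {fraction {poly rat}}.
Definition v : Qv := tofrac 'X.

(* Main.v *)
(* The generators act on the tensor power V^d through iterated coproducts, and
   this action commutes with the Hecke algebra, which gives the map to S(n,d).

   Spanning. By (Q7) the unit of the presented algebra T is a sum of weight
   vectors u_l, which are products of polynomials in the K_j. The Serre relations
   straighten a word in the E's (or in the F's) into products of blocks
   E_0^(m_0) E_1^(m_1) .. E_(k-1)^(m_(k-1)) with m nondecreasing. Since E's and F's
   commute up to shorter words on weight vectors, and weights with a negative
   entry vanish by (Q7), T is spanned by the vectors x_A u_l, where the entry
   A i j (i != j) of the matrix A counts letters moved from v_j to v_i and the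
   j-th column of A off the diagonal sums to at most l_j. Filling in the diagonal,
   these vectors correspond to the n x n matrices of naturals with sum d, hence to
   the pairs (t, s) of d-tuples that are sorted as a sequence of pairs
   (t_p, s_p).

   Bijectivity. An element of S(n,d) is determined by its coefficients at
   (v_t, v_s) for sorted pairs (t, s). The matrix of these coefficients for the
   vectors x_A u_l is triangular for the Bruhat-like order that
   compares the numbers of p with t_p < j, s_p >= i (for j <= i) and t_p >= j,
   s_p < i (for i <= j). Its diagonal entries do not vanish because all structure
   constants are positive for an ordering of Q(v). So this square matrix is
   invertible. *)
Require Import Defs.
From HB Require Import structures.
From mathcomp Require Import all_boot all_order all_algebra all_fingroup.
From mathcomp Require Import generic_quotient.
From mathcomp Require Import boolp monalg ring zify.

Set Implicit Arguments.
Unset Strict Implicit.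
Unset Printing Implicit Defensive.

Import Order.TTheory GRing.Theory Num.Theory.
Local Open Scope ring_scope.

(** * Linear identities in modules *)

(** Both sides are bounded from above by the sorted pairs: the vectors x_A u_l span T, and the
    sorted coefficients separate the elements of S(n,d). One invertible square matrix turns the two
    bounds into injectivity and surjectivity at once. The blocks are products of the E_i and F_i
    themselves rather than of root vectors. Straightening into such blocks passes through the
    q-commutator of neighbouring generators, which is then eliminated by dividing by quantum
    integers. The gain is that on V^d the nonzero matrix entries of E_i and F_i are powers of v, so
    that nothing can cancel in a product; a root vector is a difference and may bring in signs. The
    exponents m are nondecreasing because a letter going from v_k to v_i passes E_(k-1), .., E_i:
    the exponent m_i counts the letters with destination at most i, and the increments of m are the
    entries of A. The ordering of Q(v) serves twice: it also shows that the quantum integers do not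
    vanish. *)

Section LinearIdentities.
Variables (F : fieldType) (M : lmodType F).

Inductive mexp := MVar of nat | MZero | MAdd of mexp & mexp | MOpp of mexp
  | MScale of F & mexp.

Fixpoint mexp_eval (xs : seq M) e : M :=
  match e with
  | MVar i => nth 0 xs i
  | MZero => 0
  | MAdd a b => mexp_eval xs a + mexp_eval xs b
  | MOpp a => - mexp_eval xs a
  | MScale c a => c *: mexp_eval xs a
  end.

Fixpoint mexp_coef e (i : nat) : F :=
  match e with
  | MVar j => if eqn i j then 1 else 0
  | MZero => 0
  | MAdd a b => mexp_coef a i + mexp_coef b i
  | MOpp a => - mexp_coef a i
  | MScale c a => c * mexp_coef a i
  end.

Lemma mexp_evalE xs e :
  mexp_eval xs e = \sum_(i < size xs) mexp_coef e i *: nth 0 xs i.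
Proof.
elim: e => [j||a IHa b IHb|a IHa|c a IHa] /=.
- have [ltj|lej] := ltnP j (size xs); last first.
    rewrite nth_default // big1 // => i _.
    by case: eqnP (ltn_ord i) => [->|_ _]; rewrite ?scale0r // ltnNge lej.
  rewrite (bigD1 (Ordinal ltj)) //= eqnE eqxx scale1r big1 ?addr0 // => i.
  by rewrite -val_eqE /= => /negPf ->; rewrite scale0r.
- by rewrite big1 // => i _; rewrite scale0r.
- by rewrite IHa IHb -big_split; apply: eq_bigr => i _; rewrite scalerDl.
- by rewrite IHa -sumrN; apply: eq_bigr => i _; rewrite scaleNr.
- by rewrite IHa scaler_sumr; apply: eq_bigr => i _; rewrite scalerA.
Qed.

(** For a concrete list of atoms this computes to a conjunction of field equations, one per atom,
    which [ring] and [field] can close. *)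
Fixpoint mexp_same n a b :=
  if n is n'.+1 then mexp_coef a n' = mexp_coef b n' /\ mexp_same n' a b
  else True.

Lemma mexp_eq xs a b : mexp_same (size xs) a b -> mexp_eval xs a = mexp_eval xs b.
Proof.
rewrite !mexp_evalE; move: (nth 0 xs); elim: (size xs) => [|n IHn] x /=.
  by rewrite !big_ord0.
by case=> e /(IHn x) E; rewrite !big_ord_recr /= e E.
Qed.

End LinearIdentities.

Ltac lmod_find x xs :=
  match xs with
  | ?y :: _ => let _ := match goal with _ => unify x y end in constr:(0%N)
  | _ :: ?ys => let k := lmod_find x ys in constr:(S k)
  end.

Ltac lmod_atoms e xs :=
  lazymatch e with
  | (?a + ?b)%R => let ys := lmod_atoms a xs in lmod_atoms b ys
  | (- ?a)%R => lmod_atoms a xs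
  | (_ *: ?a)%R => lmod_atoms a xs
  | 0%R => xs
  | _ => match xs with
         | _ => let _ := lmod_find e xs in xs
         | _ => constr:(e :: xs)
         end
  end.

Ltac lmod_reify F e xs :=
  lazymatch e with
  | (?a + ?b)%R => let a' := lmod_reify F a xs in
                   let b' := lmod_reify F b xs in constr:(MAdd a' b')
  | (- ?a)%R => let a' := lmod_reify F a xs in constr:(MOpp a')
  | (?c *: ?a)%R => let a' := lmod_reify F a xs in constr:(MScale (c : F) a')
  | 0%R => constr:(MZero F)
  | _ => let k := lmod_find e xs in constr:(MVar F k)
  end.

(* Reduces an equation between linear combinations over the field F to the
   equations between the coefficients of syntactically equal vectors. *)
Ltac lmod F :=
  lazymatch goal with
  | |- ?a = ?b :> ?M =>
    let xs := lmod_atoms a (@nil M) in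
    let xs := lmod_atoms b xs in
    let ea := lmod_reify F a xs in
    let eb := lmod_reify F b xs in
    apply: (@mexp_eq F _ xs ea eb); rewrite /=; repeat split
  end.

(** * Linear operators and subspaces *)

Section LinearOperators.
Variables (F : fieldType) (M : lmodType F).
Implicit Types f : {linear M -> M}.

Fact linopD f x y : f (x + y) = f x + f y. Proof. exact: linearD. Qed.
Fact linopN f x : f (- x) = - f x. Proof. exact: linearN. Qed.
Fact linopZ f c x : f (c *: x) = c *: f x. Proof. exact: linearZ. Qed.
Fact linop0 f : f 0 = 0. Proof. exact: linear0. Qed.

Definition linE f := (linopD f, linopN f, linopZ f, linop0 f).

Lemma iter_linear f m : linear (iter m f).
Proof. by move=> c x y; elim: m => //= m ->; rewrite linearP. Qed.
HB.instance Definition _ f m :=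
  GRing.isLinear.Build F M M _ (iter m f) (iter_linear f m).

Lemma iter_comm f g m x : (forall y, f (g y) = g (f y)) ->
  f (iter m g x) = iter m g (f x).
Proof. by move=> fg; elim: m => //= m <-; rewrite fg. Qed.

(** Subspaces are predicates, so that lying in a span can be stated as lying in every [N] that
    contains the generators. In an induction over words, an operator standing on the left is
    absorbed by passing to the preimage of [N] ([submod_preim]). *)
Definition submod (N : M -> Prop) :=
  N 0 /\ forall c x y, N x -> N y -> N (c *: x + y).

Lemma submod0 N : submod N -> N 0. Proof. by case. Qed.

Lemma submodZ N c x : submod N -> N x -> N (c *: x).
Proof. by case=> N0 NL Nx; rewrite -[_ *: _]addr0; apply: NL. Qed.

Lemma submodD N x y : submod N -> N x -> N y -> N (x + y).
Proof. by case=> N0 NL Nx Ny; rewrite -[x]scale1r; apply: NL. Qed.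

Lemma submodB N x y : submod N -> N x -> N y -> N (x - y).
Proof. by move=> sN Nx Ny; rewrite -scaleN1r; apply: submodD => //; apply: submodZ. Qed.

Lemma submod_preim N (f : {linear M -> M}) : submod N -> submod (fun x => N (f x)).
Proof. by case=> N0 NL; split=> [|c x y Nx Ny]; rewrite ?linear0 // linearP; apply: NL. Qed.

End LinearOperators.

(** * Straightening words in the Serre relations *)

Section RankTwo.
Variables (F : fieldType) (q : F) (M : lmodType F).

Hypothesis q0 : q != 0.

Variables e1 e2 : {linear M -> M}.
Hypothesis serre12 : forall x,
  e1 (e1 (e2 x)) - (q + q^-1) *: e1 (e2 (e1 x)) + e2 (e1 (e1 x)) = 0.
Hypothesis serre21 : forall x,
  e2 (e2 (e1 x)) - (q + q^-1) *: e2 (e1 (e2 x)) + e1 (e2 (e2 x)) = 0.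

(** The root vector for the sum of two simple roots. Each of the two Serre relations says that it
    q-commutes with one of the generators ([e1_qcomm], [qcomm_e2]). *)
Definition qcomm x := e1 (e2 x) - q *: e2 (e1 x).

Fact qcomm_linear : linear qcomm.
Proof. move=> c x y; rewrite /qcomm !(linE e1, linE e2); lmod F; ring. Qed.
HB.instance Definition _ := GRing.isLinear.Build F M M _ qcomm qcomm_linear.

Lemma e1_qcomm x : e1 (qcomm x) = q^-1 *: qcomm (e1 x).
Proof.
apply/eqP; rewrite -subr_eq0 -(serre12 x) /qcomm !(linE e1, linE e2).
by apply/eqP; lmod F; field.
Qed.

Lemma qcomm_e2 x : qcomm (e2 x) = q^-1 *: e2 (qcomm x).
Proof.
apply/eqP; rewrite -subr_eq0 -(serre21 x) /qcomm !(linE e1, linE e2).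
by apply/eqP; lmod F; field.
Qed.

Let X : {linear M -> M} := qcomm.

Lemma e1_qcommX k x : e1 (iter k X x) = q^-1 ^+ k *: iter k X (e1 x).
Proof.
elim: k => [|k IHk]; first by rewrite expr0 scale1r.
by rewrite iterS [LHS]e1_qcomm IHk linopZ scalerA -exprS.
Qed.

Lemma qcomm_e2X k x : X (iter k e2 x) = q^-1 ^+ k *: iter k e2 (X x).
Proof.
elim: k => [|k IHk]; first by rewrite expr0 scale1r.
by rewrite iterS [LHS]qcomm_e2 IHk linopZ scalerA -exprS.
Qed.

Lemma qcomm_e1X k x : X (iter k e1 x) = q ^+ k *: iter k e1 (X x).
Proof.
elim: k x => [|k IHk] x; first by rewrite expr0 scale1r.
by rewrite iterSr IHk iterSr [e1 (X x)]e1_qcomm linopZ scalerA exprSr mulfK.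
Qed.

(** The quantum integer [j] = q^(j-1) + q^(j-3) + .. + q^(1-j), in the form produced by moving [e1]
    past one more [e2]. *)
Fixpoint qgam j : F := if j is j'.+1 then q ^+ j' + q^-1 * qgam j' else 0.

Lemma e1_e2X j x : e1 (iter j e2 x) =
  q ^+ j *: iter j e2 (e1 x) + qgam j *: iter j.-1 e2 (X x).
Proof.
elim: j x => [|j IHj] x; first by rewrite /= scale0r addr0 expr0 scale1r.
rewrite iterSr IHj [X (e2 x)]qcomm_e2 linopZ -[qcomm x]/(X x).
have -> : e1 (e2 x) = q *: e2 (e1 x) + X x by rewrite addrC subrK.
move: (X x) => z; rewrite !(linopD (iter j e2)) !(linopZ (iter j e2)) linopZ /= -!iterSr.
case: j {IHj} => [|j] /=; lmod F; rewrite ?exprS; ring.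
Qed.

Lemma e1_e2X_qcommX j k x : e1 (iter j e2 (iter k X x)) =
  (q ^+ j * q^-1 ^+ k) *: iter j e2 (iter k X (e1 x))
  + qgam j *: iter j.-1 e2 (iter k.+1 X x).
Proof. by rewrite e1_e2X e1_qcommX linopZ scalerA. Qed.

Hypothesis qgam_neq0 : forall j, qgam j.+1 != 0.

Lemma e1X_e2X_span a b x (N : M -> Prop) : submod N ->
  (forall k, (k <= a)%N -> (k <= b)%N ->
     N (iter (b - k) e2 (iter k X (iter (a - k) e1 x)))) ->
  N (iter a e1 (iter b e2 x)).
Proof.
elim: a N => [|a IHa] N sN HN; first by have := HN 0 isT isT; rewrite subn0.
rewrite iterS; apply: (IHa (fun y => N (e1 y))); first exact: submod_preim.
move=> k ka kb; rewrite e1_e2X_qcommX -iterS -subSn //.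
apply: submodD => //.
  by apply: submodZ => //; apply: HN => //; apply: leqW.
have [ltkb|] := ltnP k b; last first.
  by rewrite -subn_eq0 => /eqP->; rewrite scale0r; apply: submod0.
by apply: submodZ => //; have := HN k.+1; rewrite subSS subnS; apply.
Qed.

(** Inverts the expansion of [e1X_e2X_span]: as [j] is invertible, [e1_e2X_qcommX] expresses a
    product with one more factor [X] through products with fewer. *)
Lemma e2X_qcommX_span b k x (N : M -> Prop) : submod N -> (k <= b)%N ->
  (forall a, (a <= k)%N -> N (iter a e1 (iter b e2 (iter (k - a) e1 x)))) ->
  N (iter (b - k) e2 (iter k X x)).
Proof.
elim: k x N => [|k IHk] x N sN kb HN; first by rewrite subn0; apply: (HN 0%N).
set j := (b - k.+1)%N; have Ej : (b - k)%N = j.+1 by rewrite -subnSK.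
have E : qgam j.+1 *: iter j e2 (iter k.+1 X x) = e1 (iter j.+1 e2 (iter k X x))
    - (q ^+ j.+1 * q^-1 ^+ k) *: iter j.+1 e2 (iter k X (e1 x)).
  by rewrite (e1_e2X_qcommX j.+1) addrC addKr.
rewrite -[iter j e2 _](scalerK (qgam_neq0 j)) E -Ej.
apply: submodZ => //; apply: submodB => //.
  apply: (IHk x (fun y => N (e1 y))); [exact: submod_preim|exact: ltnW|].
  by move=> a ak; apply: (HN a.+1).
apply: submodZ => //; apply: IHk => //; first exact: ltnW.
by move=> a ak; rewrite -iterSr -subSn //; apply: HN; apply: leqW.
Qed.

(** Both expansions go through the middle terms e2^(b-k) X^k e1^(a-k). Since k <= b there, the
    exponent left of e2^b can be kept at most b; the surplus of [e1] reappears on the right. *)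
Lemma e1X_e2X_straighten a b x (N : M -> Prop) : submod N ->
  (forall c, (c <= a)%N -> (c <= b)%N ->
     N (iter c e1 (iter b e2 (iter (a - c) e1 x)))) ->
  N (iter a e1 (iter b e2 x)).
Proof.
move=> sN HN; apply: e1X_e2X_span => // k ka kb; apply: e2X_qcommX_span => // c ck.
rewrite -iterD addnC addnBA // subnK //.
by apply: HN; apply: leq_trans ck _.
Qed.

Lemma e2_e1X_span a y (N : M -> Prop) : submod N ->
  N (iter a e1 (e2 y)) -> ((0 < a)%N -> N (iter a.-1 e1 (X y))) ->
  N (e2 (iter a e1 y)).
Proof.
elim: a N => [//|a IHa] N sN N1 N2.
have -> : e2 (iter a.+1 e1 y) =
    q^-1 *: (e1 (e2 (iter a e1 y)) - X (iter a e1 y)).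
  by rewrite /X /= /qcomm; lmod F; field.
apply: submodZ => //; apply: submodB => //; last first.
  by rewrite qcomm_e1X; apply: submodZ => //; apply: N2.
apply: (IHa (fun z => N (e1 z))) => //; first exact: submod_preim.
by case: (a) N2 => // a' N2 _; apply: N2.
Qed.

(** Either [e2] passes e1^a and joins e2^b, or it merges with one [e1] into a root vector. By
    [e1_e2X] that root vector splits again, with its [e1] in front or at the far right. *)
Lemma e2_e1X_e2X_span a b x (N : M -> Prop) : submod N ->
  N (iter a e1 (iter b.+1 e2 x)) ->
  ((0 < a)%N -> N (iter a.-1 e1 (iter b.+1 e2 (e1 x)))) ->
  N (e2 (iter a e1 (iter b e2 x))).
Proof.
move=> sN N1 N2; apply: e2_e1X_span => // a0; rewrite qcomm_e2X linopZ.
apply: submodZ => //.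
have E : qgam b.+1 *: iter b e2 (X x) =
    e1 (iter b.+1 e2 x) - q ^+ b.+1 *: iter b.+1 e2 (e1 x).
  by rewrite (e1_e2X b.+1) addrC addKr.
rewrite -[iter b e2 _](scalerK (qgam_neq0 b)) E -scaleNr.
rewrite linopZ linopD linopZ; apply: submodZ => //; apply: submodD => //.
  by move: N1; rewrite -{1}(prednK a0) iterSr.
by apply: submodZ => //; apply: N2.
Qed.

End RankTwo.

Section SerreWords.
Variables (F : fieldType) (q : F) (M : lmodType F) (e : nat -> {linear M -> M}).
Hypothesis q0 : q != 0.
Hypothesis qgam_neq0 : forall j, qgam q j.+1 != 0.

Definition serre_rel := forall i j x, (j == i.+1) || (i == j.+1) ->
  e i (e i (e j x)) - (q + q^-1) *: e i (e j (e i x)) + e j (e i (e i x)) = 0.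
Definition far_comm := forall i j x, (i.+1 < j)%N -> e i (e j x) = e j (e i x).

Hypothesis eS : serre_rel.
Hypothesis eC : far_comm.

Definition word s x := foldr (fun i => e i) x s.

Fixpoint stair i m x :=
  if m is a :: m' then iter a (e i) (stair i.+1 m' x) else x.

Lemma word_cat s1 s2 x : word (s1 ++ s2) x = word s1 (word s2 x).
Proof. exact: foldr_cat. Qed.

Lemma word_nseq k i x : word (nseq k i) x = iter k (e i) x.
Proof. by elim: k => //= k ->. Qed.

Lemma e_stair_comm j i m x : (j.+1 < i)%N -> e j (stair i m x) = stair i m (e j x).
Proof.
elim: m i => //= a m IHm i ji; rewrite iter_comm ?IHm ?ltnS 1?ltnW // => y.
exact: eC.
Qed.

(** The letter [j] is absorbed by its own block. When it passes the block of [j - 1], one letter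
    [j - 1] may be thrown out to the right, where it commutes with the blocks after that of [j].
    Hence the last index is never thrown out, and the residual letters have smaller rank. *)
Lemma e_stair_span j i m x (N : M -> Prop) : submod N ->
  (i <= j < i + size m)%N ->
  (forall m', size m' = size m -> sumn m' = (sumn m).+1 -> N (stair i m' x)) ->
  (forall m' l, size m' = size m -> sumn m' = sumn m -> (l.+1 < i + size m)%N ->
     N (stair i m' (e l x))) ->
  N (e j (stair i m x)).
Proof.
elim: m i N => [|a m IHm] i N sN /= ; first by rewrite addn0; case: ltngtP.
rewrite addnS -addSn => /andP[lij ljm] N1 N2.
case: (ltngtP i j) lij => [lij _|//|<- _]; last first.
  by rewrite -iterS; apply: (N1 (a.+1 :: m)); rewrite //= addSn.
case: (ltngtP i.+1 j) lij => [lij _|//|Eij _]; last first.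
  case: m {IHm} ljm N1 N2 => [|b m] ljm N1 N2.
    by move: ljm; rewrite addn0 Eij ltnn.
  rewrite -Eij; apply: (e2_e1X_e2X_span q0) => //=.
  - by move=> y; apply: eS; rewrite eqxx.
  - by move=> y; apply: eS; rewrite eqxx orbT.
  - apply: (N1 (a :: b.+1 :: m)) => //=; lia.
  move=> a0; rewrite e_stair_comm //; apply: (N2 (a.-1 :: b.+1 :: m)) => //=; lia.
rewrite iter_comm; last by move=> y; apply/esym/eC.
apply: (IHm _ (fun y => N (iter a (e i) y))); rewrite ?ljm ?(ltnW lij) //.
- exact: submod_preim.
- move=> m' sm' Em'; apply: (N1 (a :: m')) => /=; lia.
by move=> m' l sm' Em' ll; apply: (N2 (a :: m')) => /=; lia.
Qed.

Lemma stair_nseq0 i k x : stair i (nseq k 0%N) x = x.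
Proof. by elim: k i => //= k IHk i; apply: IHk. Qed.

Lemma word_stair_span k s x (N : M -> Prop) : submod N ->
  all (fun l => l < k)%N s ->
  (forall m s', size m = k -> all (fun l => l.+1 < k)%N s' ->
     (sumn m + size s')%N = size s -> N (stair 0 m (word s' x))) ->
  N (word s x).
Proof.
elim: s N => [|j s IHs] N sN /=.
  move=> _ /(_ (nseq k 0%N) [::]); rewrite stair_nseq0; apply; rewrite ?size_nseq //.
  by rewrite sumn_nseq.
case/andP=> ljk ls HN; apply: (IHs (fun y => N (e j y))) => //.
  exact: submod_preim.
move=> m s' sm ls' Es; apply: e_stair_span => //.
- by rewrite add0n sm ljk.
- by move=> m' sm' Em'; apply: HN; rewrite ?sm' ?Em' // addSn Es.
move=> m' l sm' Em' ll; apply: (HN m' (l :: s')); rewrite ?sm' //=.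
  by rewrite ls' andbT -sm.
by rewrite addnS Em' Es.
Qed.

(** Once the tail is nondecreasing, only the first two exponents can be out of order. Then
    [e1X_e2X_straighten] lowers the first one, and the surplus letters [i] commute past the blocks
    from [i + 2] on. *)
Lemma stair_sorted_span i m x (N : M -> Prop) : submod N ->
  (forall m' s', size m' = size m -> sorted leq m' ->
     all (fun l => l.+1 < i + size m)%N s' ->
     (sumn m' + size s')%N = sumn m -> N (stair i m' (word s' x))) ->
  N (stair i m x).
Proof.
elim: m i N => [|a m IHm] i N sN HN /=; first exact: (HN [::] [::]).
apply: (IHm _ (fun y => N (iter a (e i) y))); first exact: submod_preim.
move=> m' s' sm' om' ls' Es; rewrite addSn -addnS in ls'.
case: m' => [|b m'] in sm' om' Es *.
  apply: (HN [:: a] s') => /=; [by rewrite -sm'|by []|exact: ls'|].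
  by rewrite -Es addn0.
have [leab|ltba] := leqP a b.
  apply: (HN [:: a, b & m'] s') => /=; [by rewrite -sm'|by rewrite leab|exact: ls'|].
  by move: Es => /=; lia.
apply: (e1X_e2X_straighten q0) => //=.
- by move=> y; apply: eS; rewrite eqxx.
- by move=> y; apply: eS; rewrite eqxx orbT.
move=> c ca cb; rewrite -[iter (a - c) _ _]word_nseq.
have -> : word (nseq (a - c) i) (stair i.+2 m' (word s' x)) =
          stair i.+2 m' (word (nseq (a - c) i ++ s') x).
  rewrite word_cat; elim: (a - c)%N => //= k ->; exact: e_stair_comm.
apply: (HN [:: c, b & m'] _) => /=; [by rewrite -sm'|by rewrite cb| |].
  by rewrite all_cat ls' andbT all_nseq -sm' /= addnS; apply/orP; right; lia.
by rewrite size_cat size_nseq; move: Es => /=; lia.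
Qed.

(* The monomials stair 0 m with m nondecreasing span the E's of the last
   column; at most one of them has a given weight. *)
Lemma word_sorted_stair_span k s x (N : M -> Prop) : submod N ->
  all (fun l => l < k)%N s ->
  (forall m s', size m = k -> sorted leq m -> all (fun l => l.+1 < k)%N s' ->
     (sumn m + size s')%N = size s -> N (stair 0 m (word s' x))) ->
  N (word s x).
Proof.
move=> sN ls HN; apply: word_stair_span ls _ => // m s1 sm ls1 Es1.
apply: stair_sorted_span => // m' s2 sm' om' ls2 Es2; rewrite -word_cat.
apply: HN; rewrite ?sm' ?size_cat ?all_cat ?ls1 //; last by lia.
by rewrite -sm ls2.
Qed.

End SerreWords.

Lemma form_eps_alpha n (i : 'I_n) (j : 'I_n.-1) :
  Defs.form (eps i) (alpha j) = (i == lo j)%:Z - (i == hi j)%:Z.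
Proof.
rewrite /Defs.form (bigD1 i) //= big1 => [|l /negPf li]; last first.
  by rewrite /eps mxE li andbF mul0r.
by rewrite /eps /alpha !mxE !eqxx /= mul1r addr0 !natz.
Qed.

(** * Generators and weights in the presented algebra *)

Section FreeMorphism.
Variables (F : fieldType) (X : choiceType) (T : algType F).
Variable pi : freeAlg F X -> T.
Hypotheses (pi_lin : linear pi) (pi_mon : monoid_morphism pi).

Fact pi1 : pi 1 = 1. Proof. by case: pi_mon. Qed.
Fact piM r s : pi (r * s) = pi r * pi s. Proof. by case: pi_mon. Qed.
Fact piD r s : pi (r + s) = pi r + pi s.
Proof. by have := pi_lin 1 r s; rewrite !scale1r. Qed.
Fact pi0 : pi 0 = 0.
Proof. by apply: (addrI (pi 0)); rewrite -piD !addr0. Qed.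
Fact piZ c a : pi (c *: a) = c *: pi a.
Proof. by have := pi_lin c a 0; rewrite pi0 !addr0. Qed.
Fact piB r s : pi (r - s) = pi r - pi s.
Proof. by rewrite -scaleN1r piD piZ scaleN1r. Qed.
Fact pi_prod I (s : seq I) (a : I -> freeAlg F X) :
  pi (\prod_(i <- s) a i) = \prod_(i <- s) pi (a i).
Proof. exact: (big_morph pi piM pi1). Qed.

(* Rewriting with piM and piZ would try to unify the product and the scaling of
   the free algebra, which is very slow; hence the explicit proof terms. *)
Fact pi_eqM r s t u : pi (r * s) = pi (t * u) -> pi r * pi s = pi t * pi u.
Proof. by move=> E; exact: etrans (esym (piM r s)) (etrans E (piM t u)). Qed.
Fact pi_eq1 r s : pi (r * s) = pi 1 -> pi r * pi s = 1.
Proof. by move=> E; exact: etrans (esym (piM r s)) (etrans E pi1). Qed.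
Fact pi_eqZ r s c : pi (r * s) = pi (c *: (s * r)) -> pi r * pi s = c *: (pi s * pi r).
Proof.
move=> E; apply: etrans (esym (piM r s)) (etrans E (etrans (piZ c _) _)).
by congr (_ *: _); exact: piM.
Qed.
Fact piBM r s t u : pi (r * s - t * u) = pi r * pi s - pi t * pi u.
Proof. by apply: etrans (piB _ _) _; congr (_ - _); exact: piM. Qed.
Fact pi_comm r s : pi (r * s - s * r) = pi 0 -> pi r * pi s = pi s * pi r.
Proof.
move=> E; apply/eqP; rewrite -subr_eq0; apply/eqP.
exact: etrans (esym (piBM r s s r)) (etrans E pi0).
Qed.
Fact pi_serre r s c :
  pi (r ^+ 2 * s - c *: (r * s * r) + s * r ^+ 2) = pi 0 ->
  pi r * (pi r * pi s) - c *: (pi r * (pi s * pi r)) + pi s * (pi r * pi r) = 0.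
Proof.
move=> E; apply: etrans (etrans (esym _) (etrans E pi0)) => //.
apply: etrans (piD _ _) _; congr (_ + _); last first.
  by apply: etrans (piM _ _) _; congr (_ * _); exact: piM.
apply: etrans (piB _ _) _; congr (_ - _).
  by rewrite mulrA; apply: etrans (piM _ _) _; congr (_ * _); exact: piM.
apply: etrans (piZ _ _) _; congr (_ *: _); rewrite mulrA.
by apply: etrans (piM _ _) _; congr (_ * _); exact: piM.
Qed.
Fact pi_bracket r s c c' k1 k2 k3 k4 :
  pi (r * s - s * r) = pi (c *: (c' *: (k1 * k2 - k3 * k4))) ->
  pi r * pi s - pi s * pi r = c *: (c' *: (pi k1 * pi k2 - pi k3 * pi k4)).
Proof.
move=> E; apply: etrans (esym (piBM _ _ _ _)) (etrans E (etrans (piZ _ _) _)).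
congr (_ *: _); apply: etrans (piZ _ _) _.
by congr (_ *: _); exact: piBM.
Qed.
Fact pi_prodA m (a : 'I_m -> freeAlg F X) c :
  pi (\prod_i a i) = pi c%:A -> \prod_i pi (a i) = c%:A.
Proof.
move=> E; apply: etrans (esym (pi_prod _ _)) (etrans E (etrans (piZ _ _) _)).
by congr (_ *: _); exact: pi1.
Qed.
Fact pi_prod0 m (a : freeAlg F X) (c : 'I_m -> F) :
  pi (\prod_i (a - (c i)%:A)) = pi 0 -> \prod_i (pi a - (c i)%:A) = 0.
Proof.
move=> E; apply: etrans (etrans (esym (pi_prod _ _)) (etrans E pi0)).
apply: eq_bigr => i _; apply/esym/(etrans (piB _ _)); congr (_ - _).
by apply: etrans (piZ _ _) _; congr (_ *: _); exact: pi1.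
Qed.

End FreeMorphism.

Section AlgebraIdentities.
Variables (F : fieldType) (T : algType F).
Implicit Types (x y u : T).

Fact serre_apply c x y u : x * (x * y) - c *: (x * (y * x)) + y * (x * x) = 0 ->
  x * (x * (y * u)) - c *: (x * (y * (x * u))) + y * (x * (x * u)) = 0.
Proof.
by move/(congr1 (fun z => z * u)); rewrite mul0r !mulrDl mulNr -!scalerAl !mulrA.
Qed.

(** On a common eigenvector the Cartan part of (Q2) is a scalar. *)
Fact bracket_apply x y c c' (k1 k2 k3 k4 : T) :
  x * y - y * x = c *: (c' *: (k1 * k2 - k3 * k4)) -> forall u a1 a2 a3 a4,
  k1 * u = a1 *: u -> k2 * u = a2 *: u -> k3 * u = a3 *: u -> k4 * u = a4 *: u ->
  x * (y * u) = y * (x * u) + (c * (c' * (a2 * a1 - a4 * a3))) *: u.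
Proof.
move=> E u a1 a2 a3 a4 E1 E2 E3 E4; have := congr1 (fun z => z * u) E.
rewrite mulrBl -!scalerAl mulrBl -!mulrA E2 E4 -!scalerAr E1 E3 => /eqP.
rewrite subr_eq => /eqP->; rewrite addrC; congr (_ + _).
by rewrite !scalerA -scalerBl !scalerA !mulrA.
Qed.

End AlgebraIdentities.

Lemma ltn_ordP n i : (i < n)%N -> exists j : 'I_n, i = j.
Proof. by move=> lti; exists (Ordinal lti). Qed.

Section Generators.
Variables (F : fieldType) (q : F) (n' d : nat).
Local Notation n := n'.+1.
Variables (T : algType F) (pi : freeAlg F (schurGen n) -> T).
Hypothesis pi_lin : linear pi.
Hypothesis pi_mon : monoid_morphism pi.
Hypothesis pi_rel : forall a b, schurRel d q a b -> pi a = pi b.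
Implicit Types (x y u : T) (b : bool).

Definition lmulT x y := x * y.
Definition rmulT x y := y * x.
Fact lmulT_linear x : linear (lmulT x).
Proof. by move=> c y z; rewrite /lmulT mulrDr -scalerAr. Qed.
Fact rmulT_linear x : linear (rmulT x).
Proof. by move=> c y z; rewrite /rmulT mulrDl -scalerAl. Qed.
HB.instance Definition _ x := GRing.isLinear.Build F T T _ (lmulT x) (lmulT_linear x).
HB.instance Definition _ x := GRing.isLinear.Build F T T _ (rmulT x) (rmulT_linear x).

Definition genEF b (i : 'I_n.-1) : freeAlg F (schurGen n) :=
  gen F (if b then GenE i else GenF i).

(* True selects the E's, false the F's; indices outside the range give 0, which
   is compatible with (Q4) and (Q5). *)
Definition EF b (i : nat) : T :=
  if insub i : option 'I_n.-1 is Some j then pi (genEF b j) else 0.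
Definition TK (i : 'I_n) : T := pi (gen F (GenK i)).
Definition TK' (i : 'I_n) : T := pi (gen F (GenKinv i)).

Lemma EF_ord b (j : 'I_n.-1) : EF b j = pi (genEF b j).
Proof.
rewrite /EF; case: insubP => [k _ /val_inj -> | ]; first exact: erefl.
by rewrite ltn_ord.
Qed.

Lemma EF_default b i : (n' <= i)%N -> EF b i = 0.
Proof.
move=> le; rewrite /EF; case: insubP => [k | _]; last exact: erefl.
by rewrite ltnNge le.
Qed.

Lemma EF_serre b i j x : (j == i.+1) || (i == j.+1) ->
  EF b i * (EF b i * (EF b j * x)) - (q + q^-1) *: (EF b i * (EF b j * (EF b i * x)))
   + EF b j * (EF b i * (EF b i * x)) = 0.
Proof.
have [lti|/EF_default->] := ltnP i n'; last by rewrite !(mul0r, mulr0) scaler0 subr0 addr0.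
have [ltj|/EF_default->] := ltnP j n'; last by rewrite !(mul0r, mulr0) scaler0 subr0 addr0.
case: (ltn_ordP lti) (ltn_ordP ltj) => {lti}i -> [{ltj}j ->] ij; rewrite !EF_ord.
have adj : adjacent (i : 'I_n.-1) j.
  by move: ij; rewrite /adjacent; clear; case: i => i ?; case: j => j ? /=; lia.
apply: serre_apply.
by case: b; [exact: pi_serre (pi_rel (Q4_serre _ _ adj))
            |exact: pi_serre (pi_rel (Q5_serre _ _ adj))].
Qed.

Lemma EF_comm b i j x : (i.+1 < j)%N -> EF b i * (EF b j * x) = EF b j * (EF b i * x).
Proof.
have [lti|/EF_default->] := ltnP i n'; last by rewrite !(mul0r, mulr0).
have [ltj|/EF_default->] := ltnP j n'; last by rewrite !(mul0r, mulr0).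
case: (ltn_ordP lti) (ltn_ordP ltj) => {lti}i -> [{ltj}j ->] ij; rewrite !EF_ord.
have adj : ~~ adjacent (i : 'I_n.-1) j.
  by move: ij; rewrite /adjacent; clear; case: i => i ?; case: j => j ? /=; lia.
have E : pi (genEF b i) * pi (genEF b j) = pi (genEF b j) * pi (genEF b i).
  by case: b; [exact: pi_comm (pi_rel (Q4_comm _ _ adj))
              |exact: pi_comm (pi_rel (Q5_comm _ _ adj))].
by rewrite !mulrA E.
Qed.

Definition EFl b i : {linear T -> T} := lmulT (EF b i).
Definition EFr b i : {linear T -> T} := rmulT (EF b i).

Lemma EFl_serre b : serre_rel q (EFl b).
Proof. by move=> i j x ij; apply: EF_serre. Qed.

Lemma EFl_far b : far_comm (EFl b).
Proof. by move=> i j x ij; apply: EF_comm. Qed.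

Lemma EFr_serre b : serre_rel q (EFr b).
Proof.
move=> i j x ij; rewrite /EFr /= /rmulT -!mulrA.
have := EF_serre b 1 ij; rewrite !mulr1 => /(congr1 (fun y => x * y)).
rewrite mulr0 !mulrDr mulrN -scalerAr => <-.
by rewrite addrC addrA addrAC.
Qed.

Lemma EFr_far b : far_comm (EFr b).
Proof.
move=> i j x ij; rewrite /EFr /= /rmulT -!mulrA.
by have := EF_comm b 1 ij; rewrite !mulr1 => ->.
Qed.

(** A weight vector for left multiplication. The entries are integers because a generator may shift
    a weight to a negative entry; [wt_neg] then shows that the vector vanishes. *)
Definition wt (la : nat -> int) u := forall i : 'I_n, TK i * u = q ^ la i *: u.

Definition wt_shift b (i : nat) (la : nat -> int) (j : nat) : int :=
  la j + (if b then 1 else -1) * ((j == i)%:Z - (j == i.+1)%:Z).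

Hypothesis q0 : q != 0.
Hypothesis q_inj : forall a b : int, q ^ a = q ^ b -> a = b.

Lemma wt_EF b i la u : wt la u -> wt (wt_shift b i la) (EF b i * u).
Proof.
have [lti|/EF_default->] := ltnP i n'; last by rewrite mul0r => _ l; rewrite mulr0 scaler0.
case: (ltn_ordP lti) => {lti}i -> wu l.
rewrite EF_ord mulrA.
have -> : TK l * pi (genEF b i) =
  q ^ ((if b then 1 else -1) * Defs.form (eps l) (@alpha n i)) *: (pi (genEF b i) * TK l).
  by case: b; rewrite ?mul1r ?mulN1r; [exact: pi_eqZ (pi_rel (Q3_E _ _ _ _))
                                      |exact: pi_eqZ (pi_rel (Q3_F _ _ _ _))].
rewrite -scalerAl -mulrA wu -scalerAr scalerA.
rewrite -expfzDr // /wt_shift form_eps_alpha -!val_eqE /=.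
by congr (q ^ _ *: _); rewrite addrC.
Qed.

Lemma TK'_wt la u i : wt la u -> TK' i * u = q ^ (- la i) *: u.
Proof.
move=> wu; have : TK' i * (TK i * u) = u.
  have E : TK' i * TK i = 1 by exact: pi_eq1 (pi_rel (Q1_invl _ _ i)).
  by rewrite mulrA E mul1r.
rewrite wu -scalerAr => {2}<-; rewrite scalerA -expfzDr // addNr expr0z.
by rewrite scale1r.
Qed.

Lemma EF_swap i j la u : wt la u ->
  exists c, EF true i * (EF false j * u) = EF false j * (EF true i * u) + c *: u.
Proof.
have [lti|/EF_default->] := ltnP i n'; last by exists 0; rewrite !(mul0r, mulr0) scale0r addr0.
have [ltj|/EF_default->] := ltnP j n'; last by exists 0; rewrite !(mul0r, mulr0) scale0r addr0.
case: (ltn_ordP lti) (ltn_ordP ltj) => {lti}i -> [{ltj}j ->] wu; rewrite !EF_ord.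
have : pi (genEF true i) * pi (genEF false j) - pi (genEF false j) * pi (genEF true i) =
    (i == j)%:R *: ((q - q^-1)^-1 *:
      (TK (@lo n i) * TK' (@hi n i) - TK' (@lo n i) * TK (@hi n i))).
  have := pi_bracket pi_lin pi_mon (pi_rel (@Q2 F n d q i j)).
  by [].
move/bracket_apply => /(_ _ _ _ _ _ (wu _) (TK'_wt _ wu) (TK'_wt _ wu) (wu _)) E.
by eexists; exact: E.
Qed.

Lemma prod_TK_wt la u : wt la u -> forall s : seq 'I_n,
  (\prod_(i <- s) TK i) * u = q ^ (\sum_(i <- s) la i) *: u.
Proof.
move=> wu; elim=> [|i s IHs]; first by rewrite !big_nil mul1r scale1r.
by rewrite !big_cons -mulrA IHs -scalerAr wu scalerA -expfzDr // addrC.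
Qed.

Lemma wt_sum la u : wt la u -> u != 0 -> \sum_(i < n) la i = d%:Z.
Proof.
move=> wu u0; apply: q_inj; apply/eqP; rewrite -subr_eq0.
have E : \prod_(i < n) TK i = (q ^+ d)%:A.
  exact: pi_prodA (pi_rel (Q6 _ _ _)).
have := prod_TK_wt wu (index_enum 'I_n); rewrite E -scalerAl mul1r => /eqP.
rewrite eq_sym.
by rewrite -subr_eq0 -scalerBl scaler_eq0 (negPf u0) orbF.
Qed.

(** On [u] the product in (Q7) is the scalar product of the q^(la j) - q^m, so one of these factors
    vanishes. *)
Lemma wt_range la u (j : 'I_n) : wt la u -> u != 0 -> exists2 m, (m <= d)%N & la j = m%:Z.
Proof.
move=> wu u0.
have E : \prod_(m < d.+1) (TK j - (q ^+ m)%:A) = 0.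
  exact: pi_prod0 (pi_rel (Q7 _ _ j)).
have {E} /(congr1 (fun y => y * u)) := E; rewrite mul0r.
suff -> : (\prod_(m < d.+1) (TK j - (q ^+ m)%:A)) * u =
   \prod_(m < d.+1) (q ^ la j - q ^+ m) *: u.
  move/eqP; rewrite scaler_eq0 (negPf u0) orbF => /prodf_eq0[m _].
  rewrite subr_eq0 => /eqP E; exists (m : nat); first by rewrite -ltnS.
  exact: (@q_inj (la j) (Posz m) E).
elim/big_rec2: _ => [|m a y _ IH]; first by rewrite mul1r scale1r.
by rewrite -mulrA IH -scalerAr mulrBl -scalerAl mul1r wu -scalerBl scalerA mulrC.
Qed.

Lemma wt_neg la u (j : nat) : wt la u -> (j < n)%N -> la j < 0 -> u = 0.
Proof.
move=> wu ltj neg; apply/eqP/negPn/negP => u0.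
by have [m _ E] := wt_range (Ordinal ltj) wu u0; rewrite /= in E; rewrite E in neg.
Qed.

End Generators.

(** * Blocks as lists of letters *)

Fixpoint stairw i m := if m is a :: m' then nseq a i ++ stairw i.+1 m' else [::].

Lemma size_stairw i m : size (stairw i m) = sumn m.
Proof. by elim: m i => //= a m IHm i; rewrite size_cat size_nseq IHm. Qed.

Lemma all_stairw k i m : (i + size m <= k)%N -> all (fun l => l < k)%N (stairw i m).
Proof.
elim: m i => //= a m IHm i; rewrite addnS -addSn => le; rewrite all_cat IHm // andbT.
by rewrite all_nseq; apply/orP; right; lia.
Qed.

Lemma count_stairw j i m :
  count_mem j (stairw i m) = if (i <= j)%N then nth 0%N m (j - i) else 0%N.
Proof.
elim: m i => [|a m IHm] i /=; first by rewrite nth_nil if_same.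
rewrite count_cat count_nseq IHm /=; case: (ltngtP i j) => [ltij|//|->].
- by rewrite mul0n add0n -(subnSK ltij).
- by rewrite subnn mul1n addn0.
Qed.

Lemma stair_word (F : fieldType) (M : lmodType F) (e : nat -> {linear M -> M}) i m x :
  stair e i m x = word e (stairw i m) x.
Proof. by elim: m i => //= a m IHm i; rewrite word_cat word_nseq IHm. Qed.

(** * Spanning monomials *)

Section PbwWords.

Definition tg b (s : seq nat) : seq (bool * nat) := [seq (b, i) | i <- s].

Lemma tg_rev b s : tg b (rev s) = rev (tg b s).
Proof. exact: map_rev. Qed.

(** A letter moved from v_k down to v_l passes E_(k-1), .., E_l, so E_i occurs once for each such
    letter with l <= i: the exponents are partial column sums. Likewise [rowA] counts the F_i on the
    way up to v_k. *)
Definition colA (A : nat -> nat -> nat) k := mkseq (fun i => \sum_(l < i.+1) A l k)%N k.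
Definition rowA (A : nat -> nat -> nat) k := mkseq (fun i => \sum_(l < i.+1) A k l)%N k.

(** Nested by rank: each level puts its E-block on the far left and its reversed F-block on the far
    right. At rank k only indices below k occur. *)
Fixpoint wordA A k :=
  if k is k'.+1 then
    tg true (stairw 0 (colA A k)) ++ wordA A k' ++ rev (tg false (stairw 0 (rowA A k)))
  else [::].

Lemma wordAS A k : wordA A k.+1 = tg true (stairw 0 (colA A k.+1)) ++ wordA A k
  ++ rev (tg false (stairw 0 (rowA A k.+1))).
Proof. by []. Qed.

Lemma eq_wordA A B k :
  (forall i j, i != j -> (i <= k)%N -> (j <= k)%N -> A i j = B i j) ->
  wordA A k = wordA B k.
Proof.
elim: k => // k IHk AB; rewrite !wordAS IHk => [|i j nij ik jk]; last by rewrite AB // leqW.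
suff [-> ->] : colA A k.+1 = colA B k.+1 /\ rowA A k.+1 = rowA B k.+1 by [].
split; apply/eq_in_map => i; rewrite mem_iota => /andP[_ lti]; apply: eq_bigr => l _;
  by apply: AB; have := ltn_ord l; lia.
Qed.

(** For nondecreasing sequences, the inverse of the partial sums in [colA] and [rowA]. *)
Definition stepd (m : seq nat) i := (nth 0 m i - (if i is i'.+1 then nth 0 m i' else 0))%N.

Lemma sum_stepd m i : sorted leq m -> (i < size m)%N ->
  (\sum_(l < i.+1) stepd m l = nth 0 m i)%N.
Proof.
move=> om; elim: i => [|i IHi] lti; first by rewrite big_ord1 /stepd subn0.
rewrite big_ord_recr IHi 1?ltnW //= /stepd addnC subnK //.
by apply: (sorted_leq_nth leq_trans leqnn) => //; rewrite ?inE // ltnW.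
Qed.

Lemma stepdZ m i : sorted leq m -> (i < size m)%N -> (stepd m i)%:Z =
  (nth 0%N m i)%:Z - (if i is i'.+1 then nth 0%N m i' else 0%N)%:Z.
Proof.
move=> om lti; rewrite /stepd subzn //; case: i lti => // i lti.
by apply: (sorted_leq_nth leq_trans leqnn) => //; rewrite ?inE // ltnW.
Qed.

Definition glue (A : nat -> nat -> nat) k m m' i j : nat :=
  if j == k then stepd m i else if i == k then stepd m' j else A i j.

Lemma colA_glue A k m m' : sorted leq m -> size m = k -> colA (glue A k m m') k = m.
Proof.
move=> om sm; apply: (@eq_from_nth _ 0%N) => [|i]; rewrite size_mkseq ?sm // => lti.
rewrite nth_mkseq // -[RHS]sum_stepd ?sm //; apply: eq_bigr => l _.
by rewrite /glue eqxx.
Qed.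

Lemma rowA_glue A k m m' : sorted leq m' -> size m' = k -> rowA (glue A k m m') k = m'.
Proof.
move=> om sm; apply: (@eq_from_nth _ 0%N) => [|i]; rewrite size_mkseq ?sm // => lti.
rewrite nth_mkseq // -[RHS]sum_stepd ?sm //; apply: eq_bigr => l _.
rewrite /glue eqxx; case: eqP => // E; have := ltn_ord l; rewrite E; lia.
Qed.

End PbwWords.

Section Spanning.
Variables (F : fieldType) (q : F) (n' d : nat).
Local Notation n := n'.+1.
Variables (T : algType F) (pi : freeAlg F (schurGen n) -> T).
Hypothesis pi_lin : linear pi.
Hypothesis pi_mon : monoid_morphism pi.
Hypothesis pi_rel : forall a b, schurRel d q a b -> pi a = pi b.
Hypothesis q0 : q != 0.
Hypothesis q_inj : forall a b : int, q ^ a = q ^ b -> a = b.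
Hypothesis qgam_neq0 : forall j, qgam q j.+1 != 0.
Local Notation EF := (EF pi).
Local Notation wt := (wt q pi).
Implicit Types (u x y : T) (N : T -> Prop) (w : seq (bool * nat)).

Definition lw w u := foldr (fun l y => EF l.1 l.2 * y) u w.
Definition wtw (la : nat -> int) w := foldr (fun l la => wt_shift l.1 l.2 la) la w.
Definition idx k w := all (fun l => l.2 < k)%N w.

Lemma lw_cat w1 w2 u : lw (w1 ++ w2) u = lw w1 (lw w2 u).
Proof. exact: foldr_cat. Qed.

Lemma lw_linear w : linear (lw w).
Proof.
by move=> c x y; elim: w => //= l w ->; rewrite mulrDr scalerAr.
Qed.
HB.instance Definition _ w := GRing.isLinear.Build F T T _ (lw w) (lw_linear w).

Lemma lw0 w : lw w 0 = 0. Proof. exact: linear0. Qed.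

Lemma lw_word b s u : lw (tg b s) u = word (EFl pi b) s u.
Proof. by elim: s => //= i s ->. Qed.

Lemma wordr_lw b s x u : word (EFr pi b) s x * u = x * lw (rev (tg b s)) u.
Proof.
elim: s u => //= i s IHs u.
by rewrite rev_cons -cats1 lw_cat /= -IHs /rmulT -mulrA.
Qed.

Lemma wt_lw la u w : wt la u -> wt (wtw la w) (lw w u).
Proof.
by move=> wu; elim: w => //= l w IHw; apply: (wt_EF pi_lin pi_mon pi_rel q0).
Qed.

Lemma wtw_tg b s la j : wtw la (tg b s) j = la j + (if b then 1 else -1) *
  ((count_mem j s)%:Z - (if j is j'.+1 then count_mem j' s else 0%N)%:Z).
Proof.
elim: s => [|i s IHs] /=; first by case: j => [|j]; rewrite subrr mulr0 addr0.
rewrite /wt_shift IHs /= ![_ == i]eq_sym -addrA -mulrDr.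
by case: j {IHs} => [|j]; rewrite ?eqSS ?[_ == i]eq_sym ?PoszD; congr (_ + _ * _); lia.
Qed.

Lemma idx_tg k b s : idx k (tg b s) = all (fun l => l < k)%N s.
Proof. by rewrite /idx all_map. Qed.

(** Words applied to [u] give weight vectors, on which E's and F's commute up to a scalar. Each
    exchange therefore costs only a word that is two letters shorter. *)
Lemma move_letter k b j p r la u N : wt la u -> submod N ->
  idx k ((~~ b, j) :: tg b p ++ r) ->
  (forall w, (size w < (size p + size r).+1)%N -> idx k w -> N (lw w u)) ->
  N (lw (tg b p ++ (~~ b, j) :: r) u) -> N (lw ((~~ b, j) :: tg b p ++ r) u).
Proof.
move=> wu; elim: p N => //= i p IHp N sN /and3P[jk ik pk] Nw N1.
have pk' : idx k (tg b p ++ r) by [].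
have [c ->] : exists c, EF (~~ b) j * (EF b i * lw (tg b p ++ r) u) =
    EF b i * (EF (~~ b) j * lw (tg b p ++ r) u) + c *: lw (tg b p ++ r) u.
  have [c E] := EF_swap pi_lin pi_mon pi_rel q0 (if b then i else j)
     (if b then j else i) (wt_lw (tg b p ++ r) wu).
  by case: (b) E => E; [exists (- c)|exists c]; rewrite E // scaleNr addrK.
apply: submodD => //; last first.
  apply: submodZ => //; apply: Nw => //; rewrite size_cat size_map; lia.
apply: (IHp (fun y => N (EF b i * y))) => //.
- exact: (@submod_preim _ _ N (EFl pi b i) sN).
- by rewrite /= jk pk.
by move=> w sw wk; apply: (Nw ((b, i) :: w)); rewrite /= ?ik //; lia.
Qed.

Definition part b w := [seq l.2 | l <- w & l.1 == b].

Lemma size_part b w : (size (part b w) + size (part (~~ b) w))%N = size w.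
Proof.
by elim: w => //= -[c i] w; rewrite /part /=; case: b c => [] [] /= IHw; lia.
Qed.

Lemma part_cat b w1 w2 : part b (w1 ++ w2) = part b w1 ++ part b w2.
Proof. by rewrite /part filter_cat map_cat. Qed.

Lemma part_tg b c s : part b (tg c s) = if c == b then s else [::].
Proof.
case: eqP => [<-|/eqP/negPf ncb]; elim: s => //= i s IHs; rewrite /part /=.
  by rewrite eqxx /= -/(part _ _) IHs.
by rewrite ncb.
Qed.

Lemma all_part k b w : idx k w -> all (fun l => l < k)%N (part b w).
Proof.
elim: w => //= -[c i] w IHw /= /andP[ik /IHw]; rewrite /part /=.
by case: (c == b) => //= ->; rewrite ik.
Qed.

Lemma lw_reorder k b w la u N : wt la u -> submod N -> idx k w ->
  (forall w', (size w' < size w)%N -> idx k w' -> N (lw w' u)) ->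
  N (lw (tg b (part b w) ++ tg (~~ b) (part (~~ b) w)) u) -> N (lw w u).
Proof.
move=> wu; elim: w N => //= -[c i] w IHw N sN /= /andP[ik wk] Nw N1.
apply: (IHw (fun y => N (EF c i * y))) => //.
- exact: (@submod_preim _ _ N (EFl pi c i) sN).
- by move=> w' sw' wk'; apply: (Nw ((c, i) :: w')) => //=; rewrite ik.
have [Ecb|] := eqVneq c b.
  by move: N1; rewrite /part /= Ecb eqxx; case: (b).
move=> ncb; have {ncb} Ec : c = ~~ b by move: ncb; clear; case: c b => [] [].
rewrite Ec in N1 Nw *; apply: (move_letter wu (k := k)) => //.
- rewrite /= ik /idx all_cat -!/(idx k _) !idx_tg !all_part //.
- by move=> w' sw'; apply: Nw; move: sw'; rewrite [size (tg _ _)]size_map size_part.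
by move: N1; rewrite /part /= eqxx; case: (b).
Qed.

(** Induction on the rank, and inside it on the length of the word. The E-part is straightened from
    the left and the F-part from the right, which leaves a word of smaller rank acting on another
    weight vector. The bound on the column sums is what later allows the diagonal of [A] to be
    filled in. *)
Theorem pbw_span k : (k <= n')%N -> forall la u N, submod N -> wt la u ->
  (forall A : nat -> nat -> nat, (forall j, (j <= k)%N -> (\sum_(i < k.+1 | i != j :> nat) A i j)%N%:Z <= la j) ->
     N (lw (wordA A k) u)) ->
  forall w, idx k w -> N (lw w u).
Proof.
elim: k => [|k IHk] lekn la u N sN wu NA.
  case=> [|//] _; have [la0|la0] := lerP 0 (la 0%N).
    by apply: (NA (fun _ _ => 0%N)) => j; rewrite leqn0 => /eqP->; rewrite big1.
  by rewrite (wt_neg pi_lin pi_mon pi_rel q_inj wu _ la0) // lw0; apply: submod0.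
move=> w; have [m] := ubnP (size w).
elim: m w => // m IHm w /[!ltnS] sw wk.
have Nshort w' : (size w' < size w)%N -> idx k.+1 w' -> N (lw w' u).
  by move=> sw'; apply: IHm; apply: leq_trans sw' sw.
apply: (lw_reorder (b := true) wu (k := k.+1)) => //.
rewrite lw_cat lw_word.
apply: (word_sorted_stair_span q0 qgam_neq0 (EFl_serre pi_lin pi_mon pi_rel true)
  (EFl_far pi_lin pi_mon pi_rel true) sN (all_part _ wk)).
move=> m1 s1 sm1 om1 ls1 E1; rewrite stair_word -!lw_word.
set p2 := part (~~ true) w.
(* As right multiplications applied to 1 the F-word is read backwards, so the straightening lemma
   collects the F-block at its right end. *)
have -> : lw (tg (~~ true) p2) u = word (EFr pi false) (rev p2) 1 * u.
  by rewrite wordr_lw mul1r /tg -map_rev revK.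
pose N2 y := N (lw (tg true (stairw 0 m1)) (lw (tg true s1) (y * u))).
have sN2 : submod N2.
  split; first by rewrite /N2 mul0r !lw0; apply: submod0.
  move=> c x y Nx Ny; rewrite /N2 mulrDl -scalerAl !linearP.
  by case: sN => _; apply.
have lp2 : all (fun l => l < k.+1)%N (rev p2) by rewrite all_rev all_part.
apply: (word_sorted_stair_span q0 qgam_neq0 (EFr_serre pi_lin pi_mon pi_rel false)
  (EFr_far pi_lin pi_mon pi_rel false) sN2 lp2).
move=> m2 s2 sm2 om2 ls2 E2; rewrite /N2 stair_word !wordr_lw mul1r -!tg_rev.
(* the monomial is now Z(m1) s1 s2 Z'(m2) u, with s1, s2 words of smaller rank *)
set t2 := rev (stairw 0 m2); set t1 := stairw 0 m1.
have lt1 : all (fun l => l < k.+1)%N t1 by apply: all_stairw; rewrite sm1.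
have lt2 : all (fun l => l < k.+1)%N t2 by rewrite all_rev; apply: all_stairw; rewrite sm2.
have ls1' : all (fun l => l < k.+1)%N s1 by apply: sub_all ls1 => l /ltnW.
have ls2' : all (fun l => l < k.+1)%N s2 by apply: sub_all ls2 => l /ltnW.
(* E_k is the only E of this rank that changes entry k + 1, and [s1] does not contain it. If it
   occurs more than la (k+1) times, the E-word acting first on [u] produces a negative weight entry,
   so the monomial reduces to shorter words. *)
have [le1|ltm1] := lerP (nth 0%N m1 k)%:Z (la k.+1); last first.
  pose W := tg true t1 ++ tg true s1 ++ tg false (rev s2) ++ tg false t2.
  suff : N (lw W u) by rewrite /W !lw_cat.
  have sW : size W = size w.
    rewrite /W !size_cat !size_map !size_rev !size_stairw.
    rewrite -[RHS](size_part true) -E1 -[size (part (~~ true) w)]size_rev -E2.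
    by rewrite -!addnA; congr (_ + (_ + _))%N; apply: addnC.
  apply: (lw_reorder (b := false) (k := k.+1) wu) => //.
  - by rewrite /W /idx !all_cat -!/(idx _ _) !idx_tg all_rev lt1 ls1' ls2' lt2.
  - by rewrite sW.
  rewrite /W !part_cat !part_tg /= cats0 lw_cat.
  suff -> : lw (tg true (t1 ++ s1)) u = 0 by rewrite lw0; apply: submod0.
  have wu1 := wt_lw (tg true (t1 ++ s1)) wu.
  apply: (wt_neg pi_lin pi_mon pi_rel q_inj (j := k.+1) wu1) => //.
  have count0 s : all (fun l => l < k.+1)%N s -> count_mem k.+1 s = 0%N.
    by move/allP => ls; apply/count_memPn/negP => /ls; rewrite ltnn.
  rewrite wtw_tg !count_cat !count0 // count_stairw subn0 /= mul1r.
  by move: ltm1; clear; lia.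
rewrite -[lw (tg true s1) _]lw_cat.
apply: (IHk (ltnW lekn) _ _ (fun y => N (lw (tg true t1) y)) _ (wt_lw (tg false t2) wu)).
- exact: (@submod_preim _ _ N (lw (tg true t1)) sN).
- move=> A HA.
  have E : tg true t1 ++ wordA A k ++ tg false t2 = wordA (glue A k.+1 m1 m2) k.+1.
    rewrite wordAS colA_glue // rowA_glue // tg_rev.
    congr (_ ++ (_ ++ _)); apply: eq_wordA => i j _ lei lej.
    by rewrite /glue !ltn_eqF.
  suff : N (lw (wordA (glue A k.+1 m1 m2) k.+1) u) by rewrite -E !lw_cat.
  apply: NA => j; rewrite leq_eqVlt => /predU1P[->|ltj].
    rewrite big_mkcond big_ord_recr /= eqxx addn0.
    under eq_bigr => i _ do rewrite (ltn_eqF (ltn_ord i)) /= /glue eqxx.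
    by rewrite sum_stepd ?sm1.
  (* Entry j of the weight of Z'(m2) u is la j minus the number of letters moved from v_j to
     v_(k+1); that number is the entry (k+1, j) of the glued matrix. *)
  have HAj : (\sum_(i < k.+1 | i != j :> nat) A i j)%N%:Z <= la j - (stepd m2 j)%:Z.
    have := HA j ltj; rewrite wtw_tg !count_rev mulN1r (stepdZ om2) ?sm2 //.
    by rewrite count_stairw subn0 /=; case: (j) => [|j']; rewrite // count_rev count_stairw subn0.
  rewrite big_mkcond big_ord_recr -big_mkcond /= /glue (ltn_eqF ltj) eqxx.
  rewrite (gtn_eqF ltj) /= (eq_bigr (fun i : 'I_k.+1 => A i j)); last first.
    by move=> i _; rewrite (ltn_eqF (ltn_ord i)).
  by rewrite PoszD -lerBrDr.
rewrite /idx all_cat -!/(idx _ _) !idx_tg all_rev.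
by apply/andP; split; [apply: sub_all ls1|apply: sub_all ls2] => l; rewrite ltnS.
Qed.

End Spanning.

(** * Action on the tensor power *)

Section Coproduct.
Variables (F : fieldType) (q : F) (M : lmodType F).
Variables (I : eqType) (adj : rel I).
Hypothesis q0 : q != 0.
Hypothesis adj_sym : symmetric adj.

Definition serre_family (A : I -> {linear M -> M}) := forall i j x,
  if adj i j then
    A i (A i (A j x)) - (q + q^-1) *: A i (A j (A i x)) + A j (A i (A i x)) = 0
  else A i (A j x) = A j (A i x).

Variables A B K : I -> {linear M -> M}.
Hypothesis adj_irr : irreflexive adj.
Hypothesis serreA : serre_family A.
Hypothesis serreB : serre_family B.
Hypothesis AB : forall i j x, B i (A j x) = A j (B i x).
Hypothesis KB : forall i j x, B i (K j x) = K j (B i x).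
Hypothesis KK : forall i j x, K i (K j x) = K j (K i x).
Hypothesis AK : forall i j x, A j (K i x) =
  (if i == j then q ^+ 2 else if adj i j then q^-1 else 1) *: K i (A j x).

(** The Serre relations survive the coproduct. [A] and [B] are the generators on two different
    tensor factors, and [K] is a Cartan element on the factor of [A], so [A] and [K] q-commute
    according to the Cartan matrix. For the E's, [A] lives on the first place; for the F's, on the
    remaining ones. *)
Lemma serre_coproduct (C : I -> {linear M -> M}) :
  (forall i x, C i x = A i x + K i (B i x)) -> serre_family C.
Proof.
move=> CE i j x; have := serreA i j; have := serreB i j; case: ifP => ij SB SA.
  have nij : i == j = false by apply/eqP => E; rewrite E adj_irr in ij.
  have nji : j == i = false by rewrite eq_sym.
  have ji : adj j i by rewrite adj_sym.
  have AKii y : A i (K i y) = q ^+ 2 *: K i (A i y) by rewrite AK eqxx.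
  have AKij y : A i (K j y) = q^-1 *: K j (A i y) by rewrite AK nji ji.
  have AKji y : A j (K i y) = q^-1 *: K i (A j y) by rewrite AK nij ij.
  have KKij y : K j (K i y) = K i (K j y) by rewrite KK.
  have SA' y : A i (A i (A j y)) = (q + q^-1) *: A i (A j (A i y)) - A j (A i (A i y)).
    by apply/eqP; rewrite -subr_eq0 opprB addrA -(SA y) addrAC; apply/eqP; lmod F; ring.
  have SB' y : B i (B i (B j y)) = (q + q^-1) *: B i (B j (B i y)) - B j (B i (B i y)).
    by apply/eqP; rewrite -subr_eq0 opprB addrA -(SB y) addrAC; apply/eqP; lmod F; ring.
  have AB1 := (AB i i, AB i j, AB j i, AB j j).
  have KB1 := (KB i i, KB i j, KB j i, KB j j).
  rewrite !CE !(linE (A i), linE (A j), linE (B i), linE (B j), linE (K i), linE (K j),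
     AKii, AKij, AKji, AB1, KB1, KKij, SA', SB').
  by lmod F; field.
case: (eqVneq i j) => [-> //|nij].
have {}nij : i == j = false by apply/negbTE.
have nji : j == i = false by rewrite eq_sym.
have ji : adj j i = false by rewrite adj_sym.
have AKij y : A i (K j y) = K j (A i y) by rewrite AK nji ji scale1r.
have AKji y : A j (K i y) = K i (A j y) by rewrite AK nij ij scale1r.
rewrite !CE !(linE (A i), linE (A j), linE (K i), linE (K j), linE (B i), linE (B j)).
by rewrite !AB !KB AKij AKji KK SA SB; lmod F; ring.
Qed.

(** Here [e], [f], [k'], [h] belong to the first place and [E], [G], [k], [h'] to the others. The
    mixed terms cancel because both exchanges produce the same factor [a]; the rest telescopes as k
    (k' - h) + h (k - h'). *)
Lemma bracket_coproduct (e f E G k k' h h' : {linear M -> M}) (a c : F) x :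
  (forall y, k (E y) = a *: E (k y)) -> (forall y, h (f y) = a *: f (h y)) ->
  (forall y, h (E y) = E (h y)) -> (forall y, h (G y) = G (h y)) ->
  (forall y, k (e y) = e (k y)) -> (forall y, k (f y) = f (k y)) ->
  (forall y, k (h y) = h (k y)) -> (forall y, k' (k y) = k (k' y)) ->
  (forall y, h' (h y) = h (h' y)) ->
  (forall y, E (f y) = f (E y)) -> (forall y, G (e y) = e (G y)) ->
  (forall y, e (f y) = f (e y) + c *: (k' y - h y)) ->
  (forall y, E (G y) = G (E y) + c *: (k y - h' y)) ->
  e (G x + k (f x)) + h (E (G x + k (f x))) - (G (e x + h (E x)) + k (f (e x + h (E x)))) =
  c *: (k (k' x) - h (h' x)).
Proof.
move=> kE hf hE hG ke kf kh k'k h'h Ef Ge ef EG.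
rewrite !(linE e, linE f, linE E, linE G, linE k, linE h, kE, hf, hE, hG, ke, kf, kh,
  k'k, h'h, Ef, Ge, ef, EG).
by lmod F; ring.
Qed.

End Coproduct.

Section TensorOperators.
Variables (F : fieldType) (q : F) (n' d : nat).
Local Notation n := n'.+1.
Local Notation W := (tens F n d).
Local Notation tup := (d.-tuple 'I_n).
Hypothesis q0 : q != 0.
Implicit Types (b : bool) (i j : 'I_n.-1) (p r : 'I_d) (s : tup) (x : W).

Definition upd s p (a : 'I_n) : tup := [tuple if r == p then a else tnth s r | r < d].

Lemma tnth_upd s p a r : tnth (upd s p a) r = if r == p then a else tnth s r.
Proof. exact: tnth_mktuple. Qed.

Lemma upd_upd s p a a' : upd (upd s p a) p a' = upd s p a'.
Proof. by apply: eq_from_tnth => r; rewrite !tnth_upd; case: eqP. Qed.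

Lemma upd_comm s p r a a' : p != r -> upd (upd s p a) r a' = upd (upd s r a') p a.
Proof.
move=> pr; apply: eq_from_tnth => t; rewrite !tnth_upd.
by case: eqP => [->|//]; rewrite eq_sym (negPf pr).
Qed.

Lemma upd_id s p a : tnth s p = a -> upd s p a = s.
Proof. by move=> <-; apply: eq_from_tnth => r; rewrite tnth_upd; case: eqP => [->|]. Qed.

(* Operators are written as substitutions: the matrix unit sending v_(src b i)
   to v_(dst b i) replaces the value of x at s by its value at the tuple where
   the entry dst b i of s is turned back into src b i. *)
Definition dst b i : 'I_n := if b then lo i else hi i.
Definition src b i : 'I_n := if b then hi i else lo i.

Definition site b i p x : W :=
  [ffun s => if tnth s p == dst b i then x (upd s p (src b i)) else 0].
Definition dgq (e : tup -> int) x : W := [ffun s => q ^ e s * x s].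

Fact evD x y s : (x + y) s = x s + y s. Proof. exact: ffunE. Qed.
Fact evZ c x s : (c *: x) s = c * x s. Proof. exact: ffunE. Qed.
Fact evN x s : (- x) s = - x s. Proof. exact: ffunE. Qed.
Fact ev0 s : (0 : W) s = 0. Proof. exact: ffunE. Qed.
Fact siteE b i p x s :
  site b i p x s = if tnth s p == dst b i then x (upd s p (src b i)) else 0.
Proof. exact: ffunE. Qed.
Fact dgqE e x s : dgq e x s = q ^ e s * x s. Proof. exact: ffunE. Qed.

Fact site_linear b i p : linear (site b i p).
Proof.
move=> c x y; apply/ffunP => s; rewrite evD evZ !siteE.
by case: ifP; rewrite ?evD ?evZ // mulr0 addr0.
Qed.
HB.instance Definition _ b i p := GRing.isLinear.Build F W W _ (site b i p) (site_linear b i p).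

Fact dgq_linear e : linear (dgq e).
Proof. by move=> c x y; apply/ffunP => s; rewrite !(evD, evZ, dgqE); ring. Qed.
HB.instance Definition _ e := GRing.isLinear.Build F W W _ (dgq e) (dgq_linear e).

Lemma dgq_comm e e' x : dgq e (dgq e' x) = dgq e' (dgq e x).
Proof. by apply/ffunP => s; rewrite !dgqE mulrCA. Qed.

Lemma dgqD e e' x : dgq e (dgq e' x) = dgq (fun s => e s + e' s) x.
Proof. by apply/ffunP => s; rewrite !dgqE mulrA expfzDr. Qed.

Lemma eq_dgq e e' x : e =1 e' -> dgq e x = dgq e' x.
Proof. by move=> E; apply/ffunP => s; rewrite !dgqE E. Qed.

Lemma site_dgq b i p c e x :
  (forall s, tnth s p = dst b i -> e s = c + e (upd s p (src b i))) ->
  dgq e (site b i p x) = q ^ c *: site b i p (dgq e x).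
Proof.
move=> He; apply/ffunP => s; rewrite evZ dgqE !siteE; case: eqP => [/He->|_].
  by rewrite dgqE expfzDr // mulrA.
by rewrite !mulr0.
Qed.

Lemma site_comm b b' i j p r x : p != r ->
  site b i p (site b' j r x) = site b' j r (site b i p x).
Proof.
move=> pr; apply/ffunP => s; rewrite !siteE !tnth_upd [r == p]eq_sym (negPf pr).
by case: ifP => _; case: ifP => _ //; rewrite upd_comm.
Qed.

Lemma site_site b i j p x s : site b i p (site b j p x) s =
  if (tnth s p == dst b i) && (src b i == dst b j) then x (upd s p (src b j)) else 0.
Proof. by rewrite !siteE; case: eqP => //= _; rewrite tnth_upd eqxx upd_upd. Qed.

Lemma src_dst b i j : (src b i == dst b j) =
  if b then (j == i.+1 :> nat) else (i == j.+1 :> nat).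
Proof. by rewrite -val_eqE; case: b => //=; rewrite eq_sym. Qed.

Lemma adjacentE i j : adjacent i j = (j == i.+1 :> nat) || (i == j.+1 :> nat).
Proof. by rewrite /adjacent; case: i => i ?; case: j => j ? /=; lia. Qed.

Lemma site_serre b p : serre_family q (@adjacent n) (fun i => site b i p).
Proof.
move=> i j x; case: ifP => ij; apply/ffunP => s.
  have E k l m y : site b k p (site b l p (site b m p y)) s = 
     if (src b k == dst b l) && (src b l == dst b m) then site b k p (site b l p (site b m p y)) s else 0.
    rewrite site_site siteE tnth_upd eqxx; case: (_ == dst b l) => /=; last by rewrite andbF.
    by rewrite andbT; case: (_ == dst b m) => //=; rewrite if_same.
  rewrite !evD -scaleNr evZ E [X in _ * X]E [X in _ + X]E.
  rewrite !src_dst ev0; rewrite adjacentE in ij.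
  by case: (b); case: i j ij => i ? [j ?] /= ij; rewrite !ifF; rewrite ?mulr0 ?addr0 //; lia.
rewrite !site_site !src_dst; move: ij; rewrite adjacentE => /negbT; rewrite negb_or.
by case/andP=> /negPf E1 /negPf E2; case: (b); rewrite ?E1 ?E2 !andbF.
Qed.

(** The exponent with which K_i^-1 K_(i+1) acts on v_a. *)
Definition wexp i (a : 'I_n) : int := (a == hi i)%:Z - (a == lo i)%:Z.
Definition hsum i (l : seq 'I_d) s : int := \sum_(p <- l) wexp i (tnth s p).

(* The coproduct E |-> E (x) 1 + K_i^-1 K_(i+1) (x) E,
   F |-> F (x) K_i K_(i+1)^-1 + 1 (x) F, iterated over the tensor places in l. *)
Fixpoint tEF b i (l : seq 'I_d) x : W :=
  if l is p :: l' then
    if b then site b i p x + dgq (hsum i [:: p]) (tEF b i l' x)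
    else tEF b i l' x + dgq (fun s => - hsum i l' s) (site b i p x)
  else 0.

Fact tEF_linear b i l : linear (tEF b i l).
Proof.
elim: l => [|p l IHl] c x y /=; first by rewrite scaler0 addr0.
by case: (b) IHl => IHl; rewrite IHl !linearP /=; lmod F; ring.
Qed.
HB.instance Definition _ b i l := GRing.isLinear.Build F W W _ (tEF b i l) (tEF_linear b i l).

Lemma tEF_dgq b i l c e x :
  (forall p s, p \in l -> tnth s p = dst b i -> e s = c + e (upd s p (src b i))) ->
  dgq e (tEF b i l x) = q ^ c *: tEF b i l (dgq e x).
Proof.
elim: l => [|p l IHl] He; first by rewrite linear0 scaler0.
have He1 s : tnth s p = dst b i -> e s = c + e (upd s p (src b i)).
  by apply: He; rewrite mem_head.
have {}IHl : dgq e (tEF b i l x) = q ^ c *: tEF b i l (dgq e x).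
  by apply: IHl => r s rl; apply: He; rewrite inE rl orbT.
move: He1 IHl; rewrite /=; case: b {He} => He1 IHl.
  by rewrite (linopD (dgq e)) /= dgq_comm IHl (site_dgq _ He1) linopZ scalerDr.
by rewrite (linopD (dgq e)) /= dgq_comm IHl (site_dgq _ He1) linopZ scalerDr.
Qed.

Lemma tEF_site b b' i j l p x : p \notin l ->
  tEF b i l (site b' j p x) = site b' j p (tEF b i l x).
Proof.
have dgs e y : (forall s a, e (upd s p a) = e s) -> dgq e (site b' j p y) = site b' j p (dgq e y).
  by move=> He; rewrite (@site_dgq _ _ _ 0) ?scale1r // => s _; rewrite He add0r.
elim: l => [|r l IHl] /=; first by rewrite linear0.
rewrite inE negb_or => /andP[pr pl].
have H1 s a : hsum i [:: r] (upd s p a) = hsum i [:: r] s.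
  by rewrite /hsum !big_seq1 tnth_upd eq_sym (negPf pr).
have H2 s a : hsum i l (upd s p a) = hsum i l s.
  apply: eq_big_seq => t tl; rewrite tnth_upd; case: eqP => // E.
  by rewrite -E tl in pl.
case: (b) (IHl pl) => {}IHl; rewrite IHl linopD ?dgs //; rewrite eq_sym in pr.
  by rewrite site_comm.
by rewrite site_comm // dgs // => s a; rewrite H2.
Qed.

(** Up to sign the Cartan pairing of alpha_i and alpha_j; see [hshiftE]. *)
Definition hshift b i j : int := wexp i (dst b j) - wexp i (src b j).

Lemma hsum_upd i l s p a : uniq l ->
  hsum i l (upd s p a) = if p \in l then hsum i l s - wexp i (tnth s p) + wexp i a
                         else hsum i l s.
Proof.
elim: l => [|r l IHl] /=; first by rewrite /hsum !big_nil.
case/andP=> rl /IHl {}IHl; rewrite inE.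
have -> : hsum i (r :: l) (upd s p a) = wexp i (tnth (upd s p a) r) + hsum i l (upd s p a).
  by rewrite /hsum big_cons.
have -> : hsum i (r :: l) s = wexp i (tnth s r) + hsum i l s by rewrite /hsum big_cons.
rewrite {}IHl tnth_upd eq_sym; case: eqP => /= [->|_]; last by case: ifP => _; ring.
by rewrite (negPf rl); ring.
Qed.

Lemma hshiftE b i j : hshift b i j =
  (if b then -1 else 1) * (if i == j then 2 else if adjacent i j then -1 else 0).
Proof.
rewrite /hshift /wexp /dst /src adjacentE -!val_eqE.
by case: b; case: i => i ?; case: j => j ? /=; do ![case: eqP => ? /=]; rewrite ?mul1r ?mulN1r ?mulr0 //; lia.
Qed.

Lemma hshiftN i j : hshift false i j = - hshift true i j.
Proof. by rewrite !hshiftE mulN1r opprK mul1r. Qed.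

Lemma expr_hshift i j : q ^ (- hshift true i j) =
  if i == j then q ^+ 2 else if adjacent i j then q^-1 else 1.
Proof. by rewrite hshiftE mulN1r opprK; case: ifP => _ //; case: ifP. Qed.

Lemma dgq_shiftV c e x y : dgq e y = q ^ c *: x -> x = q ^ (- c) *: dgq e y.
Proof. by move=> ->; rewrite scalerA -expfzDr // addNr scale1r. Qed.

Lemma tEF_serre b l : uniq l -> serre_family q (@adjacent n) (fun i => tEF b i l).
Proof.
have adj_sym : symmetric (@adjacent n) by move=> i j; rewrite !adjacentE orbC.
have adj_irr : irreflexive (@adjacent n) by move=> i; rewrite adjacentE; lia.
elim: l => [|p l IHl] /=.
  by move=> _ i j x; case: ifP => _ //=; rewrite scaler0 subr0 addr0.
case/andP=> pl ul; have {}IHl := IHl ul; case: b IHl => IHl.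
  apply: (@serre_coproduct _ q _ _ (@adjacent n) q0 adj_sym (fun i => site true i p)
    (fun i => tEF true i l) (fun i => dgq (hsum i [:: p]))) => //.
  - exact: site_serre.
  - by move=> i j x; apply: tEF_site.
  - move=> i j x; rewrite [RHS](@tEF_dgq _ _ _ 0) ?scale1r // => r s rl _.
    rewrite hsum_upd // inE; case: eqP => [E|_]; last by rewrite add0r.
    by rewrite -E rl in pl.
  - by move=> i j x; apply: dgq_comm.
  move=> i j x /=; rewrite -expr_hshift; apply: dgq_shiftV; apply: site_dgq => s E.
  by rewrite hsum_upd // mem_head /hsum big_seq1 E /hshift; ring.
apply: (@serre_coproduct _ q _ _ (@adjacent n) q0 adj_sym (fun i => tEF false i l)
  (fun i => site false i p) (fun i => dgq (fun s => - hsum i l s))) => //.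
- exact: site_serre.
- by move=> i j x; apply/esym/tEF_site.
- move=> i j x; rewrite [RHS](@site_dgq _ _ _ 0) ?scale1r // => s _.
  by rewrite hsum_upd // (negPf pl) add0r.
- by move=> i j x; apply: dgq_comm.
move=> i j x /=; rewrite -expr_hshift; apply: dgq_shiftV; apply: tEF_dgq => r s rl E.
by rewrite hsum_upd // rl -[hshift _ _ _]opprK -hshiftN /hshift E; ring.
Qed.

Hypothesis q2 : q - q^-1 != 0.

Lemma site_bracket i j p x :
  site true i p (site false j p x) - site false j p (site true i p x) =
  ((i == j)%:R * (q - q^-1)^-1) *:
    (dgq (fun s => - hsum i [:: p] s) x - dgq (hsum i [:: p]) x).
Proof.
apply/ffunP => s; rewrite !(evD, evN, evZ) !dgqE !siteE !tnth_upd !eqxx.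
rewrite /= !upd_upd /hsum big_seq1 /wexp.
have lohi : lo i == hi i = false by rewrite -val_eqE /= ltn_eqF.
have [<-|nij] := eqVneq i j; last first.
  have E1 : hi i == hi j = false by rewrite -val_eqE /= eqSS; apply/negbTE.
  have E2 : lo j == lo i = false by rewrite -val_eqE /= eq_sym; apply/negbTE.
  by rewrite E1 E2 !if_same subrr !mul0r.
rewrite !eqxx mul1r; case: eqP => [E|_].
  rewrite E lohi upd_id // subr0.
  have -> : - (false%:Z - true%:Z) = 1 by [].
  have -> : false%:Z - true%:Z = -1 by [].
  by rewrite expr1z exprN1 -mulrBl mulKf.
case: eqP => [E|_]; last by rewrite !mul1r !subrr mulr0.
rewrite upd_id // sub0r.
have -> : - (true%:Z - false%:Z) = -1 by [].
have -> : true%:Z - false%:Z = 1 by [].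
by rewrite expr1z exprN1 -mulrBl -[q^-1 - q]opprB mulNr mulrN mulKf.
Qed.

Lemma tEF_bracket l i j x : uniq l ->
  tEF true i l (tEF false j l x) - tEF false j l (tEF true i l x) =
  ((i == j)%:R * (q - q^-1)^-1) *:
    (dgq (fun s => - hsum i l s) x - dgq (hsum i l) x).
Proof.
set c := _ * _; elim: l x => [|p l IHl] x.
  move=> _; suff -> : dgq (fun s => - hsum i [::] s) x = dgq (hsum i [::]) x.
    by rewrite !subrr scaler0.
  by apply: eq_dgq => s; rewrite /hsum !big_nil oppr0.
rewrite [uniq _]/= => /andP[pl ul]; have {}IHl y := IHl y ul.
have e1 y : tEF true i l (dgq (fun s => - hsum j l s) y) =
   q ^ (hshift true j i) *: dgq (fun s => - hsum j l s) (tEF true i l y).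
  rewrite (@tEF_dgq _ _ _ (- hshift true j i)) => [|r s rl E].
    by rewrite scalerA -expfzDr // subrr scale1r.
  by rewrite hsum_upd // rl E /hshift; ring.
have e2 y : dgq (hsum i [:: p]) (site false j p y) =
   q ^ (- hshift true i j) *: site false j p (dgq (hsum i [:: p]) y).
  apply: site_dgq => s E.
  by rewrite -hshiftN hsum_upd // mem_head /hsum big_seq1 E /hshift; ring.
have e3 b k y : dgq (hsum i [:: p]) (tEF b k l y) = tEF b k l (dgq (hsum i [:: p]) y).
  rewrite (@tEF_dgq _ _ _ 0) ?scale1r // => r s rl _.
  rewrite hsum_upd // inE; case: eqP => [E|_]; last by rewrite add0r.
  by rewrite -E rl in pl.
have e4 b k y : dgq (fun s => - hsum j l s) (site b k p y) =
    site b k p (dgq (fun s => - hsum j l s) y).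
  rewrite (@site_dgq _ _ _ 0) ?scale1r // => s _.
  by rewrite hsum_upd // (negPf pl) add0r.
have hsym : hshift true i j = hshift true j i.
  by rewrite !hshiftE !adjacentE [i == j]eq_sym orbC.
have e5 y : dgq (fun s => - hsum j l s) (dgq (hsum i [:: p]) y) =
    dgq (hsum i [:: p]) (dgq (fun s => - hsum j l s) y) by rewrite dgq_comm.
have e6 y : tEF true i l (site false j p y) = site false j p (tEF true i l y).
  exact: tEF_site.
have e7 y : tEF false j l (site true i p y) = site true i p (tEF false j l y).
  exact: tEF_site.
have e8 y : site true i p (site false j p y) = site false j p (site true i p y) +
    c *: (dgq (fun s => - hsum i [:: p] s) y - dgq (hsum i [:: p]) y).
  by rewrite -site_bracket addrC subrK.
have e9 y : tEF true i l (tEF false j l y) = tEF false j l (tEF true i l y) +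
    c *: (dgq (fun s => - hsum i l s) y - dgq (hsum i l) y).
  by rewrite -IHl addrC subrK.
have e10 : dgq (fun s => - hsum i (p :: l) s) x =
    dgq (fun s => - hsum i l s) (dgq (fun s => - hsum i [:: p] s) x).
  rewrite dgqD; apply: eq_dgq => s; rewrite /hsum big_cons big_seq1; ring.
have e11 : dgq (hsum i (p :: l)) x = dgq (hsum i [:: p]) (dgq (hsum i l) x).
  by rewrite dgqD; apply: eq_dgq => s; rewrite /hsum big_cons big_seq1.
have e12 : dgq (fun s => - hsum i l s) (dgq (hsum i [:: p]) x) =
    dgq (hsum i [:: p]) (dgq (fun s => - hsum i l s) x) by apply: dgq_comm.
have e13 y : dgq (fun s => - hsum i [:: p] s) (dgq (fun s => - hsum j l s) y) =
    dgq (fun s => - hsum j l s) (dgq (fun s => - hsum i [:: p] s) y) by apply: dgq_comm.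
have [a a0 [ha ha']] : exists2 a : F, a != 0 &
    q ^ (hshift true j i) = a /\ q ^ (- hshift true i j) = a^-1.
  by exists (q ^ hshift true j i); rewrite ?expfz_neq0 // hsym invr_expz.
rewrite ha in e1; rewrite ha' in e2.
have {}e1 y : dgq (fun s => - hsum j l s) (tEF true i l y) =
    a^-1 *: tEF true i l (dgq (fun s => - hsum j l s) y) by rewrite e1 scalerA mulVf ?scale1r.
rewrite e10 e11 /=.
(* For distinct i and j the Cartan operators involved belong to different indices, and the coproduct
   identity is applied with the constant 0; for i = j all of them belong to i. *)
have [c0|Eij] : c = 0 \/ i = j.
- by rewrite /c; case: eqP => [->|_]; [right|left; rewrite mul0r].
- rewrite c0 in e8 e9 *; rewrite scale0r.
  apply: etrans (_ : _ = 0 *: (_ (dgq (fun s => - hsum i [:: p] s) x) - _ (dgq (hsum i l) x))) _; last by rewrite scale0r.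
  apply: (bracket_coproduct (a := a^-1)
    (k := dgq (fun s => - hsum j l s)) (k' := dgq (fun s => - hsum i [:: p] s))
    (h' := dgq (hsum i l))) => //= y; by [exact: dgq_comm|rewrite e9 !scale0r].
rewrite -Eij in e1 e2 e4 e5 e6 e7 e8 e9 e13 *.
apply: (bracket_coproduct (a := a^-1) (k := dgq (fun s => - hsum i l s))
  (k' := dgq (fun s => - hsum i [:: p] s)) (h' := dgq (hsum i l))) => //= y; exact: dgq_comm.
Qed.
End TensorOperators.

(** * Evaluating the defining relations in an action *)

Section FreeActions.
Variables (F : fieldType) (X : choiceType) (V : lmodType F) (T : X -> {linear V -> V}).
Local Notation A := (freeAct T).
Implicit Types (a b : freeAlg F X) (u : V).

Fact act_mulB a b a' b' u : A (a * b - a' * b') u = A a (A b u) - A a' (A b' u).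
Proof. by apply: etrans (freeActB _ _ _ _) _; congr (_ - _); exact: freeActM. Qed.

Fact act_scaleM c a b u : A (c *: (a * b)) u = c *: A a (A b u).
Proof. by apply: etrans (freeActZ _ _ _ _) _; congr (_ *: _); exact: freeActM. Qed.

Fact act_serre a b c u : A (a ^+ 2 * b - c *: (a * b * a) + b * a ^+ 2) u =
  A a (A a (A b u)) - c *: A a (A b (A a u)) + A b (A a (A a u)).
Proof.
apply: etrans (freeActD _ _ _ _) _; congr (_ + _); last first.
  by apply: etrans (freeActM _ _ _ _) _; congr (A b _); exact: freeActM.
apply: etrans (freeActB _ _ _ _) _; congr (_ - _).
  by apply: etrans (freeActM _ _ _ _) _; exact: freeActM.
apply: etrans (act_scaleM _ _ _ _) _; congr (_ *: _); exact: freeActM.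
Qed.

Fact act_gen_serre x y c u :
  A (gen F x ^+ 2 * gen F y - c *: (gen F x * gen F y * gen F x) + gen F y * gen F x ^+ 2) u =
  T x (T x (T y u)) - c *: T x (T y (T x u)) + T y (T x (T x u)).
Proof.
have g := freeAct_gen T; apply: etrans (act_serre _ _ _ _) _.
by congr (_ - _ *: _ + _); rewrite 3!g.
Qed.

Fact act_scaleB c c' a b a' b' u : A (c *: (c' *: (a * b - a' * b'))) u =
  c *: (c' *: (A a (A b u) - A a' (A b' u))).
Proof.
apply: etrans (freeActZ _ _ _ _) _; congr (_ *: _).
by apply: etrans (freeActZ _ _ _ _) _; congr (_ *: _); exact: act_mulB.
Qed.

Fact act_subA c a u : A (a - c%:A) u = A a u - c *: u.
Proof.
apply: etrans (freeActB _ _ _ _) _; congr (_ - _).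
by apply: etrans (freeActZ _ _ _ _) _; congr (_ *: _); exact: freeAct1.
Qed.

Fact act_scalar c u : A c%:A u = c *: u.
Proof. by apply: etrans (freeActZ _ _ _ _) _; congr (_ *: _); exact: freeAct1. Qed.

End FreeActions.

Section FreeActionsTensor.
Variables (F : fieldType) (X : choiceType) (n d : nat).
Local Notation W := (tens F n d).
Variable T : X -> {linear W -> W}.

Fact act_prod_diag m (a : 'I_m -> freeAlg F X) (e : 'I_m -> d.-tuple 'I_n -> F) u s :
  (forall i u s, freeAct T (a i) u s = e i s * u s) ->
  freeAct T (\prod_i a i) u s = (\prod_i e i s) * u s.
Proof.
move=> He; elim/big_rec2: _ u => [|i y z _ IH] u.
  by rewrite mul1r; exact: (congr1 (fun y : W => y s) (freeAct1 T u)).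
by rewrite -mulrA -IH -He; exact: (congr1 (fun y : W => y s) (freeActM T _ _ u)).
Qed.

End FreeActionsTensor.

(** * The action of the presented algebra *)

Section SchurAction.
Variables (F : fieldType) (q : F) (n' d : nat).
Local Notation n := n'.+1.
Local Notation W := (tens F n d).
Local Notation tup := (d.-tuple 'I_n).
Hypothesis q0 : q != 0.
Hypothesis q2 : q - q^-1 != 0.
Implicit Types (s t : tup) (x : W).

Definition cnt (i : 'I_n) s : int := \sum_p (tnth s p == i)%:Z.

Definition tE i : {linear W -> W} := tEF q true i (enum 'I_d).
Definition tF i : {linear W -> W} := tEF q false i (enum 'I_d).
Definition tK i : {linear W -> W} := dgq q (cnt i).
Definition tK' i : {linear W -> W} := dgq q (fun s => - cnt i s).

Definition schurOp (g : schurGen n) : {linear W -> W} :=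
  match g with
  | GenE i => tE i | GenF i => tF i | GenK i => tK i | GenKinv i => tK' i
  end.

Lemma hsum_cnt i s : hsum i (enum 'I_d) s = cnt (hi i) s - cnt (lo i) s.
Proof. by rewrite /hsum /cnt big_enum /= -sumrB. Qed.

Lemma cnt_upd i s p a : cnt i (upd s p a) = cnt i s - (tnth s p == i)%:Z + (a == i)%:Z.
Proof.
rewrite /cnt (bigD1 p) //= [in RHS](bigD1 p) //= tnth_upd eqxx.
rewrite (eq_bigr (fun r => (tnth s r == i)%:Z)) => [|r /negPf rp]; first by ring.
by rewrite tnth_upd rp.
Qed.

Lemma sum_cnt s : \sum_i cnt i s = d%:Z.
Proof.
rewrite exchange_big /= (eq_bigr (fun=> 1)) => [|p _].
  by rewrite sumr_const card_ord natz.
rewrite (bigD1 (tnth s p)) //= eqxx big1 ?addr0 // => i.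
by rewrite eq_sym => /negPf->.
Qed.

Lemma cnt_nat i s : cnt i s = (\sum_p (tnth s p == i))%N%:Z.
Proof. by rewrite /cnt -(big_morph Posz PoszD (erefl 0)). Qed.

Lemma cnt_le i s : (\sum_p (tnth s p == i) <= d)%N.
Proof.
rewrite -[leqRHS]muln1 -[in leqRHS](card_ord d) -sum_nat_const.
by apply: leq_sum => p _; apply: leq_b1.
Qed.

Lemma dgq_tEF b i j x : dgq q (cnt i) (tEF q b j (enum 'I_d) x) =
  q ^ ((i == dst b j)%:Z - (i == src b j)%:Z) *: tEF q b j (enum 'I_d) (dgq q (cnt i) x).
Proof.
apply: tEF_dgq => // p s _ E; rewrite cnt_upd E ![_ == i]eq_sym; ring.
Qed.

(** For (Q6) and (Q7): K_i acts on v_s by q to the number of entries i in s. These numbers sum to d,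
    and each of them lies between 0 and d, so one factor of (Q7) vanishes on v_s. *)
Theorem schurRel_act a b : schurRel d q a b -> freeAct schurOp a =1 freeAct schurOp b.
Proof.
have g := freeAct_gen schurOp.
case=> {a b} [i j|i|i|i j|i j|i j|i j ij|i j ij|i j ij|i j ij||j] u.
- apply: etrans (freeActM _ _ _ _) (etrans _ (esym (freeActM _ _ _ _))).
  by rewrite !g; apply: dgq_comm.
- apply: etrans (freeActM _ _ _ _) (etrans _ (esym (freeAct1 _ _))).
  rewrite !g /= dgqD //; apply/ffunP => s.
  by rewrite dgqE subrr mul1r.
- apply: etrans (freeActM _ _ _ _) (etrans _ (esym (freeAct1 _ _))).
  rewrite !g /= dgqD //; apply/ffunP => s.
  by rewrite dgqE addNr mul1r.
- apply: etrans (act_mulB _ _ _ _ _ _) (etrans _ (esym (act_scaleB _ _ _ _ _ _ _ _))).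
  rewrite !g /= tEF_bracket ?enum_uniq // -scalerA !dgqD //.
  by congr (_ *: (_ *: (_ - _))); apply: eq_dgq => s; rewrite hsum_cnt; ring.
- apply: etrans (freeActM _ _ _ _) (etrans _ (esym (act_scaleM _ _ _ _ _))).
  by rewrite !g /= dgq_tEF form_eps_alpha.
- apply: etrans (freeActM _ _ _ _) (etrans _ (esym (act_scaleM _ _ _ _ _))).
  by rewrite !g /= dgq_tEF form_eps_alpha opprB.
- apply: etrans (act_gen_serre schurOp (GenE i) (GenE j) _ u) (etrans _ (esym (freeAct0 _ _))).
  by have := tEF_serre q0 true (enum_uniq 'I_d) i j u; rewrite ij.
- apply: etrans (act_mulB _ _ _ _ _ _) (etrans _ (esym (freeAct0 _ _))); rewrite !g.
  have := tEF_serre q0 true (enum_uniq 'I_d) i j u; rewrite (negPf ij) /= => ->.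
  by rewrite subrr.
- apply: etrans (act_gen_serre schurOp (GenF i) (GenF j) _ u) (etrans _ (esym (freeAct0 _ _))).
  by have := tEF_serre q0 false (enum_uniq 'I_d) i j u; rewrite ij.
- apply: etrans (act_mulB _ _ _ _ _ _) (etrans _ (esym (freeAct0 _ _))); rewrite !g.
  have := tEF_serre q0 false (enum_uniq 'I_d) i j u; rewrite (negPf ij) /= => ->.
  by rewrite subrr.
- apply: etrans _ (esym (act_scalar _ _ _)); apply/ffunP => s; rewrite evZ.
  rewrite (act_prod_diag (e := fun i s => q ^ cnt i s)) => [|i y t].
    congr (_ * _); rewrite -[q ^+ d]/(q ^ d%:Z) -(sum_cnt s).
    by elim/big_rec2: _ => [|i y z _ ->]; rewrite ?expr0z ?expfzDr.
  by rewrite g /= dgqE.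
apply: etrans _ (esym (freeAct0 _ _)); apply/ffunP => s; rewrite ev0.
rewrite (act_prod_diag (e := fun m s => q ^ cnt j s - q ^+ m)) => [|m y t].
  have lt : (\sum_p (tnth s p == j) < d.+1)%N by rewrite ltnS cnt_le.
  by rewrite (bigD1 (Ordinal lt)) //= cnt_nat subrr !mul0r.
rewrite mulrBl; apply: etrans (_ : _ = (dgq q (cnt j) y - q ^+ m *: y) t) _.
  apply: (congr1 (fun y : W => y t)); apply: etrans (act_subA _ _ _ _) _.
  by congr (_ - _); exact: g.
by rewrite evD evN evZ dgqE.
Qed.

End SchurAction.

(** * Commutation with the Hecke algebra *)

Section HeckeCommutation.
Variables (F : fieldType) (q : F) (n' d : nat).
Local Notation n := n'.+1.
Local Notation W := (tens F n d).
Local Notation tup := (d.-tuple 'I_n).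
Hypothesis q0 : q != 0.
Implicit Types (b : bool) (i j : 'I_n.-1) (p r : 'I_d) (s t : tup) (x : W).

Definition kwl b i (l : seq 'I_d) p s : int :=
  if b then \sum_(r <- l | (r < p)%N) wexp i (tnth s r)
  else - \sum_(r <- l | (p < r)%N) wexp i (tnth s r).

Lemma tEF_expand b i l x s : path.sorted (fun p r : 'I_d => (p < r)%N) l ->
  tEF q b i l x s = \sum_(p <- l) (if tnth s p == dst b i
     then q ^ kwl b i l p s * x (upd s p (src b i)) else 0).
Proof.
elim: l => [|p l IHl] /=; first by rewrite big_nil ev0.
move=> pl; have {IHl} := IHl (path_sorted pl); rewrite big_cons.
have tr : transitive (fun p r : 'I_d => (p < r)%N) by move=> ? ? ?; apply: ltn_trans.
move: pl; rewrite path_sortedE // => /andP[/allP pl _] E.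
case: b E => E; rewrite evD.
  rewrite siteE /kwl dgqE E /hsum big_seq1; congr (_ + _).
    case: ifP => // _; rewrite big_cons ltnn big_seq_cond big1 ?mul1r //.
    by move=> r /andP[/pl]; lia.
  rewrite big_distrr /=; apply: eq_big_seq => r /pl ltr.
  case: ifP => _; last by rewrite mulr0.
  by rewrite big_cons ltr mulrA expfzDr.
rewrite addrC dgqE siteE /kwl E; congr (_ + _).
  case: ifP => _; last by rewrite mulr0.
  rewrite big_cons ltnn /hsum.
  congr (q ^ (- _) * _); rewrite [RHS]big_seq_cond [LHS]big_seq.
  by apply: eq_bigl => r; case: (boolP (r \in l)) => [/pl->|].
apply: eq_big_seq => r /pl ltr; case: ifP => // _.
by rewrite big_cons ltnNge (ltnW ltr).
Qed.

(** The exponent collected when the matrix unit of the iterated coproduct acts at place p: from the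
    places before p for E, from those after p for F. *)
Definition kw b i p s : int :=
  if b then \sum_(r < d | (r < p)%N) wexp i (tnth s r)
  else - \sum_(r < d | (p < r)%N) wexp i (tnth s r).

Lemma tEFE b i x s : tEF q b i (enum 'I_d) x s =
  \sum_p (if tnth s p == dst b i then q ^ kw b i p s * x (upd s p (src b i)) else 0).
Proof.
rewrite tEF_expand; last first.
  have := iota_ltn_sorted 0 d; rewrite -val_enum_ord sorted_map.
  exact: sub_sorted.
rewrite big_enum; apply: eq_bigr => p _; congr (if _ then q ^ _ * _ else _).
by rewrite /kwl /kw; case: b; rewrite big_mkcond big_enum [in RHS]big_mkcond.
Qed.

Definition tal (a c : 'I_n) : F :=
  if a == c then q else if (a < c)%N then 0 else q - q^-1.
Definition tbe (a c : 'I_n) : F := (a != c)%:R.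

Lemma tnth_swap (r : 'I_d.-1) t p : tnth (swap r t) p = tnth t (tperm (lo r) (hi r) p).
Proof. exact: tnth_mktuple. Qed.

Lemma swapK (r : 'I_d.-1) t : swap r (swap r t) = t.
Proof. by apply: eq_from_tnth => p; rewrite !tnth_swap tpermK. Qed.

Lemma lo_neq_hi m (r : 'I_m.-1) : lo r != hi r.
Proof. by rewrite -val_eqE /= neq_ltn leqnn. Qed.

Lemma heckeOp_tbasis (r : 'I_d.-1) t : heckeOp q r (tbasis F t) =
  tbe (tnth t (lo r)) (tnth t (hi r)) *: tbasis F (swap r t) +
  tal (tnth t (lo r)) (tnth t (hi r)) *: tbasis F t.
Proof.
rewrite heckeOp_basis /heckeBasis /tal /tbe; case: eqP => _ /=.
  by rewrite scale0r add0r.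
by case: ifP => _; rewrite !scale1r ?scale0r ?addr0.
Qed.

Lemma tbe_sym a c : tbe a c = tbe c a.
Proof. by rewrite /tbe eq_sym. Qed.

Lemma heckeOpE (r : 'I_d.-1) x s : heckeOp q r x s =
  tbe (tnth s (lo r)) (tnth s (hi r)) * x (swap r s) +
  tal (tnth s (lo r)) (tnth s (hi r)) * x s.
Proof.
rewrite [x in LHS](tens_expand x) linear_sum sum_ffunE.
under eq_bigr => t _ do
  rewrite linearZ /= heckeOp_tbasis evZ evD 2!evZ /tbasis 2!ffunE mulrDr.
rewrite big_split; congr (_ + _) => /=.
  rewrite (bigD1 (swap r s)) //= swapK eqxx mulr1 big1 ?addr0 => [|t /negPf ts].
    by rewrite !tnth_swap tpermL tpermR tbe_sym mulrC.
  case: eqP => [E|_]; last by rewrite !mulr0.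
  by rewrite E swapK eqxx in ts.
rewrite (bigD1 s) //= eqxx mulr1 big1 ?addr0 => [|t /negPf ts]; first by rewrite mulrC.
by rewrite eq_sym ts !mulr0.
Qed.

(** Compatibility of T_r with the coproduct on two places: [X a c] are the coefficients of a vector
    and [G a c] those of its image. Any index other than those of [lo i] and [hi i] compares in the
    same way with both ([t4], [t5]), which leaves finitely many cases. *)
Lemma two_site_hecke b i (X : 'I_n -> 'I_n -> F) a c :
  let G a c := (if a == dst b i then q ^ (if b then 0 else - wexp i c) * X (src b i) c else 0)
     + (if c == dst b i then q ^ (if b then wexp i a else 0) * X a (src b i) else 0) in
  tbe a c * G c a + tal a c * G a c =
  (if a == dst b i then q ^ (if b then 0 else - wexp i c) *
      (tbe (src b i) c * X c (src b i) + tal (src b i) c * X (src b i) c) else 0) +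
  (if c == dst b i then q ^ (if b then wexp i a else 0) *
      (tbe a (src b i) * X (src b i) a + tal a (src b i) * X a (src b i)) else 0).
Proof.
have ll : lo i == hi i = false by apply/negbTE/lo_neq_hi.
have hl : hi i == lo i = false by rewrite eq_sym.
have wl : wexp i (lo i) = -1 by rewrite /wexp eqxx ll.
have wh : wexp i (hi i) = 1 by rewrite /wexp eqxx hl.
have t1 y : tal y y = q by rewrite /tal eqxx.
have t2 : tal (lo i) (hi i) = 0 by rewrite /tal ll /= leqnn.
have t3 : tal (hi i) (lo i) = q - q^-1 by rewrite /tal hl ifF //= ltnNge leqnSn.
have w0 y : y != lo i -> y != hi i -> wexp i y = 0.
  by rewrite /wexp => /negPf-> /negPf->.
have t4 y : y != lo i -> y != hi i -> tal (hi i) y = tal (lo i) y.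
  rewrite /tal ![_ i == y]eq_sym => yl yh; rewrite (negPf yl) (negPf yh).
  have -> // : (hi i < y)%N = (lo i < y)%N.
  by move: yl yh; rewrite -!val_eqE /=; lia.
have t5 y : y != lo i -> y != hi i -> tal y (hi i) = tal y (lo i).
  rewrite /tal => yl yh; rewrite (negPf yl) (negPf yh).
  have -> // : (y < hi i)%N = (y < lo i)%N.
  by move: yl yh; rewrite -!val_eqE /=; lia.
have qV : q ^ (-1) = q^-1 by rewrite exprN1.
have cases y : [\/ y = lo i, y = hi i |
    [/\ y != lo i, y != hi i, (y == lo i = false) * (lo i == y = false)
      & (y == hi i = false) * (hi i == y = false)]].
  have [->|yl] := eqVneq y (lo i); first by constructor 1.
  have [->|yh] := eqVneq y (hi i); first by constructor 2.
  by constructor 3; split; rewrite // ![_ == y]eq_sym !(negPf yl) !(negPf yh).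
have Ew := (wl, wh, @opprK int, expr0z, expr1z, qV, @oppr0 int).
have Et := (t1, t2, t3, eqxx, ll, hl).
case: (cases a) => [->|->|[al ah Eal Eah]]; case: (cases c) => [->|->|[cl ch Ecl Ech]];
  case: b => /=; rewrite /tbe ?Et ?Eal ?Eah ?Ecl ?Ech ?Ew ?w0 ?t4 ?t5 //=;
  rewrite ?Et ?Ew; by field.
Qed.

Lemma upd_swap (r : 'I_d.-1) s p a : p != lo r -> p != hi r ->
  upd (swap r s) p a = swap r (upd s p a).
Proof.
move=> pl ph; apply: eq_from_tnth => k; rewrite tnth_upd !tnth_swap tnth_upd.
case: tpermP => [->|->|_ _]; rewrite ?[_ == p]eq_sym ?(negPf pl) ?(negPf ph) //.
Qed.

Lemma swap_upd2 (r : 'I_d.-1) s a c :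
  swap r (upd (upd s (lo r) a) (hi r) c) = upd (upd s (lo r) c) (hi r) a.
Proof.
have lh := negPf (lo_neq_hi r).
apply: eq_from_tnth => k; rewrite tnth_swap !tnth_upd.
case: tpermP => [->|->|/eqP/negPf-> /eqP/negPf->] //; by rewrite ?eqxx ?lh // eq_sym lh.
Qed.

Lemma upd2_id (r : 'I_d.-1) s : upd (upd s (lo r) (tnth s (lo r))) (hi r) (tnth s (hi r)) = s.
Proof. by rewrite [upd s _ _]upd_id // upd_id. Qed.

Lemma sum_wexp_swap (r : 'I_d.-1) i s (P : pred 'I_d) : P (lo r) = P (hi r) ->
  \sum_(k | P k) wexp i (tnth (swap r s) k) =
  \sum_(k | P k) wexp i (tnth s k).
Proof.
move=> Plh; rewrite [RHS](reindex_inj (@perm_inj _ (tperm (lo r) (hi r)))) /=.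
apply: eq_big => k; last by rewrite tnth_swap.
by case: tpermP => [->|->|].
Qed.

Lemma big_two (R : Type) (idx : R) (op : Monoid.com_law idx) (r : 'I_d.-1) (G : 'I_d -> R) :
  \big[op/idx]_p G p =
  op (op (G (lo r)) (G (hi r))) (\big[op/idx]_(p | (p != lo r) && (p != hi r)) G p).
Proof.
by rewrite (bigD1 (lo r)) //= (bigD1 (hi r)) /= ?Monoid.mulmA // eq_sym lo_neq_hi.
Qed.

(** The exponents at the two places of T_r share the part [w], which depends only on the other
    places and therefore survives any change at these two. *)
Lemma kw_two b i (r : 'I_d.-1) s : exists2 w : int,
  kw b i (lo r) s = w + (if b then 0 else - wexp i (tnth s (hi r))) &
  kw b i (hi r) s = w + (if b then wexp i (tnth s (lo r)) else 0) /\
  forall s', (forall p, p != lo r -> p != hi r -> tnth s' p = tnth s p) ->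
  kw b i (lo r) s' = w + (if b then 0 else - wexp i (tnth s' (hi r))) /\
  kw b i (hi r) s' = w + (if b then wexp i (tnth s' (lo r)) else 0).
Proof.
have H (P : pred 'I_d) s1 s2 : P (lo r) = false -> P (hi r) = false ->
   (forall p, p != lo r -> p != hi r -> tnth s1 p = tnth s2 p) ->
   \sum_(k | P k) wexp i (tnth s1 k) =
   \sum_(k | P k) wexp i (tnth s2 k).
  move=> Pl Ph E; apply: eq_bigr => k Pk; rewrite E //.
    by apply: contraTneq Pk => ->; rewrite Pl.
  by apply: contraTneq Pk => ->; rewrite Ph.
have E s' : kw b i (lo r) s' = kw b i (if b then lo r else hi r) s'
      + (if b then 0 else - wexp i (tnth s' (hi r))) /\
   kw b i (hi r) s' = kw b i (if b then lo r else hi r) s'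
      + (if b then wexp i (tnth s' (lo r)) else 0).
  rewrite /kw; case: b; rewrite addr0; split=> //.
    rewrite (bigD1 (lo r)) //= addrC; congr (_ + _); apply: eq_bigl => k.
    by rewrite -val_eqE /=; lia.
  rewrite (bigD1 (hi r)) //= opprD addrC; congr (- _ - _); apply: eq_bigl => k.
  by rewrite -val_eqE /=; lia.
exists (kw b i (if b then lo r else hi r) s); first by case: (E s).
split=> [|s' ss]; first by case: (E s).
have -> : kw b i (if b then lo r else hi r) s =
          kw b i (if b then lo r else hi r) s'; last exact: E.
rewrite /kw; case: b {E}; last congr (- _); apply: H => [||p pl ph] /=;
  by [rewrite ss|lia].
Qed.

(** Terms at the other places match because their exponents are symmetric under the swap; at the two
    places of T_r the claim is q^w times [two_site_hecke]. *)
Lemma tEF_hecke b i (r : 'I_d.-1) x :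
  tEF q b i (enum 'I_d) (heckeOp q r x) = heckeOp q r (tEF q b i (enum 'I_d) x).
Proof.
have lh := negPf (lo_neq_hi r); have hl : hi r == lo r = false by rewrite eq_sym.
apply/ffunP => s; rewrite heckeOpE !tEFE !(big_two _ r) /= !mulrDr.
set a := tnth s (lo r); set c := tnth s (hi r).
set S1 := \sum_(_ | _) _; set S2 := \sum_(_ | _) _; set S3 := \sum_(_ | _) _.
have -> : S1 = tbe a c * S2 + tal a c * S3.
  rewrite /S1 /S2 /S3 !mulr_sumr -big_split; apply: eq_bigr => p /andP[pl ph] /=.
  rewrite tnth_swap tpermD 1?eq_sym //; case: ifP => _; last by rewrite !mulr0 addr0.
  have -> : kw b i p (swap r s) = kw b i p s.
    rewrite /kw; case: (b); last congr (- _); apply: sum_wexp_swap => /=;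
    move: pl ph; rewrite -!val_eqE /=; lia.
  rewrite heckeOpE !tnth_upd ![_ == p]eq_sym (negPf pl) (negPf ph) upd_swap //.
  by rewrite -/a -/c; ring.
have [w E1 [E2 E3]] := kw_two b i r s.
have [E4 E5] : kw b i (lo r) (swap r s) = w + (if b then 0 else - wexp i a) /\
  kw b i (hi r) (swap r s) = w + (if b then wexp i c else 0).
  have [|-> ->] := E3 (swap r s); first by move=> p pl ph; rewrite tnth_swap tpermD // eq_sym.
  by rewrite !tnth_swap tpermR tpermL.
rewrite E1 E2 E4 E5 !tnth_swap tpermL tpermR -/a -/c !expfzDr //.
pose X a c := x (upd (upd s (lo r) a) (hi r) c).
have U1 a' : upd s (lo r) a' = upd (upd s (lo r) a') (hi r) c.
  by rewrite [RHS]upd_id // tnth_upd hl.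
have U2 c' : upd s (hi r) c' = upd (upd s (lo r) a) (hi r) c' by rewrite [upd s _ a]upd_id.
have sE : swap r s = upd (upd s (lo r) c) (hi r) a by rewrite -swap_upd2 upd2_id.
have U3 a' : upd (swap r s) (lo r) a' = upd (upd s (lo r) a') (hi r) a.
  by rewrite sE upd_comm ?[hi r == _]eq_sym ?lo_neq_hi // upd_upd.
have U4 c' : upd (swap r s) (hi r) c' = upd (upd s (lo r) c) (hi r) c'.
  by rewrite sE upd_upd.
rewrite !heckeOpE U1 U2 U3 U4 !swap_upd2 !tnth_upd ?eqxx ?lh ?hl.
have /= := @two_site_hecke b i X a c; rewrite /X => E.
have {}E := congr1 (fun y => q ^ w * y) E.
apply/eqP; rewrite -subr_eq0; move/eqP: E; rewrite -subr_eq0 => /eqP E.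
(* The two-site identity has the two sides of the goal exchanged, hence the sign. *)
rewrite -oppr_eq0 -[X in _ == X]E; apply/eqP.
by case: (a == _); case: (c == _) => /=; ring.
Qed.

End HeckeCommutation.

(** * Hecke endomorphisms are determined by their sorted coefficients *)

Section Determination.
Variables (F : fieldType) (q : F) (n' d : nat).
Local Notation n := n'.+1.
Local Notation W := (tens F n d).
Local Notation tup := (d.-tuple 'I_n).
Hypothesis q0 : q != 0.
Implicit Types (p : 'I_d) (r : 'I_d.-1) (s t : tup) (x : W).

(** Compares the pairs (t_p, s_p) lexicographically, as two-digit numbers in base n. *)
Definition code t s p : nat := (tnth t p * n + tnth s p)%N.
Definition codes t s : seq nat := [seq code t s p | p <- enum 'I_d].
Definition sorted_pair t s := path.sorted leq (codes t s).
(** The factor d - p decreases along the places, so bringing a smaller code forward while the sum of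
    two neighbouring codes is kept lowers [mu]. *)
Definition mu t s := (\sum_(p < d) (d - p) * code t s p)%N.

Lemma mu_lt r t s t' s' :
  (forall p, p != lo r -> p != hi r -> code t' s' p = code t s p) ->
  (code t' s' (lo r) + code t' s' (hi r) = code t s (lo r) + code t s (hi r))%N ->
  (code t' s' (lo r) < code t s (lo r))%N -> (mu t' s' < mu t s)%N.
Proof.
move=> Eo Es Elt; rewrite /mu !(big_two _ r) /=.
rewrite (eq_bigr (fun p => (d - p) * code t s p)%N) => [|p /andP[pl ph]]; last by rewrite Eo.
rewrite ltn_add2r.
rewrite -(subnSK (ltn_ord (lo r))) /=; move: Es Elt; clear.
by move: (code t' s' _) (code t' s' _) (code t s _) (code t s _) => *; nia.
Qed.

Lemma sorted_pairPn t s : ~~ sorted_pair t s ->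
  exists r, (code t s (hi r) < code t s (lo r))%N.
Proof.
apply: contraNP => H; apply/(sortedP 0%N) => i; rewrite size_map size_enum_ord => lti.
have ltr : (i < d.-1)%N by rewrite -ltnS prednK // (leq_trans _ lti).
have nthE (p : 'I_d) : nth 0%N (codes t s) p = code t s p.
  by rewrite (nth_map p) ?size_enum_ord // nth_ord_enum.
rewrite (nthE (lo (Ordinal ltr))) (nthE (hi (Ordinal ltr))) leqNgt.
by apply/negP => lt; apply: H; exists (Ordinal ltr).
Qed.

Lemma code_swap r t s p : code (swap r t) (swap r s) p = code t s (tperm (lo r) (hi r) p).
Proof. by rewrite /code !tnth_swap. Qed.

(* Commuting with T_r expresses the coefficient of v_s in f v_t through
   coefficients at pairs (t', s') that are closer to being sorted. *)
Lemma hecke_determined (f : {linear W -> W}) :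
  (forall r x, f (heckeOp q r x) = heckeOp q r (f x)) ->
  (forall t s, sorted_pair t s -> f (tbasis F t) s = 0) -> forall x, f x = 0.
Proof.
move=> fT f0.
have fTE r t s : tbe F (tnth t (lo r)) (tnth t (hi r)) * f (tbasis F (swap r t)) s +
    tal q (tnth t (lo r)) (tnth t (hi r)) * f (tbasis F t) s =
    tbe F (tnth s (lo r)) (tnth s (hi r)) * f (tbasis F t) (swap r s) +
    tal q (tnth s (lo r)) (tnth s (hi r)) * f (tbasis F t) s.
  have := congr1 (fun y : W => y s) (fT r (tbasis F t)).
  by rewrite heckeOpE heckeOp_tbasis linearD !linearZ /= evD !evZ.
suff H m t s : (mu t s < m)%N -> f (tbasis F t) s = 0.
  move=> x; rewrite (tens_expand x) linear_sum big1 // => t _; rewrite linearZ /=.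
  suff -> : f (tbasis F t) = 0 by rewrite scaler0.
  by apply/ffunP => s; rewrite (H _ t s (ltnSn _)) ev0.
elim: m t s => // m IHm t s; rewrite ltnS => lem.
have [/f0 //|/sorted_pairPn[r ltr]] := boolP (sorted_pair t s).
have {}IHm t' s' : (mu t' s' < mu t s)%N -> f (tbasis F t') s' = 0.
  by move=> lt; apply: IHm; apply: leq_trans lt lem.
have IH1 : f (tbasis F (swap r t)) (swap r s) = 0.
  apply/IHm/(@mu_lt r); rewrite ?code_swap ?tpermL ?tpermR // 1?addnC // => p pl ph.
  by rewrite code_swap tpermD // eq_sym.
(* If t decreases at the two places, the relation is used at the swapped t, where T_r has no
   correction term; it expresses the coefficient at (t, s) through two known ones. *)
have [ltt|] := ltnP (tnth t (hi r)) (tnth t (lo r)).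
  have IH2 : f (tbasis F (swap r t)) s = 0.
    apply/IHm/(@mu_lt r).
    - by move=> p pl ph; rewrite /code tnth_swap tpermD // eq_sym.
    - by rewrite /code !tnth_swap tpermL tpermR; lia.
    by rewrite /code tnth_swap tpermL ltn_add2r ltn_mul2r ltt.
  have := fTE r (swap r t) s; rewrite IH1 IH2 swapK !tnth_swap tpermL tpermR.
  by rewrite /tbe -val_eqE (ltn_eqF ltt) !mulr0 !addr0 mul1r.
rewrite leq_eqVlt => /predU1P[/val_inj Et|ltt]; last first.
  have := ltn_ord (tnth s (hi r)); have := ltn_ord (tnth s (lo r)).
  move: ltr; rewrite /code; nia.
(* For equal entries of t, T_r acts on v_t by q, while s contributes the factor q - q^-1; what
   remains is q^-1 times the coefficient at (t, s). *)
have lts : (tnth s (hi r) < tnth s (lo r))%N by move: ltr; rewrite /code Et ltn_add2l.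
have IH3 : f (tbasis F t) (swap r s) = 0.
  suff <- : swap r t = t by [].
  apply: eq_from_tnth => p; rewrite tnth_swap.
  by case: tpermP => [->|->|].
have := fTE r t s; rewrite IH3 /tbe /tal Et eqxx mul0r add0r mulr0 add0r.
rewrite -!val_eqE (gtn_eqF lts) ltnNge (ltnW lts) /= mulrBl => /eqP.
by rewrite -subr_eq0 opprB addrC subrK mulf_eq0 invr_eq0 (negPf q0) => /eqP.
Qed.

Lemma freeAct_comm (X : choiceType) (V : lmodType F) (T : X -> {linear V -> V})
    (g : {linear V -> V}) (a : freeAlg F X) u :
  (forall y v, g (T y v) = T y (g v)) -> g (freeAct T a u) = freeAct T a (g u).
Proof.
move=> gT; rewrite /freeAct linear_sum; apply: eq_bigr => w _; rewrite linearZ /=.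
by congr (_ *: _); rewrite /wordAct; elim: (fmonom_val w) => //= y l <-; rewrite gT.
Qed.

End Determination.

(** * Sorted pairs and their matrices *)

Section PairStatistics.
Variables (n' d : nat).
Local Notation n := n'.+1.
Local Notation tup := (d.-tuple 'I_n).
Implicit Types (p : 'I_d) (s t : tup) (i j k : nat).

Definition npair t s (P : nat -> nat -> bool) : nat := \sum_(p < d) P (tnth t p) (tnth s p).
Definition mat t s i j : nat := npair t s (fun a c => (a == j) && (c == i)).
Definition above t s i j : nat := npair t s (fun a c => (a < j) && (i <= c))%N.
Definition below t s i j : nat := npair t s (fun a c => (j <= a) && (c < i))%N.

Lemma npair_eqD t s (P1 P2 P3 Q1 Q2 : nat -> nat -> bool) :
  (forall a c, P1 a c + P2 a c + P3 a c = Q1 a c + Q2 a c)%N ->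
  (npair t s P1 + npair t s P2 + npair t s P3 = npair t s Q1 + npair t s Q2)%N.
Proof. by move=> E; rewrite /npair -!big_split; apply: eq_bigr => p _; apply: E. Qed.

(** Inclusion-exclusion: a matrix entry is a mixed second difference of corner sums. *)
Lemma mat_above t s i j :
  (mat t s i j + above t s i.+1 j.+1 + above t s i j =
   above t s i j.+1 + above t s i.+1 j)%N.
Proof. by apply: npair_eqD => a c; do ![case: ltngtP => ? /=]; lia. Qed.

Lemma mat_below t s i j :
  (mat t s i j + below t s i.+1 j.+1 + below t s i j =
   below t s i.+1 j + below t s i j.+1)%N.
Proof. by apply: npair_eqD => a c; do ![case: ltngtP => ? /=]; lia. Qed.

Lemma sum_npair t s (I : Type) (r : seq I) (P : pred I) (Q : I -> nat -> nat -> bool) :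
  (\sum_(i <- r | P i) npair t s (Q i) =
   \sum_(p < d) \sum_(i <- r | P i) Q i (tnth t p) (tnth s p))%N.
Proof. exact: exchange_big. Qed.

Lemma sum_ord_eq m (f : nat -> bool) (a : nat) :
  (\sum_(l < m) (f l && (a == l :> nat)) = (a < m) && f a)%N.
Proof.
have [ltam|leam] := ltnP a m.
  rewrite (bigD1 (Ordinal ltam)) //= eqxx andbT big1 ?addn0 // => l.
  by rewrite -val_eqE eq_sym /= => /negPf->; rewrite andbF.
rewrite big1 // => l _; case: eqP => [E|_]; last by rewrite andbF.
by have := ltn_ord l; rewrite -E ltnNge leam.
Qed.

Lemma sum_mat_col t s i j :
  (\sum_(l < i) mat t s l j = npair t s (fun a c => (a == j) && (c < i)%N))%N.
Proof.
rewrite sum_npair; apply: eq_bigr => p _.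
by rewrite (sum_ord_eq _ (fun=> tnth t p == j :> nat)) andbC.
Qed.

Lemma sum_mat_row t s i j :
  (\sum_(l < j) mat t s i l = npair t s (fun a c => (c == i) && (a < j)%N))%N.
Proof.
rewrite sum_npair; apply: eq_bigr => p _.
under eq_bigr do rewrite andbC.
by rewrite (sum_ord_eq _ (fun=> tnth s p == i :> nat)) andbC.
Qed.

Lemma sum_mat t s j : (\sum_(i < n) mat t s i j = \sum_(p < d) (tnth t p == j :> nat))%N.
Proof. by rewrite sum_mat_col; apply: eq_bigr => p _; rewrite ltn_ord andbT. Qed.

Lemma count_codes t s c : count_mem c (codes t s) = mat t s (c %% n)%N (c %/ n)%N.
Proof.
rewrite /codes count_map -sum1_count big_enum_cond big_mkcond /=; apply: eq_bigr => p _.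
rewrite /= /code; suff -> : (tnth t p * n + tnth s p == c)%N =
   ((tnth t p == c %/ n :> nat) && (tnth s p == c %% n :> nat))%N by case: (_ && _).
apply/eqP/andP => [<-|[/eqP-> /eqP->]]; last by rewrite -divn_eq.
by rewrite divnMDl // divn_small // addn0 modnMDl modn_small.
Qed.

(** By [count_codes] the matrix lists the multiplicities of the codes, and these determine a sorted
    sequence. *)
Lemma sorted_pair_inj t s t' s' : sorted_pair t s -> sorted_pair t' s' ->
  (forall i j, (i < n)%N -> (j < n)%N -> mat t s i j = mat t' s' i j) -> t = t' /\ s = s'.
Proof.
move=> so so' E.
have Ec : codes t s = codes t' s'.
  apply: (sorted_eq leq_trans anti_leq) => //; rewrite /= ; apply/allP => c _ /=.
  rewrite !count_codes; have [ltc|lec] := ltnP (c %/ n)%N n; first by rewrite E ?ltn_mod.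
  by rewrite /mat /npair !big1 // => p _; rewrite ltn_eqF // (leq_trans _ lec).
have {}Ec p : code t s p = code t' s' p.
  have := congr1 (nth 0%N ^~ p) Ec.
  have nthE t1 s1 : nth 0%N (codes t1 s1) p = code t1 s1 p.
    by rewrite (nth_map p) ?size_enum_ord // nth_ord_enum.
  by rewrite !nthE.
split; apply: eq_from_tnth => p; apply: val_inj => /=; have := Ec p; rewrite /code.
  by move/(congr1 (fun m => m %/ n)%N); rewrite !divnMDl // !divn_small // !addn0.
by move/(congr1 (fun m => m %% n)%N); rewrite !modnMDl !modn_small.
Qed.

Lemma sorted_pair_exists (A : nat -> nat -> nat) (wt : nat -> nat) :
  (\sum_(j < n) wt j = d)%N -> (forall j, (j < n)%N -> \sum_(i < n) A i j = wt j)%N ->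
  exists t s, sorted_pair t s /\ forall i j, (i < n)%N -> (j < n)%N -> mat t s i j = A i j.
Proof.
move=> Ed EA.
pose L0 := flatten [seq nseq (A i j) (j * n + i)%N | j <- iota 0 n, i <- iota 0 n].
pose L := path.sort leq L0.
have sumL (f : nat -> nat) : (\sum_(c <- L0) f c = \sum_(j < n) \sum_(i < n) A i j * f (j * n + i))%N.
  rewrite big_flatten big_allpairs_dep -[iota 0 n]/(index_iota 0 n) big_mkord.
  apply: eq_bigr => j _; rewrite big_mkord; apply: eq_bigr => i _.
  by rewrite big_nseq iter_addn_0 mulnC.
have sL : size L = d.
  rewrite size_sort -sum1_size sumL -Ed; apply: eq_bigr => j _.
  by rewrite -EA //; apply: eq_bigr => i _; rewrite muln1.
have ltL p : (nth 0%N L p < n * n)%N.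
  have [lt|le] := ltnP p (size L); last by rewrite nth_default.
  have := mem_nth 0%N lt; rewrite mem_sort => /flattenP[l0 /allpairsP[[j i] [+ + ->]]].
  rewrite !mem_iota /= !add0n => ltj lti; rewrite mem_nseq => /andP[_ /eqP->].
  nia.
pose t : tup := [tuple inord (nth 0%N L p %/ n) | p < d].
pose s : tup := [tuple inord (nth 0%N L p %% n) | p < d].
have cE : codes t s = L.
  apply: (@eq_from_nth _ 0%N) => [|p]; rewrite size_map size_enum_ord ?sL // => ltp.
  rewrite (nth_map (Ordinal ltp)) ?size_enum_ord // (nth_ord_enum _ (Ordinal ltp)) /code.
  rewrite !tnth_mktuple !inordK ?ltn_mod // ?ltn_divLR //.
  by rewrite -divn_eq.
exists t, s; split; first by rewrite /sorted_pair cE; apply: sort_sorted; apply: leq_total.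
move=> i j lti ltj; have := count_codes t s (j * n + i).
rewrite modnMDl divnMDl // modn_small // divn_small // addn0 => <-.
rewrite cE count_sort -sum1_count big_mkcond /=.
rewrite (eq_bigr (fun c : nat => (c == j * n + i)%N : nat)) => [|c _]; last by case: eqP.
rewrite sumL (bigD1 (Ordinal ltj)) //= (bigD1 (Ordinal lti)) //= eqxx muln1.
rewrite !big1 ?addn0 // => [j' nj|i' ni].
  rewrite big1 // => i' _; case: eqP => [E|_]; last by rewrite muln0.
  have := congr1 (fun m => m %/ n)%N E; rewrite !divnMDl // !divn_small // !addn0 => Ej.
  by rewrite -val_eqE /= Ej eqxx in nj.
case: eqP => [E|_]; last by rewrite muln0.
by move/addnI: E => Ei; rewrite -val_eqE /= Ei eqxx in ni.
Qed.

End PairStatistics.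

(** * Coefficients of the spanning monomials *)

Section WordAction.
Variables (F : fieldType) (q : F) (n' d : nat).
Local Notation n := n'.+1.
Local Notation W := (tens F n d).
Local Notation tup := (d.-tuple 'I_n).
Hypothesis q0 : q != 0.
Implicit Types (b : bool) (p : 'I_d) (s t : tup) (x : W) (w : seq (bool * nat)).

Definition lop b (i : nat) x : W :=
  if insub i is Some j then tEF q b (j : 'I_n.-1) (enum 'I_d) x else 0.
Definition tw w x := foldr (fun l y => lop l.1 l.2 y) x w.

Lemma tw_cat w1 w2 x : tw (w1 ++ w2) x = tw w1 (tw w2 x).
Proof. exact: foldr_cat. Qed.

Lemma lop_supp b i x s : lop b i x s != 0 -> exists p (a : 'I_n),
  [/\ tnth s p = (if b then i else i.+1) :> nat, a = (if b then i.+1 else i) :> nat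
    & x (upd s p a) != 0].
Proof.
rewrite /lop; case: insubP => [j _ <-|]; last by rewrite ev0 eqxx.
rewrite tEFE // => nz; have [p] : exists p, tnth s p = dst b j /\ x (upd s p (src b j)) != 0.
  apply: contraNP nz => H; apply/eqP/big1 => p _; case: eqP => // E.
  have [->|nz] := eqVneq (x (upd s p (src b j))) 0; first by rewrite mulr0.
  by case: H; exists p.
by case=> E nz'; exists p, (src b j); split => //; rewrite ?E; case: (b).
Qed.

Definition cnt_ge (P : pred 'I_d) c s : nat := \sum_(p | P p) (c <= tnth s p)%N.
Definition cnt_lt (P : pred 'I_d) c s : nat := \sum_(p | P p) (tnth s p < c)%N.

Lemma cnt_upd_le (P : pred 'I_d) (f : nat -> bool) s p (a : 'I_n) :
  (\sum_(r | P r) f (tnth s r) <= \sum_(r | P r) f (tnth (upd s p a) r) +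
    (f (tnth s p) && ~~ f a))%N.
Proof.
have [Pp|nPp] := boolP (P p); last first.
  rewrite -[leqLHS]addn0 leq_add // eq_leq //; apply: eq_bigr => r Pr.
  rewrite tnth_upd; case: eqP => // E; by rewrite -E Pr in nPp.
rewrite (bigD1 p) //= [in leqRHS](bigD1 p) //= tnth_upd eqxx.
rewrite (eq_bigr (fun r => f (tnth (upd s p a) r) : nat)) => [|r /andP[_ /negPf rp]].
  by case: (f _); case: (f a) => /=; lia.
by rewrite tnth_upd rp.
Qed.

(** Only F_c carries an entry from c to c + 1 and only E_c carries one back. So in any set of places
    the entries on either side of this threshold grow in number at most by the number of such
    letters. *)
Lemma tw_supp w x s : tw w x s != 0 -> exists2 s', x s' != 0 & forall P c,
  (cnt_ge P c.+1 s <= cnt_ge P c.+1 s' + count_mem (false, c) w)%N /\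
  (cnt_lt P c.+1 s <= cnt_lt P c.+1 s' + count_mem (true, c) w)%N.
Proof.
elim: w s => [|[b i] w IHw] s /=; first by move=> nz; exists s => // P c; rewrite !addn0.
case/lop_supp=> p [a [Es Ea /IHw[s' nz H]]]; exists s' => // P c.
have [Hge Hlt] := H P c; rewrite /cnt_ge /cnt_lt in Hge Hlt *.
have := cnt_upd_le P (fun e => c.+1 <= e)%N s p a.
have := cnt_upd_le P (fun e => e < c.+1)%N s p a; rewrite Es Ea => H1 H2.
rewrite ![_ == (_, c)]xpair_eqE; case: (b) H1 H2 {Es Ea IHw} => /= H1 H2; split;
  [apply: leq_trans H2 _; apply: leq_trans (leq_add Hge (leqnn _)) _
  |apply: leq_trans H1 _; apply: leq_trans (leq_add Hlt (leqnn _)) _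
  |apply: leq_trans H2 _; apply: leq_trans (leq_add Hge (leqnn _)) _
  |apply: leq_trans H1 _; apply: leq_trans (leq_add Hlt (leqnn _)) _];
  rewrite -addnA leq_add2l addnC leq_add2r; lia.
Qed.

(** The levels of [wordE] act from the lowest to the highest, those of [wordF] from the highest to
    the lowest. *)
Fixpoint wordE A k := if k is k'.+1 then tg true (stairw 0 (colA A k)) ++ wordE A k' else [::].
Fixpoint wordF A k :=
  if k is k'.+1 then wordF A k' ++ rev (tg false (stairw 0 (rowA A k))) else [::].

Lemma wordES A k : wordE A k.+1 = tg true (stairw 0 (colA A k.+1)) ++ wordE A k.
Proof. by []. Qed.

Lemma wordFS A k : wordF A k.+1 = wordF A k ++ rev (tg false (stairw 0 (rowA A k.+1))).
Proof. by []. Qed.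

Lemma wordAE A k : wordA A k = wordE A k ++ wordF A k.
Proof. by elim: k => // k IHk; rewrite wordAS wordES wordFS IHk !catA. Qed.

Lemma count_tg b (l : seq nat) c b' : count_mem (b', c) (tg b l) = if b' == b then count_mem c l else 0%N.
Proof.
rewrite count_map; case: eqP => [->|/eqP nb].
  by apply: eq_count => i; rewrite /= xpair_eqE eqxx.
by rewrite -(count_pred0 l); apply: eq_count => i; rewrite /= xpair_eqE eq_sym (negPf nb).
Qed.

Lemma nth_colA A k c : nth 0%N (colA A k) c = if (c < k)%N then (\sum_(l < c.+1) A l k)%N else 0%N.
Proof.
have [ltc|lec] := ltnP c k; first by rewrite nth_mkseq.
by rewrite nth_default // size_mkseq.
Qed.

Lemma nth_rowA A k c : nth 0%N (rowA A k) c = if (c < k)%N then (\sum_(l < c.+1) A k l)%N else 0%N.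
Proof.
have [ltc|lec] := ltnP c k; first by rewrite nth_mkseq.
by rewrite nth_default // size_mkseq.
Qed.

Lemma count_wordE b A k c : count_mem (b, c) (wordE A k) =
  if b then (\sum_(c.+1 <= m < k.+1) \sum_(l < c.+1) A l m)%N else 0%N.
Proof.
elim: k => [|k IHk]; first by case: b => //; rewrite big_geq.
rewrite wordES count_cat count_tg IHk; case: b {IHk}; rewrite ?eqxx ?addn0 //.
rewrite count_stairw subn0 nth_colA; case: ltnP => [ltc|lec].
  by rewrite [RHS]big_nat_recr //= addnC.
by rewrite !big_geq ?addn0 // leqW.
Qed.

Lemma count_wordF b A k c : count_mem (b, c) (wordF A k) =
  if b then 0%N else (\sum_(c.+1 <= m < k.+1) \sum_(l < c.+1) A m l)%N.
Proof.
elim: k => [|k IHk]; first by case: b => //; rewrite big_geq.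
rewrite wordFS count_cat count_rev count_tg IHk; case: b {IHk}; rewrite ?eqxx ?addn0 //.
rewrite count_stairw subn0 nth_rowA; case: ltnP => [ltc|lec].
  by rewrite [RHS]big_nat_recr //= addnC.
by rewrite !big_geq ?addn0 // leqW.
Qed.

Lemma wordE_split A j k : (j <= k)%N -> exists2 w, wordE A k = w ++ wordE A j &
  forall c, (count_mem (true, c) w = count_mem (true, c) (wordE A k) - count_mem (true, c) (wordE A j))%N.
Proof.
move=> lejk; suff [w E] : exists w, wordE A k = w ++ wordE A j.
  by exists w => // c; rewrite E count_cat addnK.
rewrite -(subnK lejk); elim: (k - j)%N => [|m [w IH]]; first by exists [::].
by rewrite addSn wordES IH catA; eexists.
Qed.

Lemma wordF_split A i k : (i <= k)%N -> exists2 w, wordF A k = wordF A i ++ w &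
  forall c, (count_mem (false, c) w = count_mem (false, c) (wordF A k) - count_mem (false, c) (wordF A i))%N.
Proof.
move=> leik; suff [w E] : exists w, wordF A k = wordF A i ++ w.
  by exists w => // c; rewrite E count_cat addKn.
rewrite -(subnK leik); elim: (k - i)%N => [|m [w IH]]; first by exists [::]; rewrite cats0.
by rewrite addSn wordFS IH -catA; eexists.
Qed.

Lemma sum_nat_eq i m c (e : bool) :
  (\sum_(i <= l < m) (c == l) && e = [&& e, i <= c & c < m])%N.
Proof.
case: e; last by rewrite big1 // => l _; rewrite andbF.
rewrite (eq_bigr (fun l => if l == c then 1%N else 0%N)) => [|l _].
  by rewrite -big_mkcond big_nat1_eq; case: ifP.
by rewrite andbT eq_sym; case: eqP.
Qed.

Lemma sum_row_above t s i j :
  (\sum_(i <= m < n) \sum_(l < j) mat t s m l = above t s i j)%N.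
Proof.
under eq_bigr do rewrite sum_mat_row.
rewrite sum_npair; apply: eq_bigr => p _.
by rewrite sum_nat_eq ltn_ord andbT.
Qed.

Lemma sum_col_below t s i j :
  (\sum_(j <= m < n) \sum_(l < i) mat t s l m = below t s i j)%N.
Proof.
under eq_bigr do rewrite sum_mat_col.
rewrite sum_npair; apply: eq_bigr => p _.
by rewrite sum_nat_eq ltn_ord andbT andbC.
Qed.

Lemma above_cnt t s i j : above t s i j = cnt_ge [pred p | tnth t p < j]%N i s.
Proof. by rewrite /cnt_ge big_mkcond; apply: eq_bigr => p _ /=; case: (_ < j)%N. Qed.

Lemma below_cnt t s i j : below t s i j = cnt_lt [pred p | j <= tnth t p]%N i s.
Proof. by rewrite /cnt_lt big_mkcond; apply: eq_bigr => p _ /=; case: (j <= _)%N. Qed.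

Lemma cnt_ge_mono P i j s : (j <= i)%N -> (cnt_ge P i s <= cnt_ge P j s)%N.
Proof. by move=> leji; apply: leq_sum => p _; case: (leqP i) => // lei; rewrite (leq_trans leji lei). Qed.

Lemma cnt_lt_mono P i j s : (i <= j)%N -> (cnt_lt P i s <= cnt_lt P j s)%N.
Proof.
move=> leij; apply: leq_sum => p _; case: (ltnP _ i) => // lt.
by rewrite (leq_trans lt leij).
Qed.

Lemma tbasis_neq0 t s : tbasis F t s != 0 -> s = t.
Proof. by rewrite /tbasis ffunE; case: (s =P t) => // _; rewrite eqxx. Qed.

(* An entry of t below j that ends up in a place >= i has to be carried over j
   by some F_(j-1), and then over i: hence that F_(j-1) belongs to a level >= i.
   Similarly for the E's, which act afterwards. *)
Lemma pbw_supp t0 s0 t s : tw (wordA (mat t0 s0) n') (tbasis F t) s != 0 ->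
  forall i j, ((j <= i -> above t s i j <= above t0 s0 i j) /\
               (i <= j -> below t s i j <= below t0 s0 i j))%N.
Proof.
set A := mat t0 s0; rewrite wordAE tw_cat => nz i j; split=> leij.
  case: j leij => [|j]; first by rewrite {1}/above /npair big1.
  case: i => // i leij; have [ltin|lein] := ltnP i n'; last first.
    rewrite {1}/above /npair big1 // => p _.
    by rewrite ltnNge andbC leqNgt (leq_trans (ltn_ord _)).
  have [w Ew Cw] := wordF_split A (ltnW ltin); rewrite Ew tw_cat in nz.
  have [s1 nz1 /(_ [pred p | tnth t p < j.+1]%N i)[H1 _]] := tw_supp nz.
  have [s2 nz2 /(_ [pred p | tnth t p < j.+1]%N i)[H2 _]] := tw_supp nz1.
  have [s3 /tbasis_neq0-> /(_ [pred p | tnth t p < j.+1]%N j)[H3 _]] := tw_supp nz2.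
  rewrite above_cnt; apply: leq_trans H1 _; rewrite count_wordE addn0.
  apply: leq_trans H2 _; rewrite count_wordF big_geq // addn0.
  apply: leq_trans (cnt_ge_mono _ _ leij) _; apply: leq_trans H3 _.
  rewrite [cnt_ge _ _ _]big1 => [|p /= lt]; last by rewrite leqNgt lt.
  rewrite add0n Cw !count_wordF -sum_row_above.
  by rewrite (big_cat_nat leij) /= ?addKn // ltnS ltnW.
case: i leij => [|i]; first by rewrite {1}/below /npair big1 // => *; rewrite andbF.
case: j => // j leij; have [ltjn|lejn] := ltnP j n'; last first.
  rewrite {1}/below /npair big1 // => p _.
  by rewrite leqNgt (leq_trans (ltn_ord _)).
have [w Ew Cw] := wordE_split A (ltnW ltjn); rewrite Ew tw_cat in nz.
have [s1 nz1 /(_ [pred p | j.+1 <= tnth t p]%N i)[_ H1]] := tw_supp nz.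
have [s2 nz2 /(_ [pred p | j.+1 <= tnth t p]%N j)[_ H2]] := tw_supp nz1.
have [s3 /tbasis_neq0-> /(_ [pred p | j.+1 <= tnth t p]%N j)[_ H3]] := tw_supp nz2.
rewrite below_cnt; apply: leq_trans H1 _.
have -> : cnt_lt [pred p | j.+1 <= tnth t p]%N i.+1 s1 = 0%N.
  apply/eqP; rewrite -leqn0; apply: leq_trans (cnt_lt_mono _ _ leij) _.
  apply: leq_trans H2 _; rewrite count_wordE big_geq // addn0.
  apply: leq_trans H3 _; rewrite count_wordF addn0 leqn0.
  by rewrite [cnt_lt _ _ _]big1 // => p /= lt; rewrite ltnS leqNgt lt.
rewrite add0n Cw !count_wordE -sum_col_below.
by rewrite (big_cat_nat leij) /= ?addKn // ltnS ltnW.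
Qed.

End WordAction.

(** * Positivity of the diagonal coefficients *)

Section Positivity.
Variables (F : fieldType) (q : F) (n' d : nat).
Local Notation n := n'.+1.
Local Notation W := (tens F n d).
Local Notation tup := (d.-tuple 'I_n).
Hypothesis q0 : q != 0.
Variable pos : F -> Prop.
Hypothesis posD : forall a b, pos a -> pos b -> pos (a + b).
Hypothesis posM : forall a b, pos a -> pos b -> pos (a * b).
Hypothesis posX : forall k : int, pos (q ^ k).
Implicit Types (b : bool) (p : 'I_d) (s t : tup) (x : W) (g : nat -> 'I_d -> nat).

Definition nneg a := a = 0 \/ pos a.
Definition nnegt x := forall s, nneg (x s).

Lemma nnegD a c : nneg a -> nneg c -> nneg (a + c).
Proof.
by case=> [->|pa] [->|pc]; rewrite /nneg ?addr0 ?add0r; [left|right|right|right; apply: posD].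
Qed.

Lemma pos_nneg a c : pos a -> nneg c -> pos (a + c).
Proof. by move=> pa [->|pc]; [rewrite addr0|apply: posD]. Qed.

Lemma nneg_term b (i : 'I_n.-1) p s x : nnegt x ->
  nneg (if tnth s p == dst b i then q ^ kw b i p s * x (upd s p (src b i)) else 0).
Proof.
move=> nx; case: ifP => _; last by left.
by case: (nx (upd s p (src b i))) => [->|px]; [left; rewrite mulr0|right; apply: posM].
Qed.

Lemma lop_nneg b i x : nnegt x -> nnegt (lop q b i x).
Proof.
move=> nx s; rewrite /lop; case: insubP => [j _ _|_]; last by rewrite ev0; left.
rewrite tEFE //; apply: big_ind => [||p _]; [by left|exact: nnegD|exact: nneg_term].
Qed.

Lemma tw_nneg w x : nnegt x -> nnegt (tw q w x).
Proof. by move=> nx; elim: w => //= l w; apply: lop_nneg. Qed.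

Lemma lop_pos b i x s p (a : 'I_n) : (i < n')%N -> nnegt x ->
  tnth s p = (if b then i else i.+1) :> nat -> a = (if b then i.+1 else i) :> nat ->
  pos (x (upd s p a)) -> pos (lop q b i x s).
Proof.
move=> lti nx Es Ea px; rewrite /lop; case: insubP => [j _ Ej|]; last by rewrite lti.
rewrite tEFE // (bigD1 p) //=; apply: pos_nneg; last first.
  by apply: big_ind => [||r _]; [by left|exact: nnegD|exact: nneg_term].
have -> : tnth s p == dst b j by rewrite -val_eqE /= Es -Ej; case: (b).
have -> : src b j = a by apply: val_inj; rewrite /= Ea -Ej; case: (b).
by apply: posM.
Qed.

Lemma iter_lop_nneg m b i x : nnegt x -> nnegt (iter m (lop q b i) x).
Proof. by move=> nx; elim: m => //= m; apply: lop_nneg. Qed.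

(** Converting the places where [s] and [s'] differ one at a time gives one positive contribution,
    and no other contribution can cancel it. *)
Lemma iter_lop_pos m b i x s s' : (i < n')%N -> nnegt x -> pos (x s') ->
  (forall p, tnth s p = tnth s' p \/ tnth s p = (if b then i else i.+1) :> nat /\
                                    tnth s' p = (if b then i.+1 else i) :> nat) ->
  m = (\sum_p (tnth s p != tnth s' p))%N -> pos (iter m (lop q b i) x s).
Proof.
move=> lti nx px; elim: m s => [|m IHm] s ss' Em.
  suff -> : s = s' by [].
  apply: eq_from_tnth => p; apply/eqP/negPn.
  have /eqP := esym Em; rewrite sum_nat_eq0 => /forallP/(_ p) /=.
  by case: (tnth s p == tnth s' p).
have [p sp] : exists p, tnth s p != tnth s' p.
  apply/existsP; apply: contraTT isT; rewrite negb_exists => /forallP H.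
  by move: Em; rewrite big1 // => p _; have := H p; rewrite negbK => ->.
have [Ep|[Es Es']] := ss' p; first by rewrite Ep eqxx in sp.
rewrite iterS; apply: (@lop_pos b i _ s p _ lti (iter_lop_nneg m b i nx) Es Es'); apply: IHm => [r|].
  by rewrite tnth_upd; case: eqP => [->|_]; [left|apply: ss'].
move: Em; rewrite (bigD1 p) //= sp => -[->]; rewrite [RHS](bigD1 p) //= tnth_upd !eqxx add0n.
by apply: eq_bigr => r /negPf rp; rewrite tnth_upd rp.
Qed.

Definition tupf (g : 'I_d -> nat) : tup := [tuple inord (g p) | p < d].

Lemma tupfE (g : 'I_d -> nat) p : (g p < n)%N -> tnth (tupf g) p = g p :> nat.
Proof. by move=> lt; rewrite tnth_mktuple inordK. Qed.

Lemma eq_tupf (g h : 'I_d -> nat) : g =1 h -> tupf g = tupf h.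
Proof. by move=> E; apply: eq_from_tnth => p; rewrite !tnth_mktuple E. Qed.

Lemma tupf_id s : tupf (fun p => tnth s p) = s.
Proof. by apply: eq_from_tnth => p; rewrite tnth_mktuple inord_val. Qed.

Lemma block_pos m b i x (g g' : 'I_d -> nat) : (i < n')%N ->
  (forall p, g p < n)%N -> (forall p, g' p < n)%N -> nnegt x -> pos (x (tupf g')) ->
  (forall p, g p = g' p \/ g p = (if b then i else i.+1) /\ g' p = (if b then i.+1 else i)) ->
  m = (\sum_p (g p != g' p))%N -> pos (iter m (lop q b i) x (tupf g)).
Proof.
move=> lti ltg ltg' nx px gg' Em; apply: (iter_lop_pos lti nx px) => [p|].
  by case: (gg' p) => [E|[Eg Eg']]; [left; rewrite !tnth_mktuple E|right; rewrite !tupfE].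
by rewrite Em; apply: eq_bigr => p _; rewrite -val_eqE /= !tupfE.
Qed.

Lemma tw_nseq b i a x : tw q (tg b (nseq a i)) x = iter a (lop q b i) x.
Proof. by elim: a => //= a ->. Qed.

(** [g l] is the state after the block of E_l has acted on [g (l + 1)], and the exponent of E_l is
    the number of places where the two states differ. *)
Lemma stairE_pos k i m g x : (i + size m = k)%N -> (k <= n')%N ->
  (forall l p, l <= k -> g l p < n)%N ->
  (forall l p, (l < k)%N -> g l p = g l.+1 p \/ g l p = l /\ g l.+1 p = l.+1) ->
  (forall l, (l < size m)%N -> nth 0%N m l = (\sum_p (g (i + l)%N p != g (i + l).+1 p))%N) ->
  nnegt x -> pos (x (tupf (g k))) -> pos (tw q (tg true (stairw i m)) x (tupf (g i))).
Proof.
move=> + lek ltg gS; elim: m i => [|a m IHm] i /=; first by rewrite addn0 => ->.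
rewrite addnS -addSn => Ek Em nx px; rewrite /tg map_cat -!/(tg _ _) tw_cat tw_nseq.
apply: (@block_pos _ _ _ _ (g i) (g i.+1)) (tw_nneg _ nx) _ _ _.
- by apply: leq_trans lek; rewrite -Ek; lia.
- by move=> p; apply: ltg; lia.
- by move=> p; apply: ltg; lia.
- by apply: IHm => // l ltl; have := Em l.+1 ltl; rewrite addnS.
- by move=> p; apply: gS; lia.
by have := Em 0%N isT; rewrite addn0.
Qed.

Lemma stairF_pos k i m g x : (i + size m = k)%N -> (k <= n')%N ->
  (forall l p, l <= k -> g l p < n)%N ->
  (forall l p, (l < k)%N -> g l.+1 p = g l p \/ g l.+1 p = l.+1 /\ g l p = l) ->
  (forall l, (l < size m)%N -> nth 0%N m l = (\sum_p (g (i + l).+1 p != g (i + l)%N p))%N) ->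
  nnegt x -> pos (x (tupf (g i))) -> pos (tw q (rev (tg false (stairw i m))) x (tupf (g k))).
Proof.
move=> + lek ltg gS; elim: m i x => [|a m IHm] i x /=; first by rewrite addn0 => ->.
rewrite addnS -addSn => Ek Em nx px; rewrite /tg map_cat -!/(tg _ _) rev_cat tw_cat.
have -> : rev (tg false (nseq a i)) = tg false (nseq a i) by rewrite -tg_rev rev_nseq.
rewrite tw_nseq; apply: IHm => //.
- by move=> l ltl; have := Em l.+1 ltl; rewrite addnS.
- exact: iter_lop_nneg.
apply: (@block_pos _ _ _ _ (g i.+1) (g i)) nx _ _ _ => //.
- by apply: leq_trans lek; rewrite -Ek; lia.
- by move=> p; apply: ltg; lia.
- by move=> p; apply: ltg; lia.
- by move=> p; apply: gS; lia.
by have := Em 0%N isT; rewrite addn0.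
Qed.

Section Diagonal.
Variables t s : tup.
Local Notation A := (mat t s).

(* The places with t_p < s_p are first carried up by the F's, level by level from
   the largest s_p; then those with s_p < t_p are carried down by the E's. *)
Definition stateE k p : nat :=
  if (tnth s p < tnth t p <= k)%N then tnth s p : nat else maxn (tnth s p) (tnth t p).
Definition stateF k p : nat :=
  if (tnth t p < tnth s p)%N && (k < tnth s p)%N then tnth s p : nat else tnth t p.

Lemma wordE_pos k x : (k <= n')%N -> nnegt x -> pos (x (tupf (stateE 0))) ->
  pos (tw q (wordE A k) x (tupf (stateE k))).
Proof.
move=> + nx px; elim: k => // k IHk lek; rewrite wordES tw_cat.
(* A letter on its way from k + 1 to s_p has come down to max(s_p, i) once E_k, .., E_i have
   acted. *)
pose g i p := if (tnth t p == k.+1 :> nat) && (tnth s p < k.+1)%N then maxn (tnth s p) i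
  else stateE k p.
have -> : tupf (stateE k.+1) = tupf (g 0%N).
  by apply: eq_tupf => p; rewrite /g /stateE; case: eqP => /= ?; repeat case: ifP; lia.
have Ek : tupf (g k.+1) = tupf (stateE k).
  by apply: eq_tupf => p; rewrite /g /stateE; case: eqP => /= ?; repeat case: ifP; lia.
rewrite -[in pos _]Ek in IHk.
apply: (@stairE_pos k.+1 0 _ g) => //.
- by rewrite size_mkseq.
- move=> l p lel; rewrite /g /stateE; have := ltn_ord (tnth t p); have := ltn_ord (tnth s p).
  by repeat case: ifP; lia.
- move=> l p ltl; rewrite /g; case: ifP => _; last by left.
  have [lt|ge] := ltnP l (tnth s p); [left|right]; lia.
- move=> l; rewrite size_mkseq add0n => ltl; rewrite nth_colA ltl sum_mat_col.
  apply: eq_bigr => p _; rewrite /g; case: ifP => [/andP[-> _] /=|].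
    by congr nat_of_bool; lia.
  by rewrite eqxx /=; case: eqP => //=; lia.
- exact: tw_nneg.
by apply: IHk; rewrite ltnW.
Qed.

Lemma wordF_pos k x : (k <= n')%N -> nnegt x -> pos (x (tupf (stateF k))) ->
  pos (tw q (wordF A k) x (tupf (stateF 0))).
Proof.
elim: k x => // k IHk x lek nx px; rewrite wordFS tw_cat.
(* A letter on its way from t_p to k + 1 has come up to max(t_p, i) once F_0, .., F_(i-1) have
   acted. *)
pose g i p := if (tnth s p == k.+1 :> nat) && (tnth t p < k.+1)%N then maxn (tnth t p) i
  else stateF k p.
have E0 : tupf (stateF k.+1) = tupf (g 0%N).
  by apply: eq_tupf => p; rewrite /g /stateF; case: eqP => /= ?; repeat case: ifP; lia.
have Ek : tupf (g k.+1) = tupf (stateF k).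
  by apply: eq_tupf => p; rewrite /g /stateF; case: eqP => /= ?; repeat case: ifP; lia.
apply: IHk (ltnW lek) (tw_nneg _ nx) _; rewrite -Ek.
apply: (@stairF_pos k.+1 0 _ g) => //; last by rewrite -E0.
- by rewrite size_mkseq.
- move=> l p lel; rewrite /g /stateF; have := ltn_ord (tnth t p); have := ltn_ord (tnth s p).
  by repeat case: ifP; lia.
- move=> l p ltl; rewrite /g; case: ifP => _; last by left.
  have [lt|ge] := ltnP l (tnth t p); [left|right]; lia.
- move=> l; rewrite size_mkseq add0n => ltl; rewrite nth_rowA ltl sum_mat_row.
  apply: eq_bigr => p _; rewrite /g; case: ifP => [/andP[-> _] /=|].
    by congr nat_of_bool; lia.
  by rewrite eqxx /=; case: eqP => //=; lia.
Qed.

Lemma pbw_diag_pos : pos (tw q (wordA A n') (tbasis F t) s).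
Proof.
have pos1 : pos 1 by rewrite -(expr0z q).
have nt : nnegt (tbasis F t).
  by move=> r; rewrite /tbasis ffunE; case: eqP => _; [right|left].
have sE : tupf (stateE n') = s.
  rewrite -[RHS]tupf_id; apply: eq_tupf => p; rewrite /stateE.
  have := ltn_ord (tnth t p); rewrite ltnS => ->; rewrite andbT.
  by case: ltnP => // le; rewrite (maxn_idPl le).
have := @wordE_pos n' (tw q (wordF A n') (tbasis F t)) (leqnn _) (tw_nneg _ nt).
rewrite sE -tw_cat -wordAE; apply.
have -> : tupf (stateE 0) = tupf (stateF 0).
  by apply: eq_tupf => p; rewrite /stateE /stateF; repeat case: ifP; lia.
apply: wordF_pos (leqnn _) nt _.
have -> : tupf (stateF n') = t.
  rewrite -[RHS]tupf_id; apply: eq_tupf => p; rewrite /stateF.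
  have -> : (n' < tnth s p)%N = false by have := ltn_ord (tnth s p); lia.
  by rewrite andbF.
by rewrite /tbasis ffunE eqxx.
Qed.

End Diagonal.

End Positivity.

(** * Linear algebra *)

Section Spectral.
Variables (F : fieldType) (M : lmodType F) (K : {linear M -> M}).

(* The components of x are obtained from x by polynomials in K, so they lie in
   every K-stable subspace that contains x. *)
Lemma spectral_decomposition (l : seq F) x : uniq l ->
  foldl (fun y c => K y - c *: y) x l = 0 ->
  exists e : F -> M, [/\ x = \sum_(c <- l) e c,
    forall c, c \in l -> K (e c) = c *: e c &
    forall N, submod N -> (forall y, N y -> N (K y)) -> N x -> forall c, c \in l -> N (e c)].
Proof.
elim: l x => [|c0 l IHl] x /=; first by move=> _ ->; exists (fun=> 0); rewrite big_nil.
case/andP=> c0l ul /(IHl _ ul)[e [Ex eK eN]].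
have nc c : c \in l -> c == c0 = false by move=> cl; apply: contraNF c0l => /eqP<-.
(* [K - c0] multiplies the component at [c] by c - c0, which is undone here; the remainder is killed
   by [K - c0] and becomes the component at [c0]. *)
pose e' c := if c == c0 then x - \sum_(a <- l) (a - c0)^-1 *: e a else (c - c0)^-1 *: e c.
exists e'; split.
- rewrite big_cons /e' eqxx; rewrite [X in _ + X](eq_big_seq (fun a => (a - c0)^-1 *: e a)).
    by rewrite subrK.
  by move=> a /nc->.
- move=> c; rewrite inE /e'; have [->|/= _ cl] := eqVneq c c0; last first.
    by rewrite linopZ eK // !scalerA mulrC.
  set S := \sum_(a <- l) _ => _.
  have E : K S - c0 *: S = K x - c0 *: x.
    rewrite Ex /S linear_sum scaler_sumr -sumrB; apply: eq_big_seq => a al.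
    rewrite linopZ eK // !scalerA -scalerBl mulrC -mulrBl divff ?scale1r //.
    by rewrite subr_eq0 nc.
  rewrite linopD linopN scalerBr -[K x](subrK (c0 *: x)) -E.
  by lmod F; ring.
move=> N sN NK Nx c.
have Ne a : a \in l -> N (e a).
  by apply: eN => //; apply: submodB => //; [exact: NK|exact: submodZ].
rewrite inE /e'; case: eqP => [_ _|_ /= cl]; last by apply: submodZ => //; exact: Ne.
apply: submodB => //; rewrite big_seq; apply: big_ind => [|y z Ny Nz|a al].
- exact: submod0.
- exact: submodD.
by apply: submodZ => //; exact: Ne.
Qed.

End Spectral.

Section Triangular.
Variables (F : fieldType) (I : finType) (m : I -> I -> F) (h : I -> nat).
Hypothesis m_tri : forall i j, m i j != 0 -> (h j <= h i)%N /\ (h j = h i -> j = i).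
Hypothesis m_diag : forall i, m i i != 0.

(** Take an index of maximal height among those with nonzero coefficient: in its column only the
    diagonal entry contributes. *)
Lemma triangular_inj (c : I -> F) : (forall j, \sum_i c i * m i j = 0) -> forall i, c i = 0.
Proof.
move=> Hc i0; apply/eqP/negPn/negP => nz.
have [i ci imax] := arg_maxnP (P := fun i => c i != 0) h nz.
have := Hc i; rewrite (bigD1 i) //= big1 => [|j ji].
  by rewrite addr0 => /eqP; rewrite mulf_eq0 (negPf ci) (negPf (m_diag i)).
have [->|cj] := eqVneq (c j) 0; first by rewrite mul0r.
have [->|/m_tri[le eq]] := eqVneq (m j i) 0; first by rewrite mulr0.
have Eij : i = j by apply/eq/eqP; rewrite eqn_leq le; apply: imax.
by rewrite Eij eqxx in ji.
Qed.

Lemma triangular_surj (v : I -> F) : exists c : I -> F, forall j, \sum_i c i * m i j = v j.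
Proof.
pose A : 'M[F]_#|I| := \matrix_(i, j) m (enum_val i) (enum_val j).
have sumE (c : 'rV[F]_#|I|) j :
    (c *m A) 0 j = \sum_i c 0 (enum_rank i) * m i (enum_val j).
  rewrite mxE (reindex_onto enum_rank enum_val) /=; last by move=> i _; apply: enum_valK.
  by apply: eq_big => i; rewrite ?enum_rankK ?eqxx // mxE enum_rankK.
have Au : A \in unitmx.
  rewrite -row_free_unit; apply: inj_row_free => c cA; apply/rowP => i; rewrite mxE.
  rewrite -[i]enum_valK; apply: (triangular_inj (c := fun i => c 0 (enum_rank i))) => j.
  by rewrite -[j]enum_rankK -sumE cA mxE.
pose w : 'rV[F]_#|I| := \row_j v (enum_val j).
exists (fun i => (w *m invmx A) 0 (enum_rank i)) => j.
by rewrite -[j]enum_rankK -sumE mulmxKV // mxE.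
Qed.

End Triangular.

Section FreeAlgebraInduction.
Variables (F : fieldType) (X : choiceType).

Lemma free_ind (P : freeAlg F X -> Prop) : P 0 -> (forall a b, P a -> P b -> P (a + b)) ->
  (forall c a, P a -> P (c *: a)) -> P 1 -> (forall x a, P a -> P (gen F x * a)) ->
  forall a, P a.
Proof.
move=> P0 PD PZ P1 PM a; rewrite [a]monalgE; apply: big_ind => // w _.
have -> : (<< a@_w *g w >> : freeAlg F X) = a@_w *: << w >>.
  by apply/malgP => k; rewrite mcoeffZ !mcoeffU mulr_natr.
apply: PZ; case: w => w; elim: w => [|x w IHw]; first by rewrite -fmoneE; exact: P1.
suff -> : (<< FMonom (x :: w) >> : freeAlg F X) = gen F x * << FMonom w >> by apply: PM.
rewrite malgM_def fgmulUU mulr1; congr (<< _ *g _ >>).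
by apply: val_inj; rewrite /= fmM fmU.
Qed.

End FreeAlgebraInduction.

(** * The generators commute with the Hecke operators *)

Section SchurHecke.
Variables (F : fieldType) (q : F) (n' d : nat).
Hypothesis q0 : q != 0.

Lemma cnt_swap i (r : 'I_d.-1) (s : d.-tuple 'I_n'.+1) : cnt i (swap r s) = cnt i s.
Proof.
rewrite /cnt [RHS](reindex_inj (@perm_inj _ (tperm (lo r) (hi r)))).
by apply: eq_bigr => p _; rewrite tnth_swap.
Qed.

Lemma dgq_hecke e (r : 'I_d.-1) (x : tens F n'.+1 d) : (forall s, e (swap r s) = e s) ->
  dgq q e (heckeOp q r x) = heckeOp q r (dgq q e x).
Proof.
move=> He; apply/ffunP => s; rewrite dgqE !heckeOpE !dgqE He mulrDr.
by rewrite mulrCA [X in _ + X]mulrCA.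
Qed.

Lemma schurOp_hecke g r x :
  heckeOp q r (@schurOp F q n' d g x) = @schurOp F q n' d g (heckeOp q r x).
Proof.
apply/esym; case: g => i; [exact: tEF_hecke|exact: tEF_hecke| |]; apply: dgq_hecke => s;
  by rewrite cnt_swap.
Qed.

End SchurHecke.

(** * Bijectivity *)

Section Assembly.
Variables (F : fieldType) (q : F) (n' d : nat).
Local Notation n := n'.+1.
Local Notation W := (tens F n d).
Local Notation tup := (d.-tuple 'I_n).
Variables (T : algType F) (pi : freeAlg F (schurGen n) -> T).
Hypothesis pi_lin : linear pi.
Hypothesis pi_mon : monoid_morphism pi.
Hypothesis pi_rel : forall a b, schurRel d q a b -> pi a = pi b.
Hypothesis pi_surj : forall x, exists a, x = pi a.
Hypothesis q0 : q != 0.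
Hypothesis q_inj : forall a b : int, q ^ a = q ^ b -> a = b.
Hypothesis qgam_neq0 : forall j, qgam q j.+1 != 0.
Variable rho : T -> W -> W.
Hypothesis rhoE : forall a u, rho (pi a) u = freeAct (@schurOp F q n' d) a u.
Local Notation schurOp := (@schurOp F q n' d).
Local Notation EF := (EF pi).
Local Notation TK := (TK pi).
Local Notation lw := (lw pi).
Implicit Types (x y : T) (u : W) (s t : tup).

Lemma rhoD x y u : rho (x + y) u = rho x u + rho y u.
Proof.
case: (pi_surj x) => a ->; case: (pi_surj y) => b ->.
rewrite -(piD pi_lin) !rhoE; exact: freeActD.
Qed.

Lemma rhoZ c x u : rho (c *: x) u = c *: rho x u.
Proof.
case: (pi_surj x) => a ->; rewrite -(piZ pi_lin) !rhoE; exact: freeActZ.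
Qed.

Lemma rho_scale c x u : rho x (c *: u) = c *: rho x u.
Proof. by case: (pi_surj x) => a ->; rewrite !rhoE linearZ. Qed.

Lemma rhoM x y u : rho (x * y) u = rho x (rho y u).
Proof.
case: (pi_surj x) => a ->; case: (pi_surj y) => b ->.
by rewrite -(piM pi_mon) !rhoE; exact: freeActM.
Qed.

Lemma rho1 u : rho 1 u = u.
Proof. rewrite -(pi1 pi_mon) rhoE; exact: freeAct1. Qed.

Lemma rho0 u : rho 0 u = 0.
Proof. by rewrite -[0](scale0r 0) rhoZ scale0r. Qed.

Lemma rho_sum (I : Type) (r : seq I) (f : I -> T) u :
  rho (\sum_(i <- r) f i) u = \sum_(i <- r) rho (f i) u.
Proof. exact: (big_morph (rho^~ u) (fun x y => rhoD x y u) (rho0 u)). Qed.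

Lemma rho_EF b i u : rho (EF b i) u = lop q b i u.
Proof.
rewrite /EF /lop; case: insubP => [j _ _|_]; last exact: rho0.
by rewrite rhoE; apply: etrans (freeAct_gen _ _ _) _; case: b.
Qed.

Lemma rho_lw w x u : rho (lw w x) u = tw q w (rho x u).
Proof. by elim: w => //= l w IHw; rewrite rhoM rho_EF IHw. Qed.

Lemma rho_TK i u : rho (TK i) u = dgq q (cnt i) u.
Proof. by rewrite rhoE; apply: freeAct_gen. Qed.

Definition diagonal x := forall t, exists c, rho x (tbasis F t) = c *: tbasis F t.

Lemma dgq_tbasis e t : dgq q e (tbasis F t) = q ^ e t *: tbasis F t.
Proof.
apply/ffunP => s; rewrite evZ dgqE /tbasis ffunE.
by case: eqP => [->|_] //; rewrite !mulr0.
Qed.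

Lemma submod_diagonal : submod diagonal.
Proof.
split=> [t|c x y Dx Dy t]; first by exists 0; rewrite rho0 scale0r.
have [a Ea] := Dx t; have [b Eb] := Dy t.
by exists (c * a + b); rewrite rhoD rhoZ Ea Eb scalerA -scalerDl.
Qed.

Lemma diagonalM x y : diagonal x -> diagonal y -> diagonal (x * y).
Proof.
move=> Dx Dy t; have [a Ea] := Dx t; have [b Eb] := Dy t.
by exists (b * a); rewrite rhoM Eb rho_scale Ea scalerA.
Qed.

Lemma TK_comm i j : TK i * TK j = TK j * TK i.
Proof. apply: (pi_eqM pi_mon); exact: pi_rel (Q1_comm _ _ _ _). Qed.

(** By (Q7) the components of 1 are polynomials in [TK j], so they inherit from it that they act
    diagonally and commute with every [TK i]. *)
Lemma TK_components j : exists e : 'I_d.+1 -> T, [/\ \sum_m e m = 1,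
  forall m, TK j * e m = q ^+ m *: e m,
  forall m, diagonal (e m) & forall i m, TK i * e m = e m * TK i].
Proof.
pose l := [seq q ^+ m | m : 'I_d.+1].
have ul : uniq l.
  rewrite map_inj_uniq ?enum_uniq // => a b E; apply: val_inj.
  by have [] := q_inj (a := a%:Z) (b := b%:Z) E.
have E : \prod_(m < d.+1) (TK j - (q ^+ m)%:A) = 0.
  exact: pi_prod0 (pi_rel (Q7 _ _ j)).
have := @spectral_decomposition F T (lmulT (TK j)) (rev l) 1.
rewrite rev_uniq foldl_rev => /(_ ul)[].
  have Ei : index_enum 'I_d.+1 = enum 'I_d.+1 by rewrite enumT [LHS]unlock.
  rewrite -[RHS]E Ei /l foldr_map; elim: (enum _) => [|m r IH] /=.
    by rewrite big_nil.
  by rewrite big_cons IH /lmulT mulrBl -scalerAl mul1r.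
move=> e [E1 eK eN]; exists (fun m : 'I_d.+1 => e (q ^+ m)).
have inl (m : 'I_d.+1) : q ^+ m \in rev l by rewrite mem_rev; apply: map_f; rewrite mem_enum.
split.
- by rewrite [RHS]E1 (perm_big l) ?perm_rev //= [RHS]big_map big_enum.
- by move=> m; apply: eK.
- move=> m; apply: eN => //; first exact: submod_diagonal.
    move=> y; apply: diagonalM => t; exists (q ^ cnt j t).
    by rewrite rho_TK dgq_tbasis.
  by move=> t; exists 1; rewrite rho1 scale1r.
move=> i m; apply: (eN (fun y => TK i * y = y * TK i)) => //.
- split=> [|c x y Ex Ey]; first by rewrite mulr0 mul0r.
  by rewrite mulrDr mulrDl -scalerAr -scalerAl Ex Ey.
- by move=> y Ey; rewrite /= /lmulT mulrA TK_comm -!mulrA Ey.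
by rewrite mulr1 mul1r.
Qed.

Definition lam t : {ffun 'I_n -> 'I_d.+1} :=
  [ffun j => inord (\sum_p (tnth t p == j))].

Lemma lamE t j : lam t j = (\sum_p (tnth t p == j))%N :> nat.
Proof. by rewrite ffunE inordK // ltnS cnt_le. Qed.

Definition la (f : {ffun 'I_n -> 'I_d.+1}) (j : nat) : int :=
  if insub j is Some k then (f k)%:Z else 0.

Lemma laE f (j : 'I_n) : la f j = (f j)%:Z.
Proof. by rewrite /la valK. Qed.

(** Products over j of the components of 1. Comparing eigenvalues, [e f] kills each v_t of a weight
    other than [f]; as all the [e f] sum to 1, it fixes the v_t of weight [f]. *)
Lemma weight_idempotents : exists e : {ffun 'I_n -> 'I_d.+1} -> T,
  [/\ \sum_f e f = 1, forall f, wt q pi (la f) (e f) &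
      forall f t, rho (e f) (tbasis F t) = (f == lam t)%:R *: tbasis F t].
Proof.
have [e He] := fin_all_exists TK_components.
pose u (f : {ffun 'I_n -> 'I_d.+1}) := \prod_j e j (f j).
have usum : \sum_f u f = 1.
  rewrite /u -(bigA_distr_bigA (fun j m => e j m)) big1 // => j _.
  by have [] := He j.
have uwt f : wt q pi (la f) (u f).
  move=> i; rewrite laE /u -[q ^ _]/(q ^+ f i).
  have Eu (r : seq 'I_n) : i \in r ->
     TK i * (\prod_(j <- r) e j (f j)) = q ^+ f i *: \prod_(j <- r) e j (f j).
    elim: r => // j r IHr; rewrite inE big_cons; case: eqVneq => [<- _|_ /= ir].
      by rewrite mulrA; have [_ -> _ _] := He i; rewrite -scalerAl.
    have [_ _ _ jc] := He j.
    by rewrite mulrA jc -mulrA IHr // -scalerAr.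
  by apply: Eu; rewrite mem_index_enum.
have udiag f : diagonal (u f).
  rewrite /u; elim/big_ind: _ => [|x y|j _]; first by move=> t; exists 1; rewrite rho1 scale1r.
    exact: diagonalM.
  by have [_ _ + _] := He j; apply.
have tb0 t : tbasis F t != 0.
  apply/eqP => /(congr1 (fun y : W => y t)); rewrite /tbasis ffunE eqxx ev0 => /eqP.
  by rewrite oner_eq0.
have uneq f t : f != lam t -> rho (u f) (tbasis F t) = 0.
  move=> nf; have [c Ec] := udiag f t; rewrite Ec.
  suff -> : c = 0 by rewrite scale0r.
  apply/eqP; apply: contraNT nf => c0; apply/eqP/ffunP => j; apply: val_inj => /=.
  have := congr1 (fun y => rho y (tbasis F t)) (uwt f j).
  rewrite rhoM rhoZ Ec rho_TK (linopZ (dgq q _)) /= dgq_tbasis !scalerA => /eqP.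
  rewrite -subr_eq0 -scalerBl scaler_eq0 (negPf (tb0 t)) orbF mulrC -mulrBl.
  rewrite mulf_eq0 (negPf c0) orbF subr_eq0 => /eqP/q_inj.
  by rewrite laE cnt_nat lamE => -[].
exists u; split=> // f t; case: eqP => [->|/eqP/uneq->]; last by rewrite scale0r.
rewrite scale1r -[RHS]rho1 -usum rho_sum (bigD1 (lam t)) //= big1 ?addr0 // => g.
exact: uneq.
Qed.

Lemma pi_stable (N : T -> Prop) y : submod N ->
  (forall g z, N z -> N (pi (gen F g) * z)) -> N y -> forall a, N (pi a * y).
Proof.
move=> sN Ng Ny; apply: free_ind => [|a b Na Nb|c a Na||g a Na].
- by rewrite (pi0 pi_lin) mul0r; apply: submod0.
- by rewrite (piD pi_lin) mulrDl; apply: submodD.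
- by rewrite (piZ pi_lin) -scalerAl; apply: submodZ.
- by rewrite (pi1 pi_mon) mul1r.
by rewrite (piM pi_mon) -mulrA; apply: Ng.
Qed.

Section Coefficients.
Variable e : {ffun 'I_n -> 'I_d.+1} -> T.
Hypothesis e_sum : \sum_f e f = 1.
Hypothesis e_wt : forall f, wt q pi (la f) (e f).
Hypothesis e_rho : forall f t, rho (e f) (tbasis F t) = (f == lam t)%:R *: tbasis F t.

Definition pbw t s : T := lw (wordA (mat t s) n') (e (lam t)).

Lemma lw_span f (N : T -> Prop) : submod N ->
  (forall w, idx n' w -> N (lw w (e f))) -> forall x, N (x * e f).
Proof.
move=> sN Nw x; have [a ->] := pi_surj x.
(* The subspace is quantified again because the induction replaces it by its preimage under a
   generator. *)
pose N' y := forall N, submod N -> (forall w, idx n' w -> N (lw w (e f))) -> N y.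
suff : N' (pi a * e f) by apply.
apply: pi_stable => [|g z Nz N1 sN1 N1w|N1 _ /(_ [::])]; last exact.
  split=> [N1 sN1 _|c y z Ny Nz N1 sN1 N1w]; first exact: submod0.
  by case: (sN1) => _; apply; [apply: Ny|apply: Nz].
apply: (Nz (fun y => N1 (pi (gen F g) * y))).
  exact: (@submod_preim _ _ N1 (lmulT (pi (gen F g))) sN1).
move=> w iw; have wuw := wt_lw pi_lin pi_mon pi_rel q0 w (e_wt f).
case: g => i.
- rewrite -[pi _]/(pi (genEF F true i)) -EF_ord; apply: (N1w ((true, i : nat) :: w)).
  by rewrite /= ltn_ord.
- rewrite -[pi _]/(pi (genEF F false i)) -EF_ord; apply: (N1w ((false, i : nat) :: w)).
  by rewrite /= ltn_ord.
- by rewrite [X in N1 X](wuw i); apply: submodZ => //; apply: N1w.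
by rewrite [X in N1 X](TK'_wt pi_mon pi_rel q0 i wuw); apply: submodZ => //; apply: N1w.
Qed.

Lemma pbw_generate (N : T -> Prop) : submod N ->
  (forall t s, sorted_pair t s -> N (pbw t s)) -> forall x, N x.
Proof.
move=> sN Nb x; rewrite -[x]mulr1 -e_sum mulr_sumr.
apply: big_ind => [|y z|f _]; [exact: submod0|exact: submodD|].
have [->|ne0] := eqVneq (e f) 0; first by rewrite mulr0; apply: submod0.
apply: lw_span => // w iw.
apply: (pbw_span pi_lin pi_mon pi_rel q0 q_inj qgam_neq0 (leqnn n') sN (e_wt f)) => // A HA.
(* The diagonal entry is what column j lacks to reach the weight entry f j; by [HA] the truncated
   subtraction is exact. *)
pose A' i j : nat := if i == j then
  (f (inord j) - \sum_(l < n | l != j :> nat) A l j)%N else A i j.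
have HA' (j : 'I_n) : (\sum_(l < n | l != j :> nat) A l j <= f j)%N.
  by have := HA j; rewrite -ltnS ltn_ord laE => /(_ isT).
have EA j : (j < n)%N -> (\sum_(i < n) A' i j = f (inord j))%N.
  move=> ltj; rewrite (bigD1 (Ordinal ltj)) //= {1}/A' eqxx.
  rewrite [X in (_ + X)%N](eq_bigr (fun l : 'I_n => A l j)) => [|l /negPf lj]; last first.
    by rewrite /A'; move: lj; rewrite -val_eqE /= => ->.
  by rewrite subnK //; have := HA' (inord j); rewrite inordK.
have [|t [s [ts E]]] := @sorted_pair_exists n' d A' (fun j => f (inord j)) _ EA.
  have := wt_sum pi_lin pi_mon pi_rel q0 q_inj (e_wt f) ne0.
  under eq_bigr do rewrite laE.
  rewrite -(big_morph Posz PoszD (erefl 0)) => -[] Ed; apply: etrans Ed.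
  by apply: eq_bigr => j _; rewrite inord_val.
have -> : f = lam t.
  apply/ffunP => j; apply: val_inj; rewrite /= lamE -[in LHS](inord_val j) -EA //.
  apply: etrans (sum_mat t s j); apply: eq_bigr => i _.
  by rewrite E.
rewrite (@eq_wordA _ (mat t s)); first exact: Nb.
by move=> i j ij lei lej; rewrite E // /A' (negPf ij).
Qed.

(** Sums all statistics of the order, so that for comparable pairs equal heights force every
    statistic to agree. The indices run up to n because a matrix entry is a difference of statistics
    at i, i + 1 and j, j + 1. *)
Definition height t s : nat :=
  \sum_(x : 'I_n.+1 * 'I_n.+1)
     ((x.2 <= x.1) * above t s x.1 x.2 + (x.1 <= x.2) * below t s x.1 x.2).

Lemma tw0 w : tw q w (0 : W) = 0.
Proof.
elim: w => //= l w ->; rewrite /lop; case: insubP => // j _ _.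
exact: (linop0 (tEF q l.1 (j : 'I_n.-1) (enum 'I_d))).
Qed.

Lemma pbw_coef t s t' s' : rho (pbw t s) (tbasis F t') s' =
  (lam t == lam t')%:R * tw q (wordA (mat t s) n') (tbasis F t') s'.
Proof.
rewrite rho_lw e_rho; case: eqP => _; first by rewrite scale1r mul1r.
by rewrite scale0r tw0 ev0 mul0r.
Qed.

Lemma pbw_coef_triangular t s t' s' : rho (pbw t s) (tbasis F t') s' != 0 ->
  sorted_pair t s -> sorted_pair t' s' ->
  (height t' s' <= height t s)%N /\ (height t' s' = height t s -> t' = t /\ s' = s).
Proof.
rewrite pbw_coef; case: (lam t =P lam t') => [El|_]; last by rewrite mul0r eqxx.
rewrite mul1r => /(pbw_supp q0) H ts ts'.
pose C (x : 'I_n.+1 * 'I_n.+1) := 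
   ((x.2 <= x.1) * above t' s' x.1 x.2 + (x.1 <= x.2) * below t' s' x.1 x.2 ==
    (x.2 <= x.1) * above t s x.1 x.2 + (x.1 <= x.2) * below t s x.1 x.2)%N.
have L (x : 'I_n.+1 * 'I_n.+1) : ((x.2 <= x.1) * above t' s' x.1 x.2 <= (x.2 <= x.1) * above t s x.1 x.2)%N
   /\ ((x.1 <= x.2) * below t' s' x.1 x.2 <= (x.1 <= x.2) * below t s x.1 x.2)%N.
  have [H1 H2] := H x.1 x.2; split; rewrite leq_mul2l orbC.
    by case: (boolP (x.2 <= x.1)%N) => [/H1->|]; rewrite ?orbT.
  by case: (boolP (x.1 <= x.2)%N) => [/H2->|]; rewrite ?orbT.
have [le eq] : (height t' s' <= height t s ?= iff [forall (x | true), C x])%N.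
  apply: leqif_sum => x _; apply: leqif_eq; apply: leq_add; by have [] := L x.
split=> // /eqP; rewrite eq => /forallP HC.
have Ea i j : (i < n.+1)%N -> (j < n.+1)%N -> (j <= i)%N -> above t' s' i j = above t s i j.
  move=> lti ltj leji; have := HC (Ordinal lti, Ordinal ltj); rewrite /C /= leji !mul1n.
  have := L (Ordinal lti, Ordinal ltj); rewrite /= leji !mul1n => -[]; lia.
have Eb i j : (i < n.+1)%N -> (j < n.+1)%N -> (i <= j)%N -> below t' s' i j = below t s i j.
  move=> lti ltj leij; have := HC (Ordinal lti, Ordinal ltj); rewrite /C /= leij !mul1n.
  have := L (Ordinal lti, Ordinal ltj); rewrite /= leij !mul1n => -[]; lia.
have Eoff i j : (i < n)%N -> (j < n)%N -> i != j -> mat t' s' i j = mat t s i j.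
  move=> lti ltj; case: (ltngtP i j) => // ltij _.
    have := mat_below t s i j; have := mat_below t' s' i j.
    by rewrite !Eb //; lia.
  have := mat_above t s i j; have := mat_above t' s' i j.
  by rewrite !Ea //; lia.
apply: sorted_pair_inj => // i j lti ltj.
(* The second difference for a diagonal entry involves statistics outside the compared ranges; the
   entry is recovered from its column sum, which the common weight fixes. *)
have [<-|] := eqVneq i j; last exact: Eoff.
have : (\sum_(l < n) mat t' s' l i = \sum_(l < n) mat t s l i)%N.
  by rewrite !sum_mat -[LHS](lamE t' (Ordinal lti)) -El lamE.
rewrite (bigD1 (Ordinal lti)) //= [RHS](bigD1 (Ordinal lti)) //=.
rewrite (eq_bigr (fun l : 'I_n => mat t s l i)) => [|l]; first by move/addIn.
by rewrite -val_eqE /= => li; apply: Eoff.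
Qed.

Variable pos : F -> Prop.
Hypothesis posD : forall a b, pos a -> pos b -> pos (a + b).
Hypothesis posM : forall a b, pos a -> pos b -> pos (a * b).
Hypothesis posX : forall k : int, pos (q ^ k).
Hypothesis pos0 : ~ pos 0.

Definition sorted_pairs := {x : tup * tup | sorted_pair x.1 x.2}.
Implicit Types (k l : sorted_pairs).

Let coef k l := rho (pbw (val k).1 (val k).2) (tbasis F (val l).1) (val l).2.
Let hgt k := height (val k).1 (val k).2.

Let coef_tri k l : coef k l != 0 -> (hgt l <= hgt k)%N /\ (hgt l = hgt k -> l = k).
Proof.
move=> nz; have [le eq] := pbw_coef_triangular nz (valP k) (valP l); split=> // /eq[E1 E2].
by apply: val_inj; rewrite [val l]surjective_pairing E1 E2 -surjective_pairing.
Qed.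

Let coef_diag k : coef k k != 0.
Proof.
rewrite /coef pbw_coef eqxx mul1r; apply/eqP => E; apply: pos0; rewrite -E.
exact: (pbw_diag_pos q0 posD posM posX).
Qed.

Let pbw_decomposition x : exists c : sorted_pairs -> F,
  x = \sum_k c k *: pbw (val k).1 (val k).2.
Proof.
apply: (pbw_generate (N := fun x => exists c : sorted_pairs -> F,
  x = \sum_k c k *: pbw (val k).1 (val k).2)) => [|t s ts].
  split=> [|a _ _ [c1 ->] [c2 ->]].
    by exists (fun=> 0); rewrite big1 // => k _; rewrite scale0r.
  exists (fun k => a * c1 k + c2 k); rewrite scaler_sumr -big_split.
  by apply: eq_bigr => k _; rewrite scalerDl scalerA.
pose k0 : sorted_pairs := Sub (t, s) ts.
exists (fun k => (k == k0)%:R); rewrite (bigD1 k0) //= eqxx scale1r big1 ?addr0 //.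
by move=> k /negPf->; rewrite scale0r.
Qed.

Let rho_coef (c : sorted_pairs -> F) l :
  rho (\sum_k c k *: pbw (val k).1 (val k).2) (tbasis F (val l).1) (val l).2 =
  \sum_k c k * coef k l.
Proof.
rewrite rho_sum sum_ffunE; apply: eq_bigr => k _.
by rewrite rhoZ evZ.
Qed.

Lemma rho_eq0 x : (forall u, rho x u = 0) -> x = 0.
Proof.
have [c ->] := pbw_decomposition x => Hc.
rewrite big1 // => k _; rewrite (triangular_inj coef_tri coef_diag) ?scale0r // => l.
by rewrite -rho_coef Hc ev0.
Qed.

(** The triangular system is solved so that [rho x] and [g] agree at the sorted pairs; both commute
    with the Hecke operators, so they agree everywhere. *)
Lemma rho_onto (g : {linear W -> W}) : (forall r u, g (heckeOp q r u) = heckeOp q r (g u)) ->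
  exists x, forall u, rho x u = g u.
Proof.
move=> gT; have [c Hc] := triangular_surj coef_tri coef_diag
  (fun l => g (tbasis F (val l).1) (val l).2).
set x := \sum_k c k *: pbw (val k).1 (val k).2 in Hc *.
exists x => u; have [a xE] := pi_surj x.
have Hx v : rho x v = freeAct schurOp a v by rewrite xE rhoE.
rewrite Hx; apply/eqP; rewrite -subr_eq0; apply/eqP.
apply: (@hecke_determined F q n' d q0 (freeAct schurOp a \- g)) => [r v|t s ts] /=.
  rewrite gT linearB /= -(freeAct_comm (g := heckeOp q r)) // => y z.
  exact: schurOp_hecke.
pose k : sorted_pairs := Sub (t, s) ts.
by have := rho_coef c k; rewrite Hc -/x Hx /= => E; rewrite evD evN E subrr.
Qed.

End Coefficients.

End Assembly.

(** * The isomorphism over a field with a positive cone *)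

Section Presentation.
Variables (F : fieldType) (q : F) (n' d : nat).
Local Notation n := n'.+1.
Local Notation W := (tens F n d).
Local Notation S := (schurPres n d q).

(* A presented algebra may be trivial, so schurPres is no algType; this copy of
   it is one, because it depends on a proof of 1 != 0. *)
Definition nzSchurPres (_ : (1 : S) != 0) : Type := S.

Section Algebra.
Variable nz : (1 : S) != 0.
Local Notation T := (nzSchurPres nz).
HB.instance Definition _ := GRing.PzRing.copy T S.
HB.instance Definition _ := GRing.Lmodule.copy T S.
HB.instance Definition _ := GRing.PzSemiRing_isNonZero.Build T nz.
HB.instance Definition _ := GRing.Lmodule_isLalgebra.Build F T
  (@pres_scalerAl F (schurGen n) (schurRel d q)).
HB.instance Definition _ := GRing.Lalgebra_isAlgebra.Build F T
  (@pres_scalerAr F (schurGen n) (schurRel d q)).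
End Algebra.

Hypothesis q0 : q != 0.
Hypothesis q2 : q - q^-1 != 0.
Hypothesis q_inj : forall a b : int, q ^ a = q ^ b -> a = b.
Variable pos : F -> Prop.
Hypothesis posD : forall a b, pos a -> pos b -> pos (a + b).
Hypothesis posM : forall a b, pos a -> pos b -> pos (a * b).
Hypothesis posX : forall k : int, pos (q ^ k).
Hypothesis pos0 : ~ pos 0.
Local Notation schurOp := (@schurOp F q n' d).
Local Notation rho := (@presAct F (schurGen n) (schurRel d q) W schurOp).

(** 1 acts as the identity on a tensor power that is not zero. *)
Lemma schurPres_nz : (1 : S) != 0.
Proof.
pose t : d.-tuple 'I_n := [tuple ord0 | _ < d].
apply/eqP => E; have := presAct1 (schurRel_act q0 q2) (tbasis F t : W).
have := presActZ (schurRel_act q0 q2) 0 (1 : S) (tbasis F t : W).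
rewrite !scale0r E => ->.
move/(congr1 (fun y : W => y t)); rewrite ev0 /tbasis ffunE eqxx => /esym/eqP.
by rewrite oner_eq0.
Qed.

Lemma rho_hecke (x : S) (h : heckeAlg d q) (u : W) : rho x (heckeAct h u) = heckeAct h (rho x u).
Proof.
rewrite /heckeAct /presAct; apply: (freeAct_comm (g := freeAct schurOp (repr x))) => r v.
apply/esym; apply: (freeAct_comm (g := heckeOp q r)) => g w.
exact: schurOp_hecke.
Qed.

Fact rho_isHeckeLinear x : isHeckeLinear q (linfun (rho x)).
Proof. by apply/asboolP => h u; rewrite !lfunE; exact: rho_hecke. Qed.

Definition schurMap (x : S) : qSchur n d q := QSchur (rho_isHeckeLinear x).

Lemma schurMapE x u : schurMap x u = rho x u.
Proof. exact: lfunE. Qed.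

(** Quantum integers are sums of powers of [q], hence positive. *)
Lemma qgam_neq0 j : qgam q j.+1 != 0.
Proof.
suff : pos (qgam q j.+1) by move=> pj; apply/eqP => E; apply: pos0; rewrite -E.
have pX i : pos (q ^+ i) := posX i.
elim: j => [|j IHj]; first by rewrite /= mulr0 addr0; apply: pX.
by rewrite /= ; apply: posD; [apply: pX|apply: posM => //; have := posX (-1); rewrite exprN1].
Qed.

Theorem schurMap_iso : [/\ linear schurMap, monoid_morphism schurMap & bijective schurMap].
Proof.
have Sa := schurRel_act (n' := n') (d := d) q0 q2.
have eqS (f g : qSchur n d q) : (forall u, f u = g u) -> f = g.
  by move=> fg; apply: val_inj; apply/lfunP.
have map_lin : linear schurMap.
  move=> c x y; apply: eqS => u; rewrite add_lfunE scale_lfunE !schurMapE.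
  by rewrite (presActD Sa) (presActZ Sa).
pose T := nzSchurPres schurPres_nz.
pose pi : freeAlg F (schurGen n) -> T := presPi (schurRel d q).
have pi_surj (x : T) : exists a, x = pi a.
  by exists (repr (x : S)); apply/esym; exact: presPi_reprK.
have pi_lin : linear pi by exact: presPi_linear.
have pi_mon : monoid_morphism pi by exact: presPi_monoid_morphism.
have pi_rel a b : schurRel d q a b -> pi a = pi b by exact: presPi_rel.
have rhoE a u : rho (pi a) u = freeAct schurOp a u by exact: presAct_pi Sa a u.
have [e [e_sum e_wt e_rho]] := weight_idempotents pi_lin pi_mon pi_rel pi_surj q_inj rhoE.
have rho0 := rho_eq0 pi_lin pi_mon pi_rel pi_surj q0 q_inj qgam_neq0 rhoE e_sum e_wt e_rho posD posM posX pos0.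
have rho1 := rho_onto pi_lin pi_mon pi_surj q0 rhoE e_rho posD posM posX pos0.
split=> //.
  split; first by apply: eqS => u; rewrite schurMapE (presAct1 Sa) id_lfunE.
  by move=> x y; apply: eqS => u; rewrite schurMapE (presActM Sa) comp_lfunE !schurMapE.
have map_inj : injective schurMap.
  move=> x y E; apply/eqP; rewrite -subr_eq0 addrC -scaleN1r; apply/eqP; apply: rho0 => u.
  by rewrite -schurMapE map_lin E scaleN1r addNr zero_lfunE.
have /choice[g gK] (f : qSchur n d q) : exists x, schurMap x = f.
  have fT r u : qSchur_val f (heckeOp q r u) = heckeOp q r (qSchur_val f u).
    have := qSchurP f (presPi (heckeRel q) (gen F r)) u.
    by rewrite !(heckeAct_gen q0).
  have [x xE] := rho1 (qSchur_val f) fT.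
  by exists x; apply: eqS => u; rewrite schurMapE xE.
by exists g => // x; apply: map_inj; rewrite gK.
Qed.

End Presentation.

(** * Positivity in Q(v) *)

Lemma lead_coefD_gt0 (R : realDomainType) (p r : {poly R}) :
  0 < lead_coef p -> 0 < lead_coef r -> 0 < lead_coef (p + r).
Proof.
move=> p0 r0; case: (ltngtP (size p) (size r)) => [lt|lt|E].
- by rewrite lead_coefDr.
- by rewrite lead_coefDl.
have pr : 0 < (p + r)`_(size p).-1 by rewrite coefD {2}E; apply: addr_gt0.
rewrite /lead_coef; have -> // : size (p + r) = size p.
apply/eqP; rewrite eqn_leq (leq_trans (size_polyD _ _)) ?E ?maxnn //= -E.
have sp : (0 < size p)%N by rewrite size_poly_gt0 -lead_coef_eq0 gt_eqF.
rewrite -(prednK sp) ltnNge; apply/negP => le.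
by rewrite nth_default // ltxx in pr.
Qed.

(* The positive cone of the ordering of Q(v) in which v is infinitely large. *)
Definition Qv_pos (x : Qv) := exists p r : {poly rat},
  [/\ 0 < lead_coef p, 0 < lead_coef r & x = tofrac p / tofrac r].

Lemma tofrac_neq0 (r : {poly rat}) : 0 < lead_coef r -> tofrac r != 0.
Proof. by move=> r0; rewrite tofrac_eq0 -lead_coef_eq0 gt_eqF. Qed.

Lemma Qv_posD a b : Qv_pos a -> Qv_pos b -> Qv_pos (a + b).
Proof.
case=> p [r [p0 r0 ->]] [p' [r' [p'0 r'0 ->]]].
exists (p * r' + p' * r), (r * r'); split.
- by apply: lead_coefD_gt0; rewrite lead_coefM mulr_gt0.
- by rewrite lead_coefM mulr_gt0.
by rewrite addf_div ?tofrac_neq0 // rmorphD !rmorphM.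
Qed.

Lemma Qv_posM a b : Qv_pos a -> Qv_pos b -> Qv_pos (a * b).
Proof.
case=> p [r [p0 r0 ->]] [p' [r' [p'0 r'0 ->]]].
exists (p * p'), (r * r'); split; rewrite ?lead_coefM ?mulr_gt0 //.
by rewrite mulf_div !rmorphM.
Qed.

Lemma Qv_pos0 : ~ Qv_pos 0.
Proof.
case=> p [r [p0 r0 /esym/eqP]].
by rewrite mulf_eq0 invr_eq0 !(negPf (tofrac_neq0 _)).
Qed.

Lemma v_neq0 : v != 0.
Proof. by rewrite /v tofrac_eq0 polyX_eq0. Qed.

Lemma v_expn m : v ^+ m = tofrac 'X^m.
Proof. by rewrite /v rmorphXn. Qed.

Lemma Qv_posX (k : int) : Qv_pos (v ^ k).
Proof.
have pX m : 0 < lead_coef ('X^m : {poly rat}) by rewrite lead_coefXn.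
case: k => m.
  exists 'X^m, 1; split; rewrite ?lead_coef1 // rmorph1 divr1.
  exact: v_expn.
exists 1, 'X^(m.+1); split; rewrite ?lead_coef1 // rmorph1 div1r -v_expn.
by [].
Qed.

Lemma v_inj (a b : int) : v ^ a = v ^ b -> a = b.
Proof.
have vX m : v ^+ m = 1 -> m = 0%N.
  rewrite v_expn -[1]/(tofrac 1) => /eqP; rewrite tofrac_eq => /eqP E.
  by have := congr1 (size : {poly rat} -> nat) E; rewrite size_polyXn size_poly1 => -[].
move=> E; apply/eqP; rewrite -subr_eq0; apply/eqP.
have : v ^ (a - b) = 1 by rewrite expfzDr ?v_neq0 // E -expfzDr ?v_neq0 // subrr.
case: (a - b) => m; first by move/vX->.
by rewrite NegzE -invr_expz => /(congr1 GRing.inv); rewrite invrK invr1 => /vX.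
Qed.

Theorem mainTheorem5 (n d : nat) (hn : (1 <= n)%N) (hd : (1 <= d)%N) :
  exists f : schurPres n d v -> qSchur n d v,
    [/\ linear f, monoid_morphism f & bijective f].
Proof.
case: n hn => // n' _.
have v2 : v - v^-1 != 0.
  rewrite subr_eq0; apply/eqP => E.
  by have := @v_inj 1 (-1); rewrite expr1z exprN1 => /(_ E).
eexists; exact: (@schurMap_iso Qv v n' d v_neq0 v2 v_inj Qv_pos Qv_posD Qv_posM Qv_posX Qv_pos0).
Qed.
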